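(* Let $x>0$ and $\lambda>0$ be constants. Suppose $\overline H$ is a solution of \[ \begin{cases} \min\big\{-\overline H''(p)+\Phi(\overline H'(p),p),\ \overline H(p)-\lambda\eta(p)\big\}=0, & \text{for a.e. } p\in(\bar p_\lambda,1);\\[1mm] \overline H(1)=0,\qquad \overline H'(p)=\dfrac{\partial V}{\partial x}(0,p)\ \text{ for } p\in(0,\bar p_\lambda]. \end{cases} \] Define $\overline Q(p)=\mathfrak S(\overline H'(p),p)$ for $p\in(0,1)$. If \[\int_0^1\overline Q(p)Q_\rho(1-p)\,dp=x,\] then $\overline Q$ is the unique optimal solution to \[\sup_{Q\in\mathscr Q^+}\int_0^1V(Q(p),p)\,dp\quad\text{subject to}\quad\int_0^1Q(p)Q_\rho(1-p)\,dp=x.\] Moreover, $\overline X=\overline Q(1-F_\rho(\rho))$ is the unique (up to almost sure equality) optimal solution to \[\sup_{X\in L^0_{\mathcal F_T}}J_\alpha(X)\quad\text{subject to}\quad\mathbb E[\rho X]\le x,\ X\ge0.\]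
   Context: Quantiles. For a distribution function $G$, its quantile is $Q_G(p)=\inf\{z\in\mathbb R: G(z)>p\}$, $p\in(0,1)$ (right-continuous inverse), extended by limits to $p=0,1$; for a random variable $Y$ with distribution function $F_Y$, $Q_Y:=Q_{F_Y}$. $\mathscr Q^+$ is the set of all right-continuous non-decreasing functions $Q:(0,1)\to[0,\infty)$. Probability space. $(\Omega,\mathbb F,\mathbb P)$ is a complete probability space carrying an $m$-dimensional standard Brownian motion $W$ with augmented filtration $\{\mathcal F_t\}$, and $T>0$; $\mathcal F_T\subsetneq\mathbb F$. ''Random variable'' means $\mathbb F$-measurable; $L^0_{\mathcal F_T}$ is the set of $\mathcal F_T$-measurable random variables. $X\sim Y$ means equality in distribution. Utility and claim. $u(x)=-\int_0^\infty e^{-\gamma x}\,dF(\gamma)$, $x\in\mathbb R$, where $F$ is a non-zero distribution function ($dF$ is a non-zero finite Borel measure, not necessarily of mass one) supported on a compact subset of $(0,\infty)$. $\vartheta$ is a random variable (the intractable claim) whose quantile $Q_\vartheta$ is Lipschitz continuous and differentiable on $[0,1]$ (so $\vartheta$ is bounded). For a fixed $\alpha\in[0,1]$, \[J_\alpha(X)=(1-\alpha)\inf_{Y\sim\vartheta}\mathbb E[u(X+Y)]+\alpha\sup_{Y\sim\vartheta}\mathbb E[u(X+Y)],\] (inf and sup over all random variables $Y$ with the law of $\vartheta$), and \[V(x,p)=(1-\alpha)u(x+Q_\vartheta(p))+\alpha u(x+Q_\vartheta(1-p)),\quad x\in\mathbb R,\ p\in(0,1).\] Pricing kernel. $r$ (interest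 rate, bounded below) and $\theta$ (market price of risk, not identically zero, $\int_0^T|\theta(t)|^2dt<\infty$ a.s.) are $\{\mathcal F_t\}$-progressively measurable and $Z(t)=\exp(-\int_0^t\theta(s)^\top dW(s)-\frac12\int_0^t|\theta(s)|^2ds)$ is a true martingale on $[0,T]$. Then $\rho=\exp\big(-\int_0^T(r(s)+\frac12|\theta(s)|^2)ds-\int_0^T\theta(s)^\top dW(s)\big)$; so $\rho>0$ and $\mathbb E[\rho]<\infty$. It is assumed that $Q_\rho$ is continuously differentiable, $Q_\rho(0)=0$ and $Q_\rho(1)=+\infty$; it is asserted as a consequence of these conditions that the distribution function $F_\rho$ of $\rho$ is continuous and $F_\rho(\rho)$ is uniform on $(0,1)$. Other notation. For each $p\in(0,1)$, $x\mapsto\frac{\partial V}{\partial x}(x,p)$ is a strictly decreasing bijection from $\mathbb R$ onto $(0,\infty)$; $\mathfrak S(y,p)$, for $y>0$, denotes the unique real number with $\frac{\partial V}{\partial x}(\mathfrak S(y,p),p)=y$. $\Phi(y,p)=\frac{\partial^2V}{\partial x\partial p}(\mathfrak S(y,p),p)$. $\eta(p)=-\int_p^1Q_\rho(1-s)\,ds$, $p\in[0,1]$; $\bar p_\lambda=\sup\{p\in(0,1):\lambda Q_\rho(1-p)\ge u'(Q_\vartheta(0))\}\in(0,1)$. *)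

(* Defs.v *)
From mathcomp Require Export all_boot all_order all_algebra.
From mathcomp Require Export all_classical all_reals all_analysis.
Export numFieldNormedType.Exports.

Set Implicit Arguments.
Unset Strict Implicit.
Unset Printing Implicit Defensive.

Import Order.TTheory GRing.Theory Num.Theory.

Local Open Scope classical_set_scope.
Local Open Scope ring_scope.

Section general.
Context {R : realType}.

Definition optimal (A : Type) (feasible : set A) (obj : A -> \bar R) (a : A) :=
  feasible a /\ forall b, feasible b -> (obj b <= obj a)%E.

Definition differentiable_within (D : set R) (f : R -> R) :=
  forall p, D p -> cvg ((f q - f p) / (q - p) @[q --> within D p^']).

(* Finitely many non-overlapping intervals can be listed from left to right. *)
Definition abs_continuous (a b : R) (f : R -> R) :=
  forall e, 0 < e -> exists2 d, 0 < d &
    forall (n : nat) (s t : nat -> R),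
      (forall k, (k < n)%N -> [/\ a <= s k, s k <= t k & t k <= b]) ->
      (forall k, (k.+1 < n)%N -> t k <= s k.+1) ->
      \sum_(k < n) (t k - s k) < d ->
      \sum_(k < n) `|f (t k) - f (s k)| < e.

Definition quantile (G : R -> R) (p : R) : R := inf [set z | p < G z].

(* The quantile of a bounded variable, extended by its limits at 0 and 1. *)
Definition quantile01 (G : R -> R) (p : R) : R :=
  if p <= 0 then lim (quantile G q @[q --> 0^'+])
  else if 1 <= p then lim (quantile G q @[q --> 1^'-])
  else quantile G p.

(* Elements of Q^+ are functions on (0,1); their values elsewhere are junk. *)
Definition Qplus : set (R -> R) := [set Q : R -> R |
  [/\ (forall p, 0 < p < 1 -> 0 <= Q p),
      (forall p q, 0 < p -> p <= q -> q < 1 -> Q p <= Q q) &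
      (forall p, 0 < p < 1 -> Q q @[q --> p^'+] --> Q p)]].

End general.

Section probability.
Context {R : realType} {d : measure_display} {Omega : measurableType d}
  (P : probability Omega R).

Definition distr_fun (X : {RV P >-> R}) (z : R) : R := fine (cdf X z).

(* A measure is unconstrained on non-measurable sets, so the laws are compared
   on Borel sets only. *)
Definition same_law (X Y : {RV P >-> R}) :=
  forall A : set R, measurable A -> distribution P X A = distribution P Y A.

Definition measurable_wrt (F : set (set Omega)) (X : Omega -> R) :=
  forall A : set R, measurable A -> F (X @^-1` A).

Definition mutually_independent (I : finType) (X : I -> Omega -> R) :=
  forall A : I -> set R, (forall i, measurable (A i)) ->
    fine (P (\bigcap_(i in [set: I]) (X i @^-1` A i))) =
    \prod_(i : I) fine (P (X i @^-1` A i)).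

Definition cvg0_in_probability (X : nat -> Omega -> \bar R) :=
  forall e : R, 0 < e ->
    P [set w | (e%:E <= X n w)%E] @[n --> \oo] --> 0%E.

Section brownian.
Context {m : nat} (W : 'I_m -> R -> Omega -> R).

Definition brownian_motion :=
  [/\ (forall i t, 0 <= t -> measurable_fun setT (W i t)),
      (forall i, {ae P, forall w, W i 0 w = 0}),
      {ae P, forall w, forall i, {within `[0, +oo[, continuous (W i ^~ w)}},
      (forall i s t, 0 <= s -> s < t -> forall A : set R, measurable A ->
         P ((fun w => W i t w - W i s w) @^-1` A) =
         normal_prob 0 (Num.sqrt (t - s)) A) &
      (forall (n : nat) (t : nat -> R), 0 <= t 0%N ->
         (forall k, (k < n)%N -> t k <= t k.+1) ->
         mutually_independent (fun (ik : 'I_m * 'I_n) w =>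
           W ik.1 (t ik.2.+1) w - W ik.1 (t ik.2) w))].

Definition filtration_gen (t : R) : set (set Omega) :=
  [set A | exists i s (B : set R),
     [/\ 0 <= s, s <= t, measurable B & A = W i s @^-1` B]]
  `|` P.-negligible.

Definition augmented_filtration (t : R) : set (set Omega) :=
  <<s filtration_gen t >>.

Definition progressively_measurable (T : R) (X : R -> Omega -> R) :=
  forall t, 0 <= t <= T ->
    measurable_fun
      (`[0, t] `*` [set: g_sigma_algebraType (filtration_gen t)])
      (fun z : R * g_sigma_algebraType (filtration_gen t) => X z.1 z.2).

(* The process sum_(k < size) coef k * 1_(time k, time k.+1] *)
Record simple_process := SimpleProcess {
  sp_size : nat;
  sp_time : nat -> R;
  sp_coef : nat -> 'I_m -> Omega -> R }.

Definition simple_process_on (T : R) (phi : simple_process) :=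
  [/\ 0 <= sp_time phi 0%N,
      sp_time phi (sp_size phi) <= T,
      (forall k, (k < sp_size phi)%N -> sp_time phi k <= sp_time phi k.+1),
      (forall k i, (k < sp_size phi)%N ->
         measurable_wrt (augmented_filtration (sp_time phi k))
           (sp_coef phi k i)) &
      exists M : R, forall k i w, (k < sp_size phi)%N ->
        `|sp_coef phi k i w| <= M].

Definition sp_value (phi : simple_process) (i : 'I_m) (s : R) (w : Omega) : R :=
  \sum_(k < sp_size phi)
    sp_coef phi k i w * (sp_time phi k < s <= sp_time phi k.+1)%R%:R.

Definition sp_integral (phi : simple_process) (t : R) (w : Omega) : R :=
  \sum_(k < sp_size phi) \sum_(i < m) sp_coef phi k i w *
    (W i (Num.min t (sp_time phi k.+1)) w - W i (Num.min t (sp_time phi k)) w).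

Definition sqnorm (theta : 'I_m -> R -> Omega -> R) (s : R) (w : Omega) : R :=
  \sum_(i < m) theta i s w ^+ 2.

(* I t is a version of the Ito integral of theta^T dW over [0, t], obtained as
   the limit in probability of the integrals of simple processes; each I t is
   determined up to almost sure equality. *)
Definition ito_integral (T : R) (theta : 'I_m -> R -> Omega -> R)
    (I : R -> Omega -> R) :=
  (forall t, 0 <= t <= T -> measurable_wrt (augmented_filtration t) (I t)) /\
  exists phi : nat -> simple_process,
  [/\ (forall n, simple_process_on T (phi n)),
      cvg0_in_probability (fun n w =>
        \int[lebesgue_measure]_(s in `[0%R, T])
          (sqnorm (fun i s w => sp_value (phi n) i s w - theta i s w)
             s w)%:E)%E &
      (forall t, 0 <= t <= T -> cvg0_in_probability (fun n w =>
        `|sp_integral (phi n) t w - I t w|%:E))].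

Definition martingale (T : R) (Z : R -> Omega -> R) :=
  (forall t, 0 <= t <= T ->
     measurable_wrt (augmented_filtration t) (Z t) /\
     P.-integrable setT (EFin \o Z t)) /\
  (forall s t, 0 <= s -> s <= t -> t <= T ->
     forall A, augmented_filtration s A ->
       (\int[P]_(w in A) (Z t w)%:E = \int[P]_(w in A) (Z s w)%:E)%E).

End brownian.

Definition robust_utility (u : R -> R) (vartheta : {RV P >-> R}) (alpha : R)
    (X : Omega -> R) : \bar R :=
  let values := [set 'E_P[(fun w => u (X w + Y w)%R)]%E |
                   Y in [set Y : {RV P >-> R} | same_law Y vartheta]] in
  ((1 - alpha)%:E * ereal_inf values + alpha%:E * ereal_sup values)%E.

End probability.

Section quantile_problem.
Context {R : realType}.

Definition utility (mass : R) (F : cumulativeBounded 0 mass) (x : R) : R :=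
  - \int[lebesgue_stieltjes_measure F]_(g in `]0, +oo[) expR (- (g * x)).

Definition Vfun (u Qth : R -> R) (alpha x p : R) : R :=
  (1 - alpha) * u (x + Qth p) + alpha * u (x + Qth (1 - p)).

(* V_x and V_xp (x outermost) at (x, p) *)
Definition dx (V : R -> R -> R) (x p : R) : R := derive1 (fun y => V y p) x.

Definition dxdp (V : R -> R -> R) (x p : R) : R :=
  derive1 (fun y => derive1 (V y) p) x.

(* The solution z of V_x(z, p) = y, unique when y > 0 *)
Definition Sfun (V : R -> R -> R) (y p : R) : R := get [set z | dx V z p = y].

Definition Phi (V : R -> R -> R) (y p : R) : R := dxdp V (Sfun V y p) p.

Definition eta (Qrho : R -> R) (p : R) : R :=
  - \int[lebesgue_measure]_(s in `]p, 1[) Qrho (1 - s).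

Definition pbar (u Qth Qrho : R -> R) (lambda : R) : R :=
  sup [set p | 0 < p < 1 /\ derive1 u (Qth 0) <= lambda * Qrho (1 - p)].

(* Solutions are strong: H' is locally absolutely continuous in (0,1) and H'' is
   its almost everywhere derivative. Positivity of H' is what makes
   Sfun V (H' p) p and Phi V (H' p) p meaningful. *)
Definition solution (V : R -> R -> R) (Qrho : R -> R) (lambda p0 : R)
    (H : R -> R) :=
  [/\ [/\ (forall p, 0 < p < 1 -> derivable H p 1),
          (forall a b, 0 < a -> a <= b -> b < 1 -> abs_continuous a b (derive1 H)),
          (forall p, 0 < p < 1 -> 0 < derive1 H p) &
          H p @[p --> 1^'-] --> H 1],
      {ae lebesgue_measure, forall p, p0 < p < 1 ->
         derivable (derive1 H) p 1 /\
         Num.min (- derive1 (derive1 H) p + Phi V (derive1 H p) p)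
           (H p - lambda * eta Qrho p) = 0},
      H 1 = 0 &
      (forall p, 0 < p <= p0 -> derive1 H p = dx V 0 p)].

Definition quantile_budget (Qrho : R -> R) (Q : R -> R) : \bar R :=
  (\int[lebesgue_measure]_(p in `]0%R, 1%R[) (Q p * Qrho (1 - p)%R)%:E)%E.

Definition quantile_value (V : R -> R -> R) (Q : R -> R) : \bar R :=
  (\int[lebesgue_measure]_(p in `]0%R, 1%R[) (V (Q p) p)%:E)%E.

End quantile_problem.

(* Main.v *)
Require Import Defs.
From mathcomp Require Import lra ring.
From mathcomp Require Import measurable_realfun.
From HB Require Import structures.

Set Implicit Arguments.
Unset Strict Implicit.
Unset Printing Implicit Defensive.

Import Order.TTheory GRing.Theory Num.Theory.

Local Open Scope classical_set_scope.
Local Open Scope ring_scope.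

(* A claim X is coupled with a uniform variable U having X comonotone with U: U
   ranks the sample points by X, ties being broken by decreasing rho, which is
   possible because rho has no atoms. By the Hardy-Littlewood inequality (applied
   under the integral defining u), Q_theta(U) and Q_theta(1 - U) are the worst and
   the best copies of the intractable claim for X, so J(X) = E[V(X, U)]; the same
   inequality gives E[Q_rho(1 - U) X] <= E[rho X] <= x. For X = 0 the rank is
   1 - F_rho(rho), which handles the candidate and the quantile problem.

   By concavity V(X, U) <= V(Qbar(U), U) + H'(U) (X - Qbar(U)). The obstacle
   condition says that the integral of H' over (a, 1) is at most lambda times that
   of Q_rho(1 - .), so slicing X along its upper level sets, which are upper level
   sets of U, gives E[H'(U) X] <= lambda E[Q_rho(1 - U) X]. For X = Qbar(U) this is
   an equality: Qbar is absolutely continuous, increases only where the obstacle is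
   touched, and a(z) = inf {Qbar > z} is such a point. Hence E[V(X, U)] is at most
   E[V(Qbar(U), U)], with equality only if X = Qbar(U) almost surely. In that case
   X and Xbar have the same law and the same cost, and since rho has no atoms the
   equality case of Hardy-Littlewood gives X = Xbar. *)

(** * Layer cake and rearrangement *)

(** Competitors come with no integrability, and expected utilities may be infinite. The comparison
    of objectives therefore uses [v0 = - V], which is positive: every integrand is non-negative, and
    only finite quantities such as [lambda * x] are cancelled.

    The second difficulty is the regularity of the candidate. It is given implicitly by
    [V_x (Qbar p, p) = H' p], and [H'] is differentiable only almost everywhere. Upper and lower
    Lipschitz bounds on [V_x] carry absolute continuity over from [H'] to [Qbar]. The inequality
    between [H''] and [V_xp] then yields one-sided slope bounds for [Qbar] at almost every point,
    which a covering argument integrates to monotonicity.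

    The calculus of [V] rests on one inequality: [1 + t <= exp t], integrated against the mixing
    measure, makes each derivative of the mixture supply tangents to the preceding one.

    The ranking variable is built on the given space. The rank of a point is the probability of its
    lower set, and its uniformity is a fact about total preorders whose ties are null. *)

Section restrict.
Context (T : Type) (R : realType) (D : set T) (t : T).

Lemma restrict_in (f : T -> R) : D t -> (f \_ D) t = f t.
Proof. by move=> Dt; rewrite patchE mem_set. Qed.

Lemma restrict_out (f : T -> R) : ~ D t -> (f \_ D) t = 0.
Proof. by move=> Dt; rewrite patchE memNset. Qed.

Lemma erestrict_in (f : T -> \bar R) : D t -> (f \_ D) t = f t.
Proof. by move=> Dt; rewrite patchE mem_set. Qed.

Lemma erestrict_out (f : T -> \bar R) : ~ D t -> (f \_ D) t = 0%E.
Proof. by move=> Dt; rewrite patchE memNset. Qed.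

End restrict.

Section comparison_sets.
Context d (T : measurableType d) (R : realType) (f g : T -> R).
Hypotheses (mf : measurable_fun setT f) (mg : measurable_fun setT g).

Lemma measurable_set_ltr : measurable [set t | f t < g t].
Proof.
rewrite -[X in measurable X]setTI.
have : measurable_fun setT (fun t => f t < g t) by exact: measurable_fun_ltr.
by move=> /(_ measurableT [set true]); apply.
Qed.

Lemma measurable_set_ler : measurable [set t | f t <= g t].
Proof.
rewrite -[X in measurable X]setTI.
have : measurable_fun setT (fun t => f t <= g t) by exact: measurable_fun_ler.
by move=> /(_ measurableT [set true]); apply.
Qed.

End comparison_sets.

Lemma measurable_set_eqr d (T : measurableType d) (R : realType) (f g : T -> R) :
  measurable_fun setT f -> measurable_fun setT g -> measurable [set t | f t = g t].
Proof.
move=> mf mg; have -> : [set t | f t = g t] = [set t | f t <= g t] `&` [set t | g t <= f t].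
  apply/seteqP; split => t /=; first by move=> ->; rewrite lexx.
  by move=> [fg gf]; apply/eqP; rewrite eq_le fg gf.
by apply: measurableI; exact: measurable_set_ler.
Qed.

Lemma measurable_set_itvoo d (T : measurableType d) (R : realType) (f : T -> R) (a b : R) :
  measurable_fun setT f -> measurable [set t | a < f t < b].
Proof.
move=> mf; have -> : [set t | a < f t < b] = [set t | a < f t] `&` [set t | f t < b].
  by apply/seteqP; split => t /=; [move=> /andP[]|move=> [-> ->]].
by apply: measurableI; exact: measurable_set_ltr.
Qed.

Section layer_cake.
Context d (T : measurableType d) (R : realType).
Variable mu : {sigma_finite_measure set T -> \bar R}.
Local Notation leb := (@lebesgue_measure R).

(** Tonelli for the integrand [g t * 1(0 < z < f t)]: integrating first in [z] restores the factor
    [f t]. An integral against [f] is thereby reduced to masses of upper level sets. *)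
Lemma ge0_layer_cake (D : set T) (f g : T -> R) : measurable D ->
  measurable_fun D f -> measurable_fun D g ->
  (forall t, D t -> 0 <= f t) -> (forall t, D t -> 0 <= g t) ->
  (\int[mu]_(t in D) (g t * f t)%:E =
   \int[leb]_(z in `]0%R, +oo[)
     \int[mu]_(t in D `&` [set t | (z < f t)%R]) (g t)%:E)%E.
Proof.
move=> mD mf mg f0 g0.
pose fD := f \_ D; pose gD := g \_ D.
have mfD : measurable_fun setT fD by apply/(measurable_restrictT _ _).1.
have mgD : measurable_fun setT gD by apply/(measurable_restrictT _ _).1.
have gD0 t : 0 <= gD t.
  by rewrite /gD patchE; case: ifPn => // /[!inE] /g0.
have fD0 t : 0 <= fD t.
  by rewrite /fD patchE; case: ifPn => // /[!inE] /f0.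
pose E : set (T * R) := [set p | 0 < p.2] `&` [set p | p.2 < fD p.1].
have mE : measurable E.
  apply: measurableI.
    exact: measurable_set_ltr.
  by apply: measurable_set_ltr => //; exact: measurableT_comp.
pose k (p : T * R) : \bar R := (gD p.1 * \1_E p)%:E.
have mk : measurable_fun setT k.
  apply/measurable_EFinP; apply: measurable_funM.
    exact: measurableT_comp.
  exact: measurable_indic.
have k0 p : (0 <= k p)%E by rewrite lee_fin mulr_ge0.
transitivity (\int[mu]_t \int[leb]_z k (t, z))%E.
  rewrite integral_mkcond; apply: eq_integral => t _.
  rewrite /k /=.
  under eq_integral do rewrite EFinM.
  rewrite ge0_integralZl//; last 2 first.
  - by apply/measurable_EFinP; apply: measurable_indic; have := measurable_xsection t mE;
    congr measurable; apply/seteqP; split => z; rewrite /xsection /= inE.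
  - by rewrite lee_fin.
  rewrite (_ : (fun z => _) = (fun z => (\1_(`]0, (fD t)[%classic) z)%:E)); last first.
    apply/funext => z; congr EFin; rewrite !indicE; congr (nat_of_bool _)%:R.
    by apply/idP/idP; rewrite !inE /E /= in_itv /=; [case=> -> ->|move=> /andP[]].
  rewrite integral_indic//= setIT lebesgue_measure_itv /= lte_fin.
  have [Dt|Dt] := pselect (D t); last first.
    by rewrite erestrict_out// /gD restrict_out// mul0e.
  rewrite erestrict_in// /gD /fD !restrict_in// EFinM; congr (_ * _)%E.
  have := f0 _ Dt; rewrite le_eqVlt => /predU1P[<-|ft]; first by rewrite ltxx.
  by rewrite ft sube0.
rewrite (@fubini_tonelli _ _ _ _ _ mu leb k mk k0)// [RHS]integral_mkcond.
apply: eq_integral => z _; rewrite patchE; case: ifPn.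
  rewrite inE /= in_itv /= andbT => z0.
  rewrite [RHS]integral_mkcond; apply: eq_integral => t _.
  rewrite /k /= indicE.
  have [tD|tD] := pselect (D t); last first.
    by rewrite /gD restrict_out// mul0r erestrict_out//; case.
  rewrite /gD restrict_in//.
  have [zf|zf] := pselect (z < f t).
    by rewrite mem_set ?mulr1 ?erestrict_in//; split => //=; rewrite /fD restrict_in.
  by rewrite memNset ?mulr0 ?erestrict_out//; [case|case; rewrite /= /fD restrict_in].
rewrite notin_setE /= in_itv /= andbT => z0.
apply: integral0_eq => t _; rewrite /k /= indicE memNset ?mulr0//.
by case.
Qed.

Lemma measurable_layer (D : set T) (A h : T -> R) : measurable D ->
  measurable_fun D A -> measurable_fun D h -> (forall t, D t -> 0 <= A t) ->
    measurable_fun (`]0%R, +oo[ : set R)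
  (fun z : R => \int[mu]_(t in D `&` [set t | (z < h t)%R]) (A t)%:E)%E.
Proof.
move=> mD mA mh A0; apply: (@measurable_funS _ _ _ _ setT) => //.
pose AD := A \_ D; pose hD := h \_ D.
have mAD : measurable_fun setT AD by apply/(measurable_restrictT _ _).1.
have mhD : measurable_fun setT hD by apply/(measurable_restrictT _ _).1.
pose E : set (T * R) := [set p | p.2 < hD p.1].
have mE : measurable E.
  by apply: measurable_set_ltr => //; exact: measurableT_comp.
pose k (p : T * R) : \bar R := (AD p.1 * \1_E p)%:E.
have mk : measurable_fun setT k.
  apply/measurable_EFinP; apply: measurable_funM.
    exact: measurableT_comp.
  exact: measurable_indic.
have k0 p : (0 <= k p)%E.
  rewrite lee_fin mulr_ge0//.
  by rewrite /AD patchE; case: ifPn => // /[!inE] /A0.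
have := @measurable_fun_fubini_tonelli_G _ _ T R R mu k mk k0.
apply: eq_measurable_fun => z _.
rewrite /fubini_G [RHS]integral_mkcond; apply: eq_integral => t _.
rewrite /k /= indicE.
have [tD|tD] := pselect (D t); last first.
  by rewrite /AD restrict_out// mul0r erestrict_out//; case.
rewrite /AD restrict_in//.
have [zf|zf] := pselect (z < h t).
  by rewrite mem_set ?mulr1 ?erestrict_in// /E /= /hD restrict_in.
by rewrite memNset ?mulr0 ?erestrict_out//; [case|rewrite /E /= /hD restrict_in].
Qed.

End layer_cake.

Section rearrangement.
Context d (T : measurableType d) (R : realType) (P : probability T R).
Local Notation leb := (@lebesgue_measure R).

(** The two integrals share the part over the intersection. The two differences have equal
    probability, and the constant [c], the infimum of [A] over one of them, separates the values of
    [A]. *)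
Lemma bathtub (A : T -> R) (S D : set T) : measurable S -> measurable D ->
  measurable_fun (S `|` D) A -> (forall t, (S `|` D) t -> 0 <= A t) ->
  P S = P D ->
  (forall s t, (S `\` D) s -> (D `\` S) t -> A s <= A t) ->
  (\int[P]_(t in S) (A t)%:E <= \int[P]_(t in D) (A t)%:E)%E.
Proof.
move=> mS mD mA A0 PSD cA.
have mSD : measurable (S `\` D) by exact: measurableD.
have mDS : measurable (D `\` S) by exact: measurableD.
have mI : measurable (S `&` D) by exact: measurableI.
have PE : P (S `\` D) = P (D `\` S).
  rewrite !measureD ?PSD ?(setIC S D)// ?PSD//.
  + by congr (_ - _)%E.
  + by rewrite -ge0_fin_numE// fin_num_measure.
  + by rewrite -ge0_fin_numE// fin_num_measure.
have mA' B : B `<=` S `|` D -> measurable_fun B (EFin \o A).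
  move=> BS; apply/measurable_EFinP; apply: measurable_funS mA => //.
  exact: measurableU.
have split_ X Y : measurable X -> measurable Y -> (X `<=` S `|` D) ->
    (\int[P]_(t in X) (A t)%:E = \int[P]_(t in X `&` Y) (A t)%:E +
      \int[P]_(t in X `\` Y) (A t)%:E)%E.
  move=> mX mY XS; rewrite -ge0_integral_setU//.
  - congr (integral _ _ _); apply/seteqP; split => [t Xt|t [[]|[]]//];
    by have [Yt|Yt] := pselect (Y t); [left|right].
  - exact: measurableI.
  - exact: measurableD.
  - apply: mA'; move=> t [[Xt _]|[Xt _]]; exact: XS.
  - by move=> t [[Xt _]|[Xt _]]; rewrite lee_fin A0//; exact: XS.
  - by apply/disj_setPS => t [[_ Yt] [_ nYt]].
rewrite (split_ S D)// (split_ D S)// setIC; apply: leeD => //.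
(* The infimum of an empty set would be a default value, so an empty difference is treated first;
   then the other difference is null. *)
have [[t0 Dt0]|D0] := pselect (exists t, (D `\` S) t); last first.
  have : P (S `\` D) = 0%E.
    rewrite PE (_ : D `\` S = set0) ?measure0//; apply/seteqP; split => // t Dt.
    by apply: D0; exists t.
  move=> P0; rewrite null_set_integral//; last by apply: mA' => t [St _]; left.
  by apply: integral_ge0 => t [Dt _]; rewrite lee_fin A0//; right.
pose c := inf [set A t | t in D `\` S].
have hinf : has_inf [set A t | t in D `\` S].
  split; first by exists (A t0); exists t0.
  by exists 0 => _ [t [Dt _] <-]; apply: A0; right.
have c0 : 0 <= c.
  by apply: lb_le_inf; [exact: hinf.1|move=> _ [t [Dt _] <-]; apply: A0; right].
apply: (@le_trans _ _ (\int[P]_(t in S `\` D) (cst c%:E t)))%E.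
  apply: ge0_le_integral => //.
  - by move=> t [St _]; rewrite lee_fin A0//; left.
  - by apply: mA' => t [St _]; left.
  - move=> t SDt; rewrite lee_fin; apply: lb_le_inf; first exact: hinf.1.
    by move=> _ [t' Dt' <-]; apply: cA.
have -> : (\int[P]_(t in S `\` D) cst c%:E t = \int[P]_(t in D `\` S) cst c%:E t)%E.
  by rewrite !integral_cst//; congr (_ * _)%E.
apply: ge0_le_integral => //.
- by apply: mA' => t [St _]; right.
- move=> t DSt; rewrite lee_fin; apply: ge_inf; first exact: hinf.2.
  by exists t.
Qed.

Section hl.
Variables (D : set T) (A f g : T -> R).
Hypothesis mD : measurable D.
Hypotheses (mA : measurable_fun D A) (mf : measurable_fun D f)
  (mg : measurable_fun D g).
Hypotheses (A0 : forall t, D t -> 0 <= A t) (f0 : forall t, D t -> 0 <= f t)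
  (g0 : forall t, D t -> 0 <= g t).
Hypothesis fg : forall z : R, 0 < z ->
  P (D `&` [set t | z < f t]) = P (D `&` [set t | z < g t]).

Let mlevel (h : T -> R) z : measurable_fun D h ->
  measurable (D `&` [set t | z < h t]).
Proof.
move=> mh; have : measurable_fun D (fun t => z < h t) by exact: measurable_fun_ltr.
by move=> /(_ mD [set true]); apply.
Qed.

(** At each level [z] the upper level sets of [f] and [g] have the same probability, and [A] is
    largest on that of [f], so [bathtub] compares the layers. Ties of [f] leave [A] unconstrained.
    The antimonotone version below exchanges the two sides. *)
Lemma integral_comonotone_max :
  (forall s t, D s -> D t -> f s < f t -> A s <= A t) ->
  (\int[P]_(t in D) (A t * g t)%:E <= \int[P]_(t in D) (A t * f t)%:E)%E.
Proof.
move=> cA; rewrite !ge0_layer_cake//; apply: ge0_le_integral => //.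
- move=> z z0; apply: integral_ge0 => t [Dt _]; rewrite lee_fin; exact: A0.
- exact: (measurable_layer P mD mA mg A0).
- exact: (measurable_layer P mD mA mf A0).
move=> z; rewrite /= in_itv /= andbT => z0.
apply: bathtub.
- exact: mlevel.
- exact: mlevel.
- by apply: measurable_funS mA => // t [[]|[]].
- by move=> t [[Dt _]|[Dt _]]; exact: A0.
- by rewrite fg.
- move=> s t [[Ds zs] nDs] [[Dt zt] _]; apply: cA => //.
  apply: le_lt_trans zt => /=; rewrite leNgt; apply/negP => zfs; exact: nDs.
Qed.

Lemma integral_antimonotone_min :
  (forall s t, D s -> D t -> f s < f t -> A t <= A s) ->
  (\int[P]_(t in D) (A t * f t)%:E <= \int[P]_(t in D) (A t * g t)%:E)%E.
Proof.
move=> cA; rewrite !ge0_layer_cake//; apply: ge0_le_integral => //.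
- move=> z z0; apply: integral_ge0 => t [Dt _]; rewrite lee_fin; exact: A0.
- exact: (measurable_layer P mD mA mf A0).
- exact: (measurable_layer P mD mA mg A0).
move=> z; rewrite /= in_itv /= andbT => z0.
apply: bathtub.
- exact: mlevel.
- exact: mlevel.
- by apply: measurable_funS mA => // t [[]|[]].
- by move=> t [[Dt _]|[Dt _]]; exact: A0.
- by rewrite fg.
- move=> t s [[Dt zt] nDs] [[Ds zs] nDt]; apply: cA => //.
  apply: le_lt_trans zt => /=; rewrite leNgt; apply/negP => zfs; exact: nDt.
Qed.

End hl.
End rearrangement.

(** * Uniform variables and ranks *)

Section uniqueness_from_cdf.
Context (R : realType).

(** Half-lines are stable under intersection and generate the Borel sets; finiteness of [m1] makes
    the half-lines ending at the integers an admissible exhaustion. *)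
Lemma finite_measure_itvNyc_unique
    (m1 m2 : {measure set (measurableTypeR R) -> \bar R}) :
  (m1 setT < +oo)%E ->
  (forall x : R, m1 `]-oo, x]%classic = m2 `]-oo, x]%classic) ->
  forall A, measurable A -> m1 A = m2 A.
Proof.
move=> m1oo m12.
pose G : set (set R) := [set A | exists x : R, A = `]-oo, x]%classic].
pose g (k : nat) : set R := `]-oo, k%:R]%classic.
have mG : (@measurable _ (measurableTypeR R)) = G.-sigma.-measurable.
  rewrite eqEsubset; split => A.
    apply: smallest_sub; first exact: smallest_sigma_algebra.
    move=> _ [[a b] _ <-].
    rewrite (_ : [set` _] = `]-oo, b]%classic `\` `]-oo, a]%classic); last first.
      apply/seteqP; split => z /=; rewrite !in_itv /=.
        by move=> /andP[az zb]; split => //; apply/negP; rewrite -ltNge.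
      by move=> [-> /negP]; rewrite -ltNge => ->.
    apply: measurableD.
      by apply: sub_sigma_algebra; exists b.
    by apply: sub_sigma_algebra; exists a.
  apply: smallest_sub; first exact: sigma_algebra_measurable.
  by move=> _ [x ->]; exact: measurable_itv.
apply: (@measure_unique _ R (measurableTypeR R) G g mG) => //.
- move=> _ _ [x ->] [y ->]; exists (Num.min x y).
  by apply/seteqP; split => z; rewrite /= !in_itv /= le_min; [case=> -> ->|move=> /andP[]].
- by move=> i; exists i%:R.
- apply/seteqP; split => // z _; exists (Num.Def.archi_bound `|z|) => //=.
  by rewrite /g /= in_itv /= (le_trans (ler_norm z))// ltW// archi_boundP.
- by move=> A [x ->]; exact: m12.
- move=> k; apply: le_lt_trans m1oo; apply: le_measure; rewrite ?inE//=.
  exact: measurable_itv.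
Qed.

End uniqueness_from_cdf.

Section uniform.
Context d (T : measurableType d) (R : realType) (P : probability T R).
Local Notation leb := (@lebesgue_measure R).

(** Values outside []0, 1]] are excluded only up to a null set, which is why later statements carry
    a set of full probability on which [0 < U < 1]. *)
Definition uniform01 (U : T -> R) :=
  measurable_fun setT U /\
  forall p, 0 <= p <= 1 -> P [set w | U w <= p] = p%:E.

Lemma uniform01_law (U : T -> R) : uniform01 U ->
  forall A : set R, measurable A -> P (U @^-1` A) = leb (A `&` `]0, 1]%classic).
Proof.
move=> [mU U01] A mA.
pose X : {mfun T >-> measurableTypeR R} := HB.pack U (isMeasurableFun.Build _ _ T
  (measurableTypeR R) U mU).
pose m1 := distribution P X.
pose m2 := mrestr leb (measurable_itv `]0, 1]).
transitivity (m1 A); first by [].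
transitivity (m2 A); last by [].
apply: finite_measure_itvNyc_unique mA.
  by apply: (@le_lt_trans _ _ 1%E); [exact: probability_le1|exact: ltry].
move=> x.
transitivity (P (U @^-1` `]-oo, x]%classic)); first by [].
transitivity (leb (`]-oo, x]%classic `&` `]0, 1]%classic)); last by [].
transitivity (P [set w | U w <= x]).
  by congr (P _); apply/seteqP; split => w; rewrite /= in_itv.
have [x0|x0] := ltP x 0.
  transitivity (0%E : \bar R).
    apply/eqP; rewrite eq_le measure_ge0 andbT.
    have <- : P [set w | U w <= 0] = 0%E by rewrite U01// lexx ler01.
    apply: le_measure; rewrite ?inE.
    - exact: measurable_set_ler.
    - exact: measurable_set_ler.
    - by move=> w /= /le_trans; apply; exact: ltW.
  rewrite (_ : _ `&` _ = set0) ?measure0//; apply/seteqP; split => // z [] /=.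
  by rewrite !in_itv /= => zx /andP[z0 _]; have := lt_le_trans z0 zx; rewrite ltNge (ltW x0).
have [x1|x1] := leP x 1.
  rewrite U01 ?x0//.
  rewrite (_ : _ `&` _ = `]0, x]%classic).
    by rewrite lebesgue_measure_itv /= lte_fin; case: ltgtP x0 => // [_|<-] _; rewrite ?sube0.
  apply/seteqP; split => z /=; rewrite !in_itv /=.
    by move=> [-> /andP[->]].
  by move=> /andP[-> zx]; rewrite zx (le_trans zx x1).
transitivity (1%E : \bar R).
  apply/eqP; rewrite eq_le probability_le1/=; last first.
    exact: measurable_set_ler.
  have <- : P [set w | U w <= 1] = 1%E by rewrite U01// lexx ler01.
  apply: le_measure; rewrite ?inE.
  - exact: measurable_set_ler.
  - exact: measurable_set_ler.
  - by move=> w /= /le_trans; apply; exact: ltW.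
rewrite (_ : _ `&` _ = `]0, 1]%classic).
  by rewrite lebesgue_measure_itv /= lte_fin ltr01 sube0.
apply/seteqP; split => z /=; rewrite !in_itv /=; first by case.
by move=> /andP[-> z1]; rewrite z1 (le_trans z1 (ltW x1)).
Qed.

Lemma uniform01_integral (U : T -> R) (f : R -> \bar R) : uniform01 U ->
  measurable_fun (`]0, 1[%classic : set R) f -> (forall p, 0 < p < 1 -> (0 <= f p)%E) ->
  (\int[P]_(w in [set w | (0 < U w < 1)%R]) f (U w) = \int[leb]_(p in `]0%R, 1%R[) f p)%E.
Proof.
move=> unifU mf f0; have [mU _] := unifU.
pose X : {mfun T >-> measurableTypeR R} := HB.pack U (isMeasurableFun.Build _ _ T
  (measurableTypeR R) U mU).
transitivity (\int[distribution P X]_(p in `]0%R, 1%R[) f p)%E.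
  rewrite ge0_integral_pushforward//.
  by move=> p; rewrite inE /= in_itv /=; exact: f0.
apply: eq_measure_integral => A mA A01.
transitivity (P (U @^-1` A)); first by [].
rewrite uniform01_law//; congr (leb _); apply/setIidPl => p /A01.
by rewrite /= !in_itv /= => /andP[-> /ltW].
Qed.

Lemma uniform01_ae (U : T -> R) : uniform01 U -> P [set w | 0 < U w < 1] = 1%E.
Proof.
move=> uU.
have -> : [set w | 0 < U w < 1] = U @^-1` `]0, 1[%classic.
  by apply/seteqP; split => w /=; rewrite in_itv.
rewrite uniform01_law//.
rewrite (_ : _ `&` _ = `]0, 1[%classic).
  by rewrite lebesgue_measure_itv /= lte_fin ltr01 sube0.
apply/setIidPl => p /=.
by rewrite /= !in_itv /= => /andP[-> /ltW].
Qed.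

Lemma uniform01_onem (U : T -> R) : uniform01 U -> uniform01 (fun w => 1 - U w).
Proof.
move=> uU; have [mU _] := uU; split; first exact: measurable_funB.
move=> p /andP[p0 p1].
have -> : [set w | 1 - U w <= p] = U @^-1` `[1 - p, +oo[%classic.
  by apply/seteqP; split => w /=; rewrite in_itv /= andbT lerBlDr lerBlDl addrC.
rewrite uniform01_law//.
have [->|p0'] := eqVneq p 0.
  rewrite subr0 (_ : _ `&` _ = [set 1]) ?lebesgue_measure_set1//.
  apply/seteqP; split => q /=; rewrite !in_itv /= ?andbT.
    by move=> [q1 /andP[_ q1']]; apply/eqP; rewrite eq_le q1 q1'.
  by move=> ->; rewrite !lexx ltr01.
have [->|p1'] := eqVneq p 1.
  rewrite subrr (_ : _ `&` _ = `]0, 1]%classic).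
    by rewrite lebesgue_measure_itv /= lte_fin ltr01 sube0.
  apply/seteqP; split => q /=; rewrite !in_itv /= ?andbT; first by case.
  by move=> /andP[q0 q1]; rewrite q0 q1 (ltW q0).
rewrite (_ : _ `&` _ = `[1 - p, 1]%classic).
  rewrite lebesgue_measure_itv /= lte_fin ltrBlDr ltrDl lt_neqAle eq_sym p0' p0 /=.
  by rewrite -EFinB opprB addrC subrK.
have p1'' : p < 1 by rewrite lt_neqAle p1'.
apply/seteqP; split => q /=; rewrite !in_itv /= ?andbT.
  by move=> [-> /andP[_ ->]].
by move=> /andP[q0 q1]; rewrite q0 q1 (lt_le_trans _ q0)// subr_gt0.
Qed.

End uniform.

Section total_preorder.
Context d (T : measurableType d) (R : realType) (P : probability T R).
Variable L : set (T * T).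
Hypothesis mL : measurable L.
Hypothesis L_total : forall s t, L (s, t) \/ L (t, s).
Hypothesis L_trans : forall s t u, L (s, t) -> L (t, u) -> L (s, u).

Let rank t := P (ysection L t).

Lemma measurable_rank : measurable_fun setT rank.
Proof. exact: measurable_fun_ysection. Qed.

Let m_ysec t : measurable (ysection L t).
Proof. exact: measurable_ysection. Qed.

Let in_ysec s t : ysection L t s <-> L (s, t).
Proof. by rewrite /ysection /= inE. Qed.

Let rank_mono s t : L (s, t) -> ysection L s `<=` ysection L t.
Proof. by move=> st u /in_ysec us; apply/in_ysec/(L_trans us). Qed.

(* Along a sequence in [rank <= p] whose ranks tend to the supremum, the lower
   sets exhaust [rank <= p] up to a set B meeting no lower set of its elements
   in positive measure; by Fubini and totality, B has square measure 0. *)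
Lemma rank_le (p : \bar R) : (0 <= p)%E -> (P [set t | rank t <= p] <= p)%E.
Proof.
move=> p0; set S := [set t | _].
have mS : measurable S.
  rewrite -[X in measurable X]setTI.
  by apply: emeasurable_fun_infty_c => //; exact: measurable_rank.
have [S0|S0] := pselect (S = set0); first by rewrite S0 measure0.
have /set0P/cid[t0 St0] : S != set0 by exact/eqP.
pose E := [set rank t | t in S].
have E0 : E !=set0 by exists (rank t0), t0.
have [u uE ulim] : {u : nat -> \bar R | forall n, E (u n) & u n @[n --> \oo] --> ereal_sup E}.
  by apply: ereal_sup_seq; apply/set0P.
have /choice[t_ tE] : forall n, exists t, S t /\ rank t = u n.
  by move=> n; have [t St <-] := uE n; exists t.
(* [m_ n] is a largest element of [t_ 0], ..., [t_ n] for the preorder, so the lower sets of [m_]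
   increase with [n]. *)
pose m_ := fix m_ n := if n is k.+1 then
  if `[< L (t_ n, m_ k) >] then m_ k else t_ n else t_ 0%N.
have mS_ n : S (m_ n).
  elim: n => [|n ih] /=; first by have [] := tE 0%N.
  by case: ifPn => // _; have [] := tE n.+1.
have Lrefl t : L (t, t) by case: (L_total t t).
have Ltm n : L (t_ n, m_ n).
  by case: n => [|n] /=; [exact: Lrefl|case: ifPn => [/asboolP //|_]; exact: Lrefl].
have Lmm n : L (m_ n, m_ n.+1).
  rewrite /=; case: ifPn => [_|/asboolPn nL]; first exact: Lrefl.
  by case: (L_total (t_ n.+1) (m_ n)).
pose F n := ysection L (m_ n).
pose Linf := \bigcup_n F n.
have mLinf : measurable Linf by apply: bigcupT_measurable => n; exact: m_ysec.
have PLinf : (P Linf <= p)%E.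
  have : P (F n) @[n --> \oo] --> P Linf.
    apply: nondecreasing_cvg_mu => //; first by move=> n; exact: m_ysec.
    by apply/nondecreasing_seqP => n; apply/subsetPset; exact: rank_mono.
  move=> /cvg_lim <- //; apply: lime_le.
    apply: ereal_nondecreasing_is_cvgn; apply/nondecreasing_seqP => n.
    by apply: le_measure; rewrite ?inE //; [exact: m_ysec|exact: m_ysec|exact: rank_mono].
  by apply: nearW => n; exact: mS_.
pose B := S `\` Linf.
have mB : measurable B by exact: measurableD.
have BL t : B t -> P (B `&` ysection L t) = 0%E.
  move=> [St nLt].
  have LinfL : Linf `<=` ysection L t.
    move=> s [n _]; apply: rank_mono; case: (L_total (m_ n) t) => // tt.
    by exfalso; apply: nLt; exists n => //; exact/in_ysec.
  have Plim : (rank t <= P Linf)%E.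
    apply: (@le_trans _ _ (ereal_sup E)); first by apply: ereal_sup_ubound; exists t.
    rewrite -(cvg_lim _ ulim)//; apply: lime_le; first by apply/cvg_ex; exists (ereal_sup E).
    apply: nearW => n; have [_ <-] := tE n.
    apply: le_measure; rewrite ?inE//.
    by apply: subset_trans (@bigcup_sup _ _ n _ F _) => //; exact: rank_mono.
  (* [Linf] lies below [t] and already has at least the probability of the lower set of [t]. *)
  have PLL : P (ysection L t `\` Linf) = 0%E.
    rewrite measureD//; last by rewrite -ge0_fin_numE// fin_num_measure.
    rewrite setIidr//; apply/eqP; rewrite sube_eq ?fin_num_measure//.
      by rewrite add0e eq_le Plim /=; apply: le_measure; rewrite ?inE.
  apply/eqP; rewrite eq_le measure_ge0 andbT -PLL.
  apply: le_measure; rewrite ?inE.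
  - exact: measurableI.
  - exact: measurableD.
  - by move=> s [[_ nLs] Ls].
pose C := (B `*` B) `&` L.
have mC : measurable C by apply: measurableI => //; exact: measurableX.
pose f (z : T * T) : \bar R := (\1_C z)%:E.
have mf : measurable_fun setT f by apply/measurable_EFinP; exact: measurable_indic.
have f0 z : (0 <= f z)%E by rewrite lee_fin.
have c1 : (\int[P]_t \int[P]_s f (s, t) = 0)%E.
  apply: integral0_eq => t _.
  rewrite (_ : (fun s => f (s, t)) = (fun s => (\1_(ysection C t) s)%:E)); last first.
    apply/funext => s; rewrite /f !indicE; congr (_%:R%:E).
    by rewrite mem_ysection.
  rewrite integral_indic//; last exact: measurable_ysection.
  rewrite setIT; have [Bt|Bt] := pselect (B t).
    rewrite -(BL _ Bt); congr (P _); apply/seteqP; split => s.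
      by rewrite /ysection /= inE => -[[? _] ?]; split => //; exact/in_ysec.
    by move=> [Bs /in_ysec Ls]; rewrite /ysection /= inE; split.
  rewrite (_ : ysection C t = set0) ?measure0//; apply/seteqP; split => // s.
  by rewrite /ysection /= inE => -[[]].
have c2 : (\int[P]_t \int[P]_s f (t, s) = 0)%E by rewrite (fubini_tonelli f).
have PB : (P B * P B = 0)%E.
  apply/eqP; rewrite eq_le mule_ge0// andbT -[leRHS]adde0 -{1}c1 -c2.
  rewrite -ge0_integralD//; last 4 first.
  - by move=> t _; exact: integral_ge0.
  - exact: measurable_fun_fubini_tonelli_G.
  - by move=> t _; exact: integral_ge0.
  - exact: measurable_fun_fubini_tonelli_F.
  have -> : (P B * P B = \int[P]_t (P B * (\1_B t)%:E))%E.
    rewrite ge0_integralZl//; last by apply/measurable_EFinP; exact: measurable_indic.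
    by rewrite integral_indic// setIT.
  apply: ge0_le_integral => //.
  - by move=> t _; rewrite mule_ge0// lee_fin.
  - apply: measurable_funeM; apply/measurable_EFinP; exact: measurable_indic.
  - by apply: emeasurable_funD; [exact: measurable_fun_fubini_tonelli_G|exact:
    measurable_fun_fubini_tonelli_F].
  move=> t _; rewrite -ge0_integralD//; last 2 first.
  - by apply: measurableT_comp => //; exact: measurable_fun_pair.
  - by apply: measurableT_comp => //; exact: measurable_fun_pair.
  have [Bt|Bt] := pselect (B t); last first.
    rewrite indicE memNset// mule0; apply: integral_ge0 => s _; exact: adde_ge0.
  rewrite indicE mem_set// mule1.
  have -> : (P B = \int[P]_s (\1_B s)%:E)%E by rewrite integral_indic// setIT.
  apply: ge0_le_integral => //.
  - by apply/measurable_EFinP; exact: measurable_indic.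
  - apply: emeasurable_funD; by apply: measurableT_comp => //; exact: measurable_fun_pair.
  move=> s _; rewrite indicE; have [Bs|Bs] := pselect (B s); last first.
    by rewrite memNset//; exact: adde_ge0.
  rewrite mem_set// /f !indicE.
  case: (L_total s t) => Lst.
    by rewrite mem_set ?leeDl//; split.
  by rewrite [in X in (_ + X)%E]mem_set ?leeDr//; split.
have PB0 : P B = 0%E by move/eqP: PB; rewrite mule_eq0 orbb => /eqP.
apply: le_trans PLinf; rewrite -[leRHS]adde0 -PB0.
apply: (@le_trans _ _ (P (Linf `|` B))); last exact: measureU2.
apply: le_measure; rewrite ?inE//.
  exact: measurableU.
by move=> t St; have [?|?] := pselect (Linf t); [left|right].
Qed.

End total_preorder.

Section rank_uniform.
Context d (T : measurableType d) (R : realType) (P : probability T R).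
Variable L : set (T * T).
Hypothesis mL : measurable L.
Hypothesis L_total : forall s t, L (s, t) \/ L (t, s).
Hypothesis L_trans : forall s t u, L (s, t) -> L (t, u) -> L (s, u).
Hypothesis L_null : forall t, P [set s | L (s, t) /\ L (t, s)] = 0%E.

Definition rank (t : T) : R := fine (P [set s | L (s, t)]).

Let ysecE t : ysection L t = [set s | L (s, t)].
Proof. by apply/seteqP; split => s; rewrite /ysection /= inE. Qed.

Let xsecE t : xsection L t = [set s | L (t, s)].
Proof. by apply/seteqP; split => s; rewrite /xsection /= inE. Qed.

Let m_ysec t : measurable [set s | L (s, t)].
Proof. by rewrite -ysecE; exact: measurable_ysection. Qed.

Let m_xsec t : measurable [set s | L (t, s)].
Proof. by rewrite -xsecE; exact: measurable_xsection. Qed.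

Let rankE t : (rank t)%:E = P [set s | L (s, t)].
Proof. by rewrite /rank fineK// fin_num_measure. Qed.

Lemma rank_homo s t : L (s, t) -> rank s <= rank t.
Proof.
move=> st; rewrite -lee_fin !rankE; apply: le_measure; rewrite ?inE//.
by move=> u /= us; exact: L_trans st.
Qed.

Lemma rank_ge0 t : 0 <= rank t.
Proof. by rewrite /rank fine_ge0. Qed.

Lemma rank_le1 t : rank t <= 1.
Proof. by rewrite -lee_fin rankE probability_le1. Qed.

Lemma measurable_rankR : measurable_fun setT rank.
Proof.
apply/measurable_EFinP; apply: (eq_measurable_fun (fun t => P (ysection L t))) => [t _ /=|].
  by rewrite rankE ysecE.
exact: measurable_rank.
Qed.

(** The upper bound on the distribution function is [rank_le]. The lower bound is [rank_le] for the
    reversed preorder, whose rank is [1 - rank] because ties are null. *)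
Lemma rank_uniform01 : uniform01 P rank.
Proof.
split; first exact: measurable_rankR.
move=> p /andP[p0 p1].
apply/eqP; rewrite eq_le; apply/andP; split.
  have := @rank_le _ _ _ P L mL L_total L_trans p%:E; rewrite lee_fin => /(_ p0).
  apply: le_trans; rewrite le_eqVlt; apply/orP; left; apply/eqP; congr (P _).
  by apply/seteqP; split => t /=; rewrite ysecE -rankE lee_fin.
pose L' := (fun z : T * T => (z.2, z.1)) @^-1` L.
have mL' : measurable L'.
  rewrite -[X in measurable X]setTI.
  by apply: (measurable_fun_pair (f := snd) (g := fst)).
have L'tot s t : L' (s, t) \/ L' (t, s) by exact: L_total.
have L'tr s t u : L' (s, t) -> L' (t, u) -> L' (s, u).
  by move=> st tu; exact: L_trans tu st.
have := @rank_le _ _ _ P L' mL' L'tot L'tr (1 - p)%:E.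
rewrite lee_fin subr_ge0 => /(_ p1).
have mlt : measurable [set t | rank t < p].
  by apply: measurable_set_ltr => //; exact: measurable_rankR.
have rank'E t : P (ysection L' t) = (1 - rank t)%:E.
  have -> : ysection L' t = ~` [set s | L (s, t) /\ ~ L (t, s)].
    apply/seteqP; split => s; rewrite /ysection /= inE /L' /=; first by move=> ? [].
    by move=> H; case: (L_total t s) => // st; apply: contrapT => nts; exact: H.
  have E : [set s | L (s, t) /\ ~ L (t, s)] = [set s | L (s, t)] `\` [set s | L (s, t) /\ L (t,
    s)].
    apply/seteqP; split => s /= [Ls H]; split => //.
      by move=> [].
    by move=> Lts; exact: H.
  have mN : measurable [set s | L (s, t) /\ L (t,
    s)] by exact: (measurableI _ _ (m_ysec t) (m_xsec t)).
  rewrite probability_setC; last by rewrite E; exact: measurableD.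
  rewrite EFinB rankE; congr (_ - _)%E; rewrite E measureD//;
    last by rewrite -ge0_fin_numE// fin_num_measure.
  rewrite [X in (_ - X)%E](_ : _ = 0%E) ?sube0//.
  by rewrite -(L_null t); congr (P _); apply/seteqP; split => s /=; [case|move=> [? ?]].
have -> : [set t | (P (ysection L' t) <= (1 - p)%:E)%E] = ~` [set t | rank t < p].
  apply/seteqP; split => t /=; rewrite rank'E lee_fin lerD2l lerN2.
    by rewrite leNgt => /negP.
  by move=> /negP; rewrite -leNgt.
rewrite probability_setC// EFinB leeBrDr ?fin_num_measure//.
rewrite addeC addeA => H.
have {}H : (p%:E <= P [set t | (rank t < p)%R])%E.
  have fP : P [set t | rank t < p] \is a fin_num by rewrite fin_num_measure.
  move: H; rewrite -(fineK fP) -!EFinD !lee_fin; lra.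
apply: (le_trans H); apply: le_measure; rewrite ?inE//; last by move=> t /ltW.
by apply: measurable_set_ler => //; exact: measurable_rankR.
Qed.

End rank_uniform.

Section lexicographic.
Context d (T : measurableType d) (R : realType) (P : probability T R).
Variables X rho : T -> R.
Hypotheses (mX : measurable_fun setT X) (mrho : measurable_fun setT rho).
Hypothesis rho_atomless : forall z, P [set w | rho w = z] = 0%E.

(* Ties of X are broken by decreasing rho. *)
Definition lexico : set (T * T) :=
  [set z | X z.1 < X z.2 \/ (X z.1 = X z.2 /\ rho z.2 <= rho z.1)].

Definition lex_rank : T -> R := rank P lexico.

Let m_lexico : measurable lexico.
Proof.
have mm (A : T * T -> bool) : measurable_fun setT A -> measurable [set z | A z].
  move=> mA; rewrite -[X in measurable X]setTI.
  by have := mA measurableT [set true]; apply.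
have m1 (Y : T -> R) : measurable_fun setT Y -> measurable_fun setT (fun z : T * T => Y z.1).
  by move=> mY; exact: measurableT_comp.
have m2 (Y : T -> R) : measurable_fun setT Y -> measurable_fun setT (fun z : T * T => Y z.2).
  by move=> mY; exact: measurableT_comp.
have -> : lexico = [set z | X z.1 < X z.2] `|`
    (([set z | X z.1 <= X z.2] `&` [set z | X z.2 <= X z.1]) `&` [set z | rho z.2 <= rho z.1]).
  apply/seteqP; split => z /=; rewrite /lexico /=.
    by move=> [|[-> ?]]; [left|right].
  by move=> [|[[? ?] ?]]; [left|right; split => //; apply/eqP; rewrite eq_le; apply/andP].
by apply: measurableU; [|apply: measurableI; [apply: measurableI|]];
  apply: mm; (apply: measurable_fun_ltr || apply: measurable_fun_ler);
  (exact: m1 || exact: m2).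
Qed.

Let lex_total s t : lexico (s, t) \/ lexico (t, s).
Proof.
rewrite /lexico /=; have [?|?|->] := ltgtP (X s) (X t); [by left; left|by right; left|].
by case: (leP (rho t) (rho s)) => [?|/ltW ?]; [left; right|right; right].
Qed.

Let lex_trans s t u : lexico (s, t) -> lexico (t, u) -> lexico (s, u).
Proof.
rewrite /lexico /= => -[st|[st rst]] [tu|[tu rtu]].
- by left; exact: lt_trans tu.
- by left; rewrite -tu.
- by left; rewrite st.
- by right; rewrite st tu; split => //; exact: le_trans rst.
Qed.

Let lex_null t : P [set s | lexico (s, t) /\ lexico (t, s)] = 0%E.
Proof.
have mr : measurable [set w | rho w = rho t].
  exact: measurable_set_eqr.
apply/eqP; rewrite eq_le measure_ge0 andbT -(rho_atomless (rho t)).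
apply: le_measure; rewrite ?inE//.
  apply: measurableI.
    have := measurable_ysection t m_lexico.
    by congr measurable; apply/seteqP; split => s; rewrite /ysection /= inE.
  have := measurable_xsection t m_lexico.
  by congr measurable; apply/seteqP; split => s; rewrite /xsection /= inE.
rewrite /lexico => s /= [] [st|[Xst rst]] [ts|[Xts rts]].
- by have := lt_trans st ts; rewrite ltxx.
- by move: st; rewrite Xts ltxx.
- by move: ts; rewrite Xst ltxx.
- by apply/eqP; rewrite eq_le rst rts.
Qed.

Lemma lex_rank_uniform : uniform01 P lex_rank.
Proof. exact: rank_uniform01. Qed.

Lemma lex_rank_comonotone s t : X s < X t -> lex_rank s <= lex_rank t.
Proof. by move=> st; apply: rank_homo => //; left. Qed.

Lemma lex_rank_ge0 t : 0 <= lex_rank t.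
Proof. exact: rank_ge0. Qed.

Lemma lex_rank_le1 t : lex_rank t <= 1.
Proof. exact: rank_le1. Qed.

End lexicographic.

Lemma lex_rank_cst d (T : measurableType d) (R : realType) (P : probability T R)
    (rho : {RV P >-> R}) (c : R) :
  (forall z, P [set w | rho w = z] = 0%E) ->
  lex_rank P (cst c) rho = (fun w => 1 - distr_fun rho (rho w)).
Proof.
move=> at0; apply/funext => w; rewrite /lex_rank /rank.
have mrho : measurable_fun setT rho by [].
have mle z : measurable [set s | rho s < z].
  exact: measurable_set_ltr.
have -> : [set s | lexico (cst c) rho (s, w)] = ~` [set s | rho s < rho w].
  apply/seteqP; split => s; rewrite /lexico /= ltxx.
    by move=> [//|[_]]; rewrite leNgt => /negP.
  by move=> /negP; rewrite -leNgt; right.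
rewrite probability_setC//= fineB ?fin_num_measure//=; congr (_ - _).
rewrite /distr_fun /cdf /distribution /pushforward /=; congr fine.
have mr : measurable [set s | rho s = rho w].
  exact: measurable_set_eqr.
have -> : rho @^-1` `]-oo, rho w] = [set s | rho s < rho w] `|` [set s | rho s = rho w].
  apply/seteqP; split => s /=; rewrite in_itv /= le_eqVlt.
    by move=> /predU1P[->|]; [right|left].
  by move=> [->|->]; rewrite ?orbT ?eqxx.
rewrite measureU//; last by apply/seteqP; split => // s [/= + E]; rewrite E ltxx.
by rewrite [X in (_ + X)%E](_ : _ = 0%E) ?adde0//; exact: at0.
Qed.

(** * Quantiles *)

Lemma homo_measurable_itv (R : realType) (a b : R) (Q : R -> R) :
  (forall p q, a < p -> p <= q -> q < b -> Q p <= Q q) ->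
  measurable_fun (`]a, b[%classic : set R) Q.
Proof.
move=> Qh mD; apply: (measurability _ (RGenOInfty.measurableE R)) => //.
move=> /= _ [_ [c ->] <-]; apply: is_interval_measurable.
move=> p q [] /= + + [] + + z /andP[pz zq].
rewrite !in_itv /= !andbT => /andP[ap pb] cp /andP[aq qb] cq.
have az := lt_le_trans ap pz; split; first by rewrite az (le_lt_trans zq).
by apply: lt_le_trans cp _; apply: Qh => //; exact: le_lt_trans qb.
Qed.

Section quantile.
Context (R : realType) (G : R -> R).
Hypothesis G_homo : {homo G : x y / x <= y}.
Hypothesis G_rc : forall z, G x @[x --> z^'+] --> G z.
Hypothesis G_Ny : G x @[x --> -oo] --> (0 : R).
Hypothesis G_y : G x @[x --> +oo] --> (1 : R).

Lemma has_inf_quantile p : 0 < p < 1 -> has_inf [set z | p < G z].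
Proof.
move=> /andP[p0 p1]; split.
  have : \forall x \near +oo, p < G x by exact: (cvgr_gt _ G_y).
  move=> [M [_ HM]]; exists (M + 1) => /=; apply: HM; by rewrite ltrDl.
have : \forall x \near -oo, G x < p by exact: (cvgr_lt _ G_Ny).
move=> [M [_ HM]]; exists (M - 1) => z /= pz.
rewrite leNgt; apply/negP => zM.
have zM' : z < M by apply: lt_trans zM _; rewrite ltrBlDr ltrDl.
by have := lt_trans pz (HM _ zM'); rewrite ltxx.
Qed.

Lemma quantile_le p z : 0 < p < 1 -> p < G z -> quantile G p <= z.
Proof. by move=> p01 pz; apply: ge_inf => //; exact: (has_inf_quantile p01).2. Qed.

(** Right continuity of [G] enters here: if [G z < p], then still [G z' < p] for some [z' > z],
    whereas the infimum leaves a point [y < z'] with [p < G y]. *)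
Lemma quantile_leP p z : 0 < p < 1 -> quantile G p <= z -> p <= G z.
Proof.
move=> p01 qz; rewrite leNgt; apply/negP => Gp.
have : \forall x \near z^'+, G x < p by exact: (cvgr_lt _ (G_rc (z := z))).
move=> [e /= e0 He].
pose z' := z + e / 2.
have zz' : z < z' by rewrite ltrDl divr_gt0.
have Gz' : G z' < p.
  apply: He => //=.
  by rewrite /z' opprD addNKr normrN gtr0_norm ?divr_gt0// ltr_pdivrMr// ltr_pMr// ltr1n.
have [y /= py yz'] : exists2 y, p < G y & y < z'.
  have /inf_adherent : 0 < z' - quantile G p by rewrite subr_gt0 (le_lt_trans qz).
  move=> /(_ _ (has_inf_quantile p01)) [y py]; rewrite addrC subrK => yz'.
  by exists y.
by have := le_lt_trans (G_homo (ltW yz')) Gz'; rewrite ltNge (ltW py).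
Qed.

Lemma quantile_homo p q : 0 < p -> p <= q -> q < 1 -> quantile G p <= quantile G q.
Proof.
move=> p0 pq q1.
have p01 : 0 < p < 1 by rewrite p0 (le_lt_trans pq).
have q01 : 0 < q < 1 by rewrite q1 (lt_le_trans p0).
apply: lb_le_inf; first exact: (has_inf_quantile q01).1.
by move=> z /= qz; apply: quantile_le => //; exact: le_lt_trans qz.
Qed.

Lemma quantile_ge p z : 0 < p < 1 -> G z <= p -> z <= quantile G p.
Proof.
move=> p01 Gz; apply: lb_le_inf; first exact: (has_inf_quantile p01).1.
move=> y /= py; rewrite leNgt; apply/negP => yz.
by have := le_lt_trans (le_trans (G_homo (ltW yz)) Gz) py; rewrite ltxx.
Qed.

End quantile.

Section distr_fun.
Context d (T : measurableType d) (R : realType) (P : probability T R).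
Variable Y : {RV P >-> R}.

Lemma distr_funE z : (distr_fun Y z)%:E = P [set w | Y w <= z].
Proof.
rewrite /distr_fun fineK ?fin_num_measure// /cdf /distribution /pushforward.
Qed.

Lemma distr_fun_homo : {homo distr_fun Y : x y / x <= y}.
Proof.
by move=> x y xy; rewrite /distr_fun fine_le ?fin_num_measure// cdf_nondecreasing.
Qed.

Lemma distr_fun_rc z : distr_fun Y x @[x --> z^'+] --> distr_fun Y z.
Proof.
apply: fine_cvg; rewrite fineK ?fin_num_measure//; exact: cdf_right_continuous.
Qed.

Lemma distr_fun_Ny : distr_fun Y x @[x --> -oo] --> (0 : R).
Proof. by apply: fine_cvg; exact: cvg_cdfNy0. Qed.

Lemma distr_fun_y : distr_fun Y x @[x --> +oo] --> (1 : R).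
Proof. by apply: fine_cvg; exact: cvg_cdfy1. Qed.

Lemma distr_fun_ge0 z : 0 <= distr_fun Y z.
Proof. by rewrite /distr_fun fine_ge0. Qed.

Lemma distr_fun_le1 z : distr_fun Y z <= 1.
Proof. by rewrite -lee_fin distr_funE probability_le1//; exact: measurable_set_ler. Qed.

Lemma prob_gt z : P [set w | z < Y w] = (1 - distr_fun Y z)%:E.
Proof.
have mY : measurable_fun setT Y by [].
have -> : [set w | z < Y w] = ~` [set w | Y w <= z].
  by apply/seteqP; split => w /=; [rewrite ltNge => /negP|move=> /negP; rewrite -ltNge].
rewrite probability_setC; last exact: measurable_set_ler.
by rewrite EFinB distr_funE.
Qed.

End distr_fun.

Lemma continuous_distr_atomless d (T : measurableType d) (R : realType) (P : probability T R)
    (rho : {RV P >-> R}) : continuous (distr_fun rho) -> forall z, P [set w | rho w = z] = 0%E.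
Proof.
move=> cF z.
have mrho : measurable_fun setT rho by [].
have mr : measurable [set s | rho s = z].
  exact: measurable_set_eqr.
have mle y : measurable [set s | rho s <= y].
  exact: measurable_set_ler.
apply/eqP; rewrite eq_le measure_ge0 andbT; apply/lee_addgt0Pr => e e0.
rewrite add0e.
have := cF z; rewrite /continuous_at => /cvgrPdist_lt /(_ e e0) [del /= del0 Hdel].
pose y := z - del / 2.
have yz : y < z by rewrite /y ltrBlDr ltrDl divr_gt0.
have zy : `|z - y| < del.
  by rewrite /y opprB addrC subrK gtr0_norm ?divr_gt0// ltr_pdivrMr// ltr_pMr// ltr1n.
have H : `|distr_fun rho z - distr_fun rho y| < e := Hdel y zy.
apply: (@le_trans _ _ (P ([set s | rho s <= z] `\` [set s | rho s <= y]))).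
  apply: le_measure; rewrite ?inE//; first exact: measurableD.
  by move=> s /= ->; split => //; apply/negP; rewrite -ltNge.
rewrite measureD//; last by rewrite -ge0_fin_numE// fin_num_measure.
rewrite setIidr; last by move=> s /= /le_trans; apply; exact: ltW.
apply: (@le_trans _ _ ((distr_fun rho z)%:E - (distr_fun rho y)%:E)%E).
  by rewrite !distr_funE.
by rewrite -EFinB lee_fin; apply: le_trans (ltW H); exact: ler_norm.
Qed.

Section full.
Context d (T : measurableType d) (R : realType) (P : probability T R).

Lemma full_setC (D : set T) : measurable D -> P D = 1%E -> P (~` D) = 0%E.
Proof. by move=> mD PD; apply: eq_trans (probability_setC P mD) _; rewrite PD subee. Qed.

Lemma prob_full (D S : set T) : measurable D -> measurable S -> P D = 1%E ->
  P (D `&` S) = P S.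
Proof.
move=> mD mS PD; have PC := full_setC mD PD.
apply/eqP; rewrite eq_le; apply/andP; split.
  by apply: le_measure; rewrite ?inE//; exact: measurableI.
rewrite -[leRHS]adde0 -PC.
apply: (@le_trans _ _ (P ((D `&` S) `|` ~` D))); last first.
  by apply: measureU2; [exact: measurableI|exact: measurableC].
apply: le_measure; rewrite ?inE//.
  by apply: measurableU; [exact: measurableI|exact: measurableC].
by move=> t St; have [?|?] := pselect (D t); [left|right].
Qed.

End full.

Section quantile_transform.
Context d (T : measurableType d) (R : realType) (P : probability T R).
Variables (U : T -> R) (uU : uniform01 P U).

Lemma uniform01_gt c : 0 <= c <= 1 -> P [set w | c < U w < 1] = (1 - c)%:E.
Proof.
move=> /andP[c0 c1].
transitivity (P (U @^-1` `]c, 1[%classic)).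
  by congr (P _); apply/seteqP; split => w /=; rewrite in_itv.
rewrite (uniform01_law uU)//.
rewrite (_ : _ `&` _ = `]c, 1[%classic).
  rewrite lebesgue_measure_itv /= lte_fin; case: ltP => [_|c1']; first by rewrite EFinB.
  by rewrite (_ : c = 1) ?subrr//; apply/eqP; rewrite eq_le c1 c1'.
apply/setIidPl => p /=; rewrite !in_itv /= => /andP[cp p1].
by rewrite (le_lt_trans c0 cp) ltW.
Qed.

Lemma uniform01_ge c : 0 <= c <= 1 -> P [set w | c <= U w /\ 0 < U w < 1] = (1 - c)%:E.
Proof.
move=> /andP[c0 c1].
have [->|c0'] := eqVneq c 0.
  rewrite subr0 -(uniform01_ae uU); congr (P _); apply/seteqP; split => w /=; first by case.
  by move=> /andP[U0 U1]; rewrite U0 U1 ltW.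
transitivity (P (U @^-1` `[c, 1[%classic)).
  congr (P _); apply/seteqP; split => w /=; rewrite in_itv /=.
    by move=> [-> /andP[_ ->]].
  by move=> /andP[cU ->]; rewrite (lt_le_trans _ cU)// lt_neqAle eq_sym c0'.
rewrite (uniform01_law uU)//.
rewrite (_ : _ `&` _ = `[c, 1[%classic).
  rewrite lebesgue_measure_itv /= lte_fin; case: ltP => [_|c1']; first by rewrite EFinB.
  by rewrite (_ : c = 1) ?subrr//; apply/eqP; rewrite eq_le c1 c1'.
apply/setIidPl => p /=; rewrite !in_itv /= => /andP[cp p1].
by rewrite (lt_le_trans _ cp) ?(ltW p1)// lt_neqAle eq_sym c0'.
Qed.

(** For the right-continuous inverse, the event [z < quantile G (U w)] lies between [G z < U w] and
    [G z <= U w]. Both have probability [1 - G z], since [U] has no atoms. *)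
Lemma quantile_law (Y : {RV P >-> R}) z :
  P [set w | 0 < U w < 1 /\ z < quantile (distr_fun Y) (U w)] = P [set w | z < Y w].
Proof.
have [mU _] := uU.
set G := distr_fun Y.
have Gh : {homo G : x y / x <= y} by exact: distr_fun_homo.
have Grc : forall z, G x @[x --> z^'+] --> G z by exact: distr_fun_rc.
have GNy : G x @[x --> -oo] --> (0 : R) by exact: distr_fun_Ny.
have Gy : G x @[x --> +oo] --> (1 : R) by exact: distr_fun_y.
have G01 : 0 <= G z <= 1 by rewrite distr_fun_ge0 distr_fun_le1.
have m0 c : measurable [set w | c < U w < 1] by exact: measurable_set_itvoo.
have m1 : measurable [set w | 0 < U w < 1 /\ z < quantile G (U w)].
  have -> : [set w | 0 < U w < 1 /\ z < quantile G (U w)] =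
      U @^-1` (`]0, 1[%classic `&` (quantile G @^-1` `]z, +oo[%classic)).
    by apply/seteqP; split => w /=; rewrite !in_itv /= andbT.
  rewrite -[X in measurable X]setTI; apply: mU => //.
  apply: homo_measurable_itv => //.
  by move=> p q; exact: quantile_homo.
rewrite prob_gt -/G; apply/eqP; rewrite eq_le; apply/andP; split.
  rewrite -(uniform01_ge G01); apply: le_measure; rewrite ?inE//.
    apply: measurableI; [exact: measurable_set_ler|exact: m0].
  move=> w /= [U01 zU]; split => //; rewrite leNgt; apply/negP => UG.
  by have := quantile_le GNy Gy U01 UG; rewrite leNgt zU.
rewrite -(uniform01_gt G01); apply: le_measure; rewrite ?inE//.
move=> w /= /andP[GU U1]; have U01 : 0 < U w < 1.
  by rewrite U1 andbT (le_lt_trans _ GU) ?distr_fun_ge0.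
split => //; rewrite ltNge; apply/negP => Uz.
by have := quantile_leP Gh Grc GNy Gy U01 Uz; rewrite leNgt GU.
Qed.

End quantile_transform.

Section quantile01.
Context (R : realType) (G : R -> R).
Hypothesis G_homo : {homo G : x y / x <= y}.
Hypothesis G_rc : forall z, G x @[x --> z^'+] --> G z.
Hypothesis G_Ny : G x @[x --> -oo] --> (0 : R).
Hypothesis G_y : G x @[x --> +oo] --> (1 : R).
Hypothesis lip : exists k : R, k.-lipschitz_(`[0, 1]) (quantile01 G).

Lemma quantile01_lip : exists k : R, 0 <= k /\ forall p q, 0 <= p <= 1 -> 0 <= q <= 1 ->
  `|quantile01 G p - quantile01 G q| <= k * `|p - q|.
Proof.
have [k Hk] := lip; exists `|k|; split => // p q p01 q01.
apply: le_trans (ler_wpM2r (normr_ge0 _) (ler_norm k)).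
by have := Hk (p, q); apply; split => /=; rewrite in_itv.
Qed.

(** The end values are limits, about which the Lipschitz bound gives the needed control: both
    arguments are moved into the open interval, where the quantile is monotone. *)
Lemma quantile01_homo p q : 0 <= p -> p <= q -> q <= 1 -> quantile01 G p <= quantile01 G q.
Proof.
have [k [k0 Hk]] := quantile01_lip.
have in01 p' : 0 < p' < 1 -> quantile01 G p' = quantile G p'.
  by move=> /andP[p0 p1]; rewrite /quantile01 leNgt p0 /= leNgt p1.
move=> p0; rewrite le_eqVlt => /predU1P[->//|pq] q1.
apply/ler_addgt0Pr => e e0.
(* The first bound keeps the two Lipschitz errors [k * r] below [e] together; the second keeps
   [p + r <= q - r]. *)
pose r := Num.min (e / (k + k + 1)) ((q - p) / 3).
have k1 : 0 < k + k + 1 by rewrite ltr_pwDr// addr_ge0.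
have r0 : 0 < r by rewrite lt_min !divr_gt0// subr_gt0.
have rq : r <= (q - p) / 3 by rewrite ge_min lexx orbT.
have re : (k + k + 1) * r <= e by rewrite mulrC -ler_pdivlMr// ge_min lexx.
have pr : 0 < p + r < 1 by apply/andP; split; lra.
have qr : 0 < q - r < 1 by apply/andP; split; lra.
have prqr : quantile01 G (p + r) <= quantile01 G (q - r).
  by rewrite !in01//; apply: quantile_homo => //; lra.
have H1 : `|quantile01 G p - quantile01 G (p + r)| <= k * `|p - (p + r)|.
  by apply: Hk; apply/andP; split; lra.
have H2 : `|quantile01 G (q - r) - quantile01 G q| <= k * `|(q - r) - q|.
  by apply: Hk; apply/andP; split; lra.
rewrite opprD addNKr normrN (gtr0_norm r0) in H1.
rewrite (addrAC q) subrr add0r normrN (gtr0_norm r0) in H2.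
have := ler_norm (quantile01 G p - quantile01 G (p + r)).
have := ler_norm (quantile01 G (q - r) - quantile01 G q).
nra.
Qed.

End quantile01.

Section full_integral.
Context d (T : measurableType d) (R : realType) (P : probability T R).

Lemma integral_full (D : set T) (f : T -> \bar R) : measurable D -> P D = 1%E ->
  measurable_fun setT f -> (\int[P]_w f w = \int[P]_(w in D) f w)%E.
Proof.
move=> mD PD mf; rewrite [RHS]integral_mkcond; apply: ae_eq_integral => //.
  by apply/(measurable_restrictT _ _).1 => //; exact: measurable_funTS.
exists (~` D); split; first exact: measurableC.
  exact: full_setC.
move=> w /= nE Dw; apply: nE => _; by rewrite erestrict_in.
Qed.

Lemma full_setI (D E : set T) : measurable D -> measurable E -> P D = 1%E -> P E = 1%E ->
  P (D `&` E) = 1%E.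
Proof. by move=> mD mE PD PE; rewrite (prob_full mD mE PD). Qed.

Lemma ae_full (E : set T) : measurable E -> {ae P, forall w, E w} -> P E = 1%E.
Proof.
move=> mE [N [mN N0 HN]].
have C0 : P (~` E) = 0%E.
  by apply/eqP; rewrite eq_le measure_ge0 andbT -N0; apply: le_measure; rewrite ?inE//;
    exact: measurableC.
have := probability_setC P mE; rewrite C0 => H0.
have fE : P E \is a fin_num by rewrite fin_num_measure.
move: H0; rewrite -(fineK fE) -EFinB => -[] /eqP; rewrite eq_sym subr_eq0 => /eqP <-.
by [].
Qed.

End full_integral.

Lemma full_ae (R : realType) d (T : measurableType d) (P : probability T R) (E : set T) :
  measurable E -> P E = 1%E -> {ae P, forall w, E w}.
Proof.
by move=> mE PE; exists (~` E); split => //; [exact: measurableC|exact: full_setC].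
Qed.

(** * Absolutely continuous functions *)

(* Real induction. *)
Lemma creeping (R : realType) (a b : R) (S : R -> Prop) : a <= b -> S a ->
  (forall c, a <= c <= b -> exists2 d, 0 < d &
     (forall x, a <= x <= c -> c - d < x -> S x -> S c) /\
     (forall y, c <= y <= b -> y < c + d -> S c -> S y)) -> S b.
Proof.
move=> ab Sa step.
pose A := [set x | a <= x <= b /\ S x].
have Aa : A a by split => //; rewrite lexx.
have hA : has_sup A by split; [exists a|exists b => x [/andP[]]].
have acb : a <= sup A <= b.
  apply/andP; split; first exact: (ub_le_sup hA.2).
  by apply: ge_sup; [exists a|move=> x [/andP[]]].
have [d d0 [Hl Hr]] := step _ acb.
have [x [/andP[ax xb] Sx] dx] := sup_adherent d0 hA.
have xA : x <= sup A by apply: (ub_le_sup hA.2); split => //; rewrite ax xb.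
have Sc : S (sup A) by apply: (Hl x) => //; rewrite ax xA.
move: acb => /andP[ac cb].
move: cb; rewrite le_eqVlt => /predU1P[E|cb]; first by rewrite E in Sc.
pose y := Num.min b (sup A + d / 2).
have cy : sup A < y by rewrite lt_min cb ltrDl divr_gt0.
have yb : y <= b by rewrite ge_min lexx.
have Sy : S y.
  apply: Hr => //; first by rewrite ltW.
  by rewrite gt_min ltrD2l ltr_pdivrMr// ltr_pMr// ltr1n orbT.
have : y <= sup A by apply: (ub_le_sup hA.2); split => //; rewrite yb (le_trans ac (ltW cy)).
by rewrite leNgt cy.
Qed.

(** Both lower Dini derivatives of [f] at [p] are non-negative. This weaker notion suits an
    implicitly defined function, whose increments are only estimated. *)
Definition slope_ge0 (R : realType) (f : R -> R) (p : R) :=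
  forall e, 0 < e -> \forall q \near p,
    (p <= q -> f p - e * (q - p) <= f q) /\ (q <= p -> f q <= f p + e * (p - q)).

Section absolutely_continuous_monotone.
Context (R : realType).
Local Notation leb := (@lebesgue_measure R).
Variables (a b : R) (f : R -> R).
Hypothesis ab : a <= b.
Hypothesis acf : abs_continuous a b f.

Section cover.
Variables (O : set R) (oO : open O) (e : R) (e0 : 0 < e).
Hypothesis Ofin : (leb O < +oo)%E.
Hypothesis Oslope : forall p, a <= p <= b -> ~ O p -> slope_ge0 f p.

Let mO : measurable O. Proof. exact: open_measurable. Qed.

(** The length of [O] traversed up to [x], which serves as the budget for the total length of the
    intervals selected in [reach]. *)
Let g (x : R) : R := fine (leb (O `&` `]a, x]%classic)).

Let mOx x : measurable (O `&` `]a, x]%classic).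
Proof. by apply: measurableI. Qed.

Let g_fin x : leb (O `&` `]a, x]%classic) \is a fin_num.
Proof.
rewrite ge0_fin_numE ?measure_ge0//; apply: le_lt_trans Ofin.
by apply: le_measure; rewrite ?inE//; exact: mOx.
Qed.

Let g_homo x y : x <= y -> g x <= g y.
Proof.
move=> xy; apply: fine_le => //; apply: le_measure; rewrite ?inE//; try exact: mOx.
by move=> z [Oz]; rewrite /= !in_itv /= => /andP[az zx]; split => //; rewrite az (le_trans zx).
Qed.

Let g_le x : g x <= fine (leb O).
Proof.
apply: fine_le => //; last by apply: le_measure; rewrite ?inE//; exact: mOx.
by rewrite ge0_fin_numE// measure_ge0.
Qed.

Let g_step x y : a <= x -> x <= y -> (forall z, x < z <= y -> O z) -> y - x <= g y - g x.
Proof.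
move=> ax xy xyO; rewrite lerBrDr -lee_fin EFinD /g !fineK//.
have -> : (y - x)%:E = leb `]x, y]%classic.
  rewrite lebesgue_measure_itv /= lte_fin; case: ltP => [_|yx]; first by rewrite EFinB.
  by rewrite (_ : x = y) ?subrr//; apply/eqP; rewrite eq_le xy yx.
rewrite -measureU//; last 2 first.
- exact: mOx.
- apply/seteqP; split => // z [] /=; rewrite !in_itv /= => /andP[xz _] [_ /andP[_]].
  by rewrite leNgt xz.
apply: le_measure; rewrite ?inE//; try exact: mOx.
  by apply: measurableU => //; exact: mOx.
move=> z [|[Oz]] /=; rewrite !in_itv /=.
  by move=> /andP[xz zy]; split; [apply: xyO; rewrite xz|rewrite (le_lt_trans ax xz)].
by move=> /andP[az zx]; split => //; rewrite az (le_trans zx).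
Qed.

(* The intervals (s k, t k) are those tagged by a point of O. *)
Let reach (x : R) := exists n (s t : nat -> R),
  [/\ (forall k, (k < n)%N -> [/\ a <= s k, s k <= t k & t k <= x]),
      (forall k, (k.+1 < n)%N -> t k <= s k.+1),
      \sum_(k < n) (t k - s k) <= g x - g a &
      f a - e * (x - a) - \sum_(k < n) `|f (t k) - f (s k)| <= f x].

Let reach_slope x y : a <= x -> x <= y -> f x - e * (y - x) <= f y -> reach x -> reach y.
Proof.
move=> ax xy fxy [n [s [t [H1 H2 H3 H4]]]]; exists n, s, t; split => //.
- by move=> k kn; have [? ? tx] := H1 k kn; split => //; exact: le_trans xy.
- by apply: le_trans H3 _; rewrite lerD2r g_homo.
- by apply: le_trans fxy; move: H4; lra.
Qed.

Let reach_cover x y : a <= x -> x <= y -> y - x <= g y - g x -> reach x -> reach y.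
Proof.
move=> ax xy gxy [n [s [t [H1 H2 H3 H4]]]].
(* The interval from [x] to [y] is appended under the index [n]; a decrease of [f] across it is paid
   for by its own term of the sum. *)
exists n.+1, (fun k => if (k < n)%N then s k else x), (fun k => if (k < n)%N then t k else y).
split.
- move=> k; rewrite ltnS leq_eqVlt => /predU1P[->|kn]; first by rewrite ltnn.
  by rewrite kn; have [? ? tx] := H1 k kn; split => //; exact: le_trans xy.
- move=> k; rewrite ltnS => kn; rewrite kn; case: ifPn => kn'; first exact: H2.
  by have [] := H1 k kn.
- rewrite big_ord_recr /= ltnn.
  under eq_bigr do rewrite ltn_ord.
  by lra.
- rewrite big_ord_recr /= ltnn.
  under eq_bigr do rewrite ltn_ord.
  have := ler_norm (- (f y - f x)); rewrite normrN.
  have : 0 <= e * (y - x) by rewrite mulr_ge0 ?subr_ge0//; exact: ltW.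
  by lra.
Qed.

(** Real induction on the right end. Near a point of [O] a short interval is added to the list; near
    any other point the slope condition loses at most [e] per unit length. *)
Lemma reach_end : reach b.
Proof.
apply: (creeping ab).
  exists 0%N, (fun=> 0), (fun=> 0); split => //.
    by rewrite big_ord0 subrr.
  by rewrite big_ord0 subrr mulr0 !subr0.
move=> c acb; have [Oc|Oc] := pselect (O c).
  have [d /= d0 Hd] : \forall z \near c, O z by exact: open_nbhs_nbhs.
  have Od z : `|c - z| < d -> O z by move=> ?; exact: Hd.
  exists d => //; split.
    move=> x /andP[ax xc] cdx; apply: reach_cover => //; apply: g_step => //.
    by move=> z /andP[xz zc]; apply: Od; rewrite ger0_norm ?subr_ge0//; lra.
  move=> y /andP[cy yb] cdy; move: acb => /andP[ac cb].
  apply: reach_cover => //; apply: g_step => //.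
  by move=> z /andP[xz zc]; apply: Od; rewrite ler0_norm ?subr_le0 ?ltW//; lra.
have [d /= d0 Hd] := Oslope acb Oc e0.
have Hs q : `|c - q| < d -> (c <= q -> f c - e * (q - c) <= f q) /\ (q <= c ->
  f q <= f c + e * (c - q)).
  by move=> ?; exact: Hd.
exists d => //; split.
  move=> x /andP[ax xc] cdx; apply: reach_slope => //.
  have [] := Hs x; first by rewrite ger0_norm ?subr_ge0//; lra.
  by move=> _ /(_ xc); lra.
move=> y /andP[cy yb] cdy; move: acb => /andP[ac cb].
apply: reach_slope => //.
have [] := Hs y; first by rewrite ler0_norm ?subr_le0//; lra.
by move=> /(_ cy).
Qed.

Lemma cover_estimate d e' : 0 < d -> (leb O < d%:E)%E ->
  (forall (n : nat) (s t : nat -> R),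
      (forall k, (k < n)%N -> [/\ a <= s k, s k <= t k & t k <= b]) ->
      (forall k, (k.+1 < n)%N -> t k <= s k.+1) ->
      \sum_(k < n) (t k - s k) < d ->
      \sum_(k < n) `|f (t k) - f (s k)| < e') ->
  f a - e * (b - a) - e' <= f b.
Proof.
move=> d0 Od H; have [n [s [t [H1 H2 H3 H4]]]] := reach_end.
have := H n s t H1 H2; apply: (_ : (_ -> _) -> _) => H5.
have : \sum_(k < n) `|f (t k) - f (s k)| < e'.
  apply: H5; apply: le_lt_trans H3 _.
  have ga : 0 <= g a by rewrite /g fine_ge0.
  have : g b < d.
    apply: le_lt_trans (g_le b) _; rewrite -lte_fin fineK//.
    by rewrite ge0_fin_numE// measure_ge0.
  by lra.
by lra.
Qed.

End cover.

(** The exceptional null set is covered by an open set of measure less than [d]. Absolute continuity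
    bounds the variation over the intervals chosen in it by [e], and elsewhere the slope condition
    loses at most [e * (b - a)]. *)
Lemma abs_continuous_homo :
  {ae leb, forall p, a < p < b -> slope_ge0 f p} -> f a <= f b.
Proof.
move=> [N [mN N0 HN]].
suff H e : 0 < e -> f a - e * (b - a) - e <= f b.
  apply/ler_addgt0Pr => e e0.
  (* The total loss is [b - a + 1] times the tolerance, hence the division. *)
  have ba1 : 0 < b - a + 1 by rewrite ltr_pwDr// subr_ge0.
  have := H (e / (b - a + 1)); rewrite divr_gt0// => /(_ isT).
  rewrite -addrA -opprD -[X in _ * _ + X]mulr1 -mulrDr.
  by rewrite -mulrA mulVf ?gt_eqF// mulr1 lerBlDr.
move=> e0; have [d d0 Hd] := acf e0.
(* The slope condition concerns interior points only, so the two end points join the exceptional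
   set. *)
pose N' := N `|` [set a] `|` [set b].
have mN' : measurable N' by apply: measurableU => //; apply: measurableU.
have leb1 c : leb [set c] = 0%E by exact: lebesgue_measure_set1.
have N'0 : leb N' = 0%E.
  apply/eqP; rewrite eq_le measure_ge0 andbT.
  apply: (@le_trans _ _ (leb (N `|` [set a]) + leb [set b])%E).
    by apply: measureU2 => //; exact: measurableU.
  rewrite leb1 adde0; apply: (@le_trans _ _ (leb N + leb [set a])%E).
    exact: measureU2.
  by rewrite leb1 adde0 N0.
have N'oo : (leb N' < +oo)%E by rewrite N'0 ltry.
have [ O [oO NO ON]] := @lebesgue_regularity_outer R N' d mN' N'oo d0.
have mO : measurable O by exact: open_measurable.
have Od : (leb O < d%:E)%E.
  apply: le_lt_trans ON; apply: (@le_trans _ _ (leb (O `\` N') + leb N')%E); last first.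
    by rewrite N'0 adde0.
  apply: (@le_trans _ _ (leb ((O `\` N') `|` N'))).
    apply: le_measure; rewrite ?inE//.
      by apply: measurableU => //; exact: measurableD.
    by move=> z Oz; have [?|?] := pselect (N' z); [right|left].
  by apply: measureU2 => //; exact: measurableD.
apply: (@cover_estimate O oO e e0 _ _ d e) => //.
- by apply: lt_trans Od _; exact: ltry.
- move=> p /andP[ap pb] nOp; apply: contrapT => nslope; apply: nOp; apply: NO.
  have [->|pa] := eqVneq p a; first by left; right.
  have [->|pb'] := eqVneq p b; first by right.
  left; left; apply: HN => /= /(_ _)/nslope; apply.
  by rewrite !lt_neqAle eq_sym pa pb' ap pb.
Qed.

End absolutely_continuous_monotone.

(** * Exponential mixtures *)

(* The inequality f y >= f x - (y - x) * g x for all x, y says that - g x is a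
   subgradient of f at x. *)
Section convex_tangent.
Context (R : realType) (f g h : R -> R).
Hypothesis fg : forall x y, f x - (y - x) * g x <= f y.
Hypothesis gh : forall x y, g x - (y - x) * h x <= g y.
Hypothesis h0 : forall x, 0 < h x.

Lemma tangent_homo x y : x <= y -> g y <= g x.
Proof.
move=> xy; have := gh y x; have := h0 y => ? ?.
have : 0 <= (y - x) * h y by rewrite mulr_ge0 ?subr_ge0// ltW.
lra.
Qed.

Lemma tangent_lt x y : x < y -> g y < g x.
Proof.
move=> xy; have := gh y x; have := h0 y => ? ?.
have : 0 < (y - x) * h y by rewrite mulr_gt0 ?subr_gt0.
lra.
Qed.

Hypothesis h_homo : forall x y, x <= y -> h y <= h x.

Lemma tangent_lip x y z : x <= y -> x <= z -> `|g y - g z| <= h x * `|y - z|.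
Proof.
wlog yz : y z / y <= z => [H xy xz|xy xz].
  have [yz|/ltW zy] := leP y z; first exact: H.
  by rewrite distrC (distrC y); exact: H.
rewrite ger0_norm ?subr_ge0; last exact: tangent_homo.
rewrite ler0_norm ?subr_le0//; have := gh y z.
have : (z - y) * h y <= (z - y) * h x by rewrite ler_wpM2l ?subr_ge0//; exact: h_homo.
lra.
Qed.

(** Left of [x] the function [g] falls at a rate at least [h x], as [h] is non-increasing. For the
    marginal utility this gives a Lipschitz inverse on half-lines. *)
Lemma tangent_lip_ge x y z : y <= x -> z <= x -> h x * `|y - z| <= `|g y - g z|.
Proof.
wlog yz : y z / y <= z => [H xy xz|xy xz].
  have [yz|/ltW zy] := leP y z; first exact: H.
  by rewrite distrC (distrC (g y)); exact: H.
rewrite [leRHS]ger0_norm ?subr_ge0; last exact: tangent_homo.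
rewrite ler0_norm ?subr_le0//; have := gh z y.
have : (z - y) * h x <= (z - y) * h z by rewrite ler_wpM2l ?subr_ge0//; exact: h_homo.
lra.
Qed.

Lemma tangent_continuous : continuous g.
Proof.
move=> x; apply/cvgrPdist_le => e e0.
have hx : 0 < h (x - 1) by [].
near=> y.
have yx : `|x - y| <= Num.min 1 (e / h (x - 1)).
  near: y; apply: cvgr_dist_le => //.
  by rewrite lt_min ltr01 divr_gt0.
move: yx; rewrite le_min => /andP[yx1 yxe].
apply: le_trans (tangent_lip (x := x - 1) _ _) _.
- by rewrite lerBlDr lerDl.
- by move: yx1; rewrite ler_norml => /andP[]; lra.
- by rewrite mulrC -ler_pdivlMr.
Unshelve. all: by end_near. Qed.

(** The tangents at [x] and at [k + x] enclose the difference quotient between [- g x] and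
    [- g (k + x)], and [g] is continuous. *)
Lemma tangent_derive (x : R) : derivable f x 1 /\ derive1 f x = - g x.
Proof.
have H : h^-1 *: (f (h + x) - f x) @[h --> 0^'] --> - g x.
  apply/cvgrPdist_le => e e0.
  have gc : g y @[y --> x] --> g x by exact: tangent_continuous.
  have [d /= d0 Hd] := (cvgrPdist_le _ _).1 gc e e0.
  exists d => // k /= kd k0.
  have {kd} : `|g x - g (k + x)| <= e.
    apply: Hd => /=; rewrite opprD addrCA subrr addr0.
    by move: kd; rewrite sub0r.
  have H1 := fg x (k + x); have H2 := fg (k + x) x.
  rewrite addrK in H1; rewrite opprD addrCA subrr addr0 mulNr in H2.
  have nk : k^-1 * k = 1 by rewrite mulVf.
  rewrite -opprD normrN => ge.
  have -> : g x + k^-1 *: (f (k + x) - f x) = k^-1 * (f (k + x) - f x + k * g x).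
    by rewrite mulrDr mulrA nk mul1r addrC.
  apply: le_trans ge.
  rewrite normrM normfV ler_pdivrMl ?normr_gt0//.
  rewrite -normrM ger0_norm; last by lra.
  apply: le_trans (ler_norm _); lra.
have E : (fun h0 : R => h0^-1 *: ((f \o shift x) (h0 *: (1 : R)) - f x)) = (fun h0 : R => h0^-1
  *: (f (h0 + x) - f x)).
  by apply/funext => k; rewrite /= [k *: 1]mulr1.
split; first by rewrite /derivable E; apply/cvg_ex; exists (- g x).
by rewrite derive1E /derive E; apply/cvg_lim.
Qed.

(** Going from [x] to [y] through the midpoint [w] uses the tangent at [w] on the second half; since
    [g] is strictly decreasing, this lower bound is strictly better than the one from [x] alone. *)
Lemma tangent_strict x y : x != y -> f x - (y - x) * g x < f y.
Proof.
move=> xy; rewrite lt_neqAle fg andbT; apply/eqP => E.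
pose w := (x + y) / 2.
have H1 := fg x w; have H2 := fg w y.
move: xy; rewrite neq_lt => /orP[xy|yx].
  have xw : x < w by rewrite /w; lra.
  have := tangent_lt xw => gw.
  have yw : 0 < y - w by rewrite /w; lra.
  have : (y - w) * g w < (y - w) * g x by rewrite ltr_pM2l.
  have : (y - x) * g x = (w - x) * g x + (y - w) * g x by rewrite -mulrDl; congr (_ * _); lra.
  lra.
have wx : w < x by rewrite /w; lra.
have := tangent_lt wx => gw.
have wy : 0 < w - y by rewrite /w; lra.
have : (w - y) * g x < (w - y) * g w by rewrite ltr_pM2l.
have : (y - x) * g x = (w - x) * g x - (w - y) * g x by rewrite -mulrBl; congr (_ * _); lra.
have : (y - w) * g w = - ((w - y) * g w) by ring.
lra.
Qed.

End convex_tangent.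

Section exp_moments.
Context (R : realType) (F : cumulative R R) (c C : R).
Local Notation mu := (lebesgue_stieltjes_measure F).
Hypothesis c0 : 0 < c.
Hypothesis mu_fin : (mu `[c, C]%classic < +oo)%E.
Hypothesis mu_pos : (0 < mu `[c, C]%classic)%E.

(* (-1)^n times the n-th derivative of [exp_moment 0] = - u. *)
Definition exp_moment (n : nat) (x : R) : R :=
  \int[mu]_(g in `[c, C]) (g ^+ n * expR (- (g * x))).

Let m := fine (mu `[c, C]%classic).

Let m_gt0 : 0 < m.
Proof. by apply: fine_gt0; rewrite mu_pos. Qed.

Let measurable_integrand n x : measurable_fun setT (fun g : R => g ^+ n * expR (- (g * x))).
Proof.
apply: measurable_funM; first exact: exprn_measurable.
apply: measurableT_comp => //.
by apply: measurableT_comp => //; apply: measurable_funM.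
Qed.

Let itv_fin g : `[c, C]%classic g -> c <= g <= C.
Proof. by rewrite /= in_itv. Qed.

Lemma exp_moment_integrable n x :
  mu.-integrable `[c, C] (EFin \o (fun g : R => g ^+ n * expR (- (g * x)))).
Proof.
apply: measurable_bounded_integrable => //; first exact: measurable_funS (measurable_integrand
  n x).
exists (C ^+ n * expR (C * `|x|)); split; first exact: num_real.
move=> M HM g /itv_fin /andP[cg gC] /=; apply: le_trans (ltW HM).
have g0 : 0 <= g by rewrite (le_trans _ cg)// ltW.
rewrite ger0_norm ?mulr_ge0 ?exprn_ge0 ?expR_ge0//.
apply: ler_pM; rewrite ?exprn_ge0 ?expR_ge0//; first by apply: lerXn2r;
  rewrite ?nnegrE ?(le_trans g0).
rewrite ler_expR -mulrN; apply: (@le_trans _ _ (g * `|x|)).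
  by rewrite ler_wpM2l// -normrN ler_norm.
by rewrite ler_wpM2r.
Qed.

Let le_moment (p q : R -> R) : mu.-integrable `[c, C] (EFin \o p) ->
  mu.-integrable `[c, C] (EFin \o q) -> (forall g, c <= g <= C -> p g <= q g) ->
  \int[mu]_(g in `[c, C]) p g <= \int[mu]_(g in `[c, C]) q g.
Proof.
move=> ip iq pq; rewrite /Rintegral; apply: fine_le.
- exact: integrable_fin_num.
- exact: integrable_fin_num.
- apply: le_integral => // g; rewrite inE => /itv_fin cg.
  by rewrite lee_fin; exact: pq.
Qed.

Let cst_integrable (k : R) : mu.-integrable `[c, C] (EFin \o (fun=> k)).
Proof.
apply: measurable_bounded_integrable => //.
by exists `|k|; split; [exact: num_real|move=> M /ltW + g _ /=].
Qed.

Let cst_moment (k : R) : \int[mu]_(g in `[c, C]) k = k * m.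
Proof. by rewrite Rintegral_cst. Qed.

Lemma exp_moment_gt0 n x : 0 < exp_moment n x.
Proof.
pose k := c ^+ n * expR (- (C * `|x|)).
have k0 : 0 < k by rewrite mulr_gt0 ?exprn_gt0 ?expR_gt0.
apply: (@lt_le_trans _ _ (k * m)); first exact: mulr_gt0.
rewrite -cst_moment; apply: le_moment => //; first exact: exp_moment_integrable.
move=> g /andP[cg gC].
have g0 : 0 < g by exact: lt_le_trans cg.
apply: ler_pM; rewrite ?exprn_ge0 ?expR_ge0//; try exact: ltW.
  by apply: lerXn2r; rewrite ?nnegrE//; exact: ltW.
rewrite ler_expR lerN2; apply: (@le_trans _ _ (g * `|x|)).
  by rewrite ler_wpM2l ?ler_norm// ltW.
by rewrite ler_wpM2r.
Qed.

(** [1 + t <= exp t] at [t = - g * (y - x)], multiplied by [g ^+ n * exp (- g * x)] and integrated.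
    All derivatives of the mixture follow from this without differentiating under the integral. *)
Lemma exp_moment_tangent n x y :
  exp_moment n x - (y - x) * exp_moment n.+1 x <= exp_moment n y.
Proof.
have i1 := exp_moment_integrable n x.
have i2 := exp_moment_integrable n.+1 x.
rewrite /exp_moment -RintegralZl// -RintegralB//; last first.
  exact: (integrableZl _ (y - x) i2).
apply: le_moment; last first.
- move=> g /andP[cg gC]; have g0 : 0 <= g by rewrite (le_trans _ cg)// ltW.
  rewrite exprS.
  have -> : g ^+ n * expR (- (g * x)) - (y - x) * (g * g ^+ n * expR (- (g * x))) =
      g ^+ n * (expR (- (g * x)) * (1 + - (g * (y - x)))) by ring.
  rewrite ler_wpM2l ?exprn_ge0//.
  have -> : - (g * y) = - (g * x) + - (g * (y - x)) by ring.
  by rewrite expRD ler_wpM2l ?expR_ge0// expR_ge1Dx.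
- exact: exp_moment_integrable.
- exact: (integrableB _ i1 (integrableZl _ (y - x) i2)).
Qed.

(** The kernel [exp (- g * x)] is at most [1 / (1 + c * x)]. Together with the linear growth on the
    negative axis below, this lets the marginal utility take arbitrarily small and arbitrarily large
    values. *)
Lemma exp_moment_bound x : 0 <= x -> exp_moment 1 x <= C * m / (1 + c * x).
Proof.
move=> x0.
have cx : 0 < 1 + c * x by rewrite ltr_pwDl// mulr_ge0// ltW.
rewrite mulrAC -cst_moment; apply: le_moment => //; first exact: exp_moment_integrable.
move=> g /andP[cg gC]; have g0 : 0 < g by exact: lt_le_trans cg.
rewrite expr1; apply: ler_pM; rewrite ?expR_ge0 ?(ltW g0)//.
rewrite expRN lef_pV2 ?posrE ?expR_gt0//.
apply: le_trans (expR_ge1Dx _); rewrite lerD2l.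
by rewrite ler_wpM2r.
Qed.

Lemma exp_moment_coercive x : x <= 0 -> c * m * (1 - c * x) <= exp_moment 1 x.
Proof.
move=> x0.
rewrite mulrAC -cst_moment; apply: le_moment => //; first exact: exp_moment_integrable.
move=> g /andP[cg gC]; have g0 : 0 < g by exact: lt_le_trans cg.
have cx : 0 <= 1 - c * x by rewrite subr_ge0 (le_trans _ ler01)// mulr_ge0_le0// ltW.
rewrite expr1; apply: ler_pM => //; first exact: ltW.
apply: le_trans (expR_ge1Dx _); rewrite lerD2l lerN2.
by rewrite ler_wnM2r.
Qed.

End exp_moments.

Section exp_moment_range.
Context (R : realType) (F : cumulative R R) (c C : R).
Local Notation mu := (lebesgue_stieltjes_measure F).
Hypothesis c0 : 0 < c.
Hypothesis mu_fin : (mu `[c, C]%classic < +oo)%E.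
Hypothesis mu_pos : (0 < mu `[c, C]%classic)%E.

Lemma exp_moment1_small e : 0 < e -> exists x, exp_moment F c C 1 x <= e.
Proof.
move=> e0; pose B := C * fine (mu `[c, C]%classic).
have x0 : 0 <= `|B| / e / c by rewrite !divr_ge0// ltW.
exists (`|B| / e / c); apply: le_trans (exp_moment_bound c0 mu_fin x0) _.
rewrite -/B [c * _]mulrC divfK ?gt_eqF// ler_pdivrMr; last by rewrite ltr_pwDl// divr_ge0// ltW.
rewrite mulrDr mulr1 mulrC divfK ?gt_eqF//.
by apply: le_trans (ler_norm B) _; rewrite lerDr ltW.
Qed.

Lemma exp_moment1_large e : 0 < e -> exists x, e <= exp_moment F c C 1 x.
Proof.
move=> e0; pose B := c * fine (mu `[c, C]%classic).
have B0 : 0 < B by rewrite mulr_gt0// fine_gt0// mu_pos.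
have x0 : - (e / B / c) <= 0 by rewrite oppr_le0 !divr_ge0// ltW.
exists (- (e / B / c)); apply: le_trans (exp_moment_coercive c0 mu_fin x0).
rewrite -/B mulrN opprK [c * _]mulrC divfK ?gt_eqF// mulrDr mulr1 [B * (e / B)]mulrC divfK
  ?gt_eqF//.
by rewrite lerDr ltW.
Qed.

End exp_moment_range.

Section utility.
Context (R : realType) (mass : R) (F : cumulativeBounded 0 mass).
Local Notation mu := (lebesgue_stieltjes_measure F).

Let mu_itv a b : a <= b -> mu `]a, b]%classic = (F b - F a)%:E.
Proof.
move=> ab; rewrite /lebesgue_stieltjes_measure /measure_extension.
by rewrite measurable_mu_extE /=; [rewrite wlength_itv_bnd|exact: is_ocitv].
Qed.

Hypothesis mass_gt0 : 0 < mass.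
Hypothesis F_supp : exists K : set R, [/\ compact K, K `<=` `]0, +oo[ & mu (~` K) = 0%E].

(** A compact subset of []0, +oo[] stays away from 0. If the interval were null, all increments of
    [F] would vanish, against the limits 0 and [mass] of [F]. *)
Lemma supported_itv : exists c C : R, [/\ 0 < c, (mu `[c, C]%classic < +oo)%E,
  (0 < mu `[c, C]%classic)%E & mu (~` `[c, C]%classic) = 0%E].
Proof.
have [K [cK K0 muK]] := F_supp.
have [e e0 He] : exists2 e : R, 0 < e & forall x, K x -> e <= x.
  have : nbhs (0 : R) (~` K).
    apply: open_nbhs_nbhs; split; first by apply: closed_openC; exact: compact_closed.
    by move=> /K0; rewrite /= in_itv /= ltxx.
  move=> [e /= e0 He]; exists e => // x Kx; rewrite leNgt; apply/negP => xe.
  have x0 : 0 < x by have := K0 _ Kx; rewrite /= in_itv /= andbT.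
  by apply: (He x) => //=; rewrite sub0r normrN gtr0_norm.
have [C HC] : exists C : R, forall x, K x -> x <= C.
  have /compact_bounded := cK; move=> [M [_ HM]]; exists (M + 1) => x Kx.
  apply: le_trans (ler_norm x) _; apply: (HM (M + 1)) => //; by rewrite ltrDl.
have mI : measurable (`[e, C]%classic : set (measurableTypeR R)) by exact: measurable_itv.
have sub : ~` `[e, C]%classic `<=` ~` K.
  by move=> x nx Kx; apply: nx; rewrite /= in_itv /= He// HC.
have mK : measurable (~` K : set (measurableTypeR R)).
  apply: measurableC; exact: (compact_measurable cK).
have N0 : mu (~` `[e, C]%classic) = 0%E.
  apply/eqP; rewrite eq_le measure_ge0 andbT -muK.
  by apply: le_measure; rewrite ?inE//; exact: measurableC.
exists e, C; split => //.
  apply: (@le_lt_trans _ _ (mu `]e - 1, Num.max C e]%classic)).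
    apply: le_measure; rewrite ?inE//.
    by move=> g; rewrite /= !in_itv /= le_max => /andP[eg ->]; rewrite andbT; lra.
  by rewrite mu_itv ?ltry// le_max; apply/orP; right; lra.
rewrite lt_neqAle measure_ge0 andbT eq_sym; apply/eqP => I0.
have F_cst z z' : F z = F z'.
  wlog zz' : z z' / z <= z' => [H|].
    by have [/H//|/ltW/H/esym] := leP z z'.
  apply/esym/eqP; rewrite -subr_eq0; apply/eqP.
  suff : mu `]z, z']%classic = 0%E by rewrite mu_itv// => -[].
  apply/eqP; rewrite eq_le measure_ge0 andbT -[leRHS]adde0 -[X in (X + _)%E]I0 -N0.
  have mC : measurable (~` `[e, C]%classic : set (measurableTypeR R)) by exact: measurableC.
  apply: (@le_trans _ _ (mu (`[e, C]%classic `|` ~` `[e, C]%classic))).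
    apply: le_measure; rewrite ?inE//; [exact: measurableU|move=> g _].
    by have [?|?] := pselect (`[e, C]%classic g); [left|right].
  exact: measureU2.
have F0 : (F : R -> R) = cst (F 0) by apply/funext => z; exact: F_cst.
have Fc (G : set_system R) : Filter G -> F @ G --> F 0 by rewrite F0 => FG; exact: cvg_cst.
have Fy : F 0 = mass by exact: (cvg_unique _ (Fc _ _) (@cumulativey _ _ _ F)).
have FNy : F 0 = 0 by exact: (cvg_unique _ (Fc _ _) (@cumulativeNy _ _ _ F)).
by move: mass_gt0; rewrite -Fy FNy ltxx.
Qed.

Variables c C : R.
Hypothesis c0 : 0 < c.
Hypothesis mu_fin : (mu `[c, C]%classic < +oo)%E.
Hypothesis mu_pos : (0 < mu `[c, C]%classic)%E.
Hypothesis mu_supp : mu (~` `[c, C]%classic) = 0%E.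

Lemma utilityE x : utility F x = - exp_moment F c C 0 x.
Proof.
rewrite /utility /exp_moment /Rintegral; congr (- fine _).
have mI : measurable (`[c, C]%classic : set (measurableTypeR R)) by exact: measurable_itv.
have mE : measurable_fun setT (fun g : R => (expR (- (g * x)))%:E).
  apply/measurable_EFinP; apply: measurableT_comp => //.
  by apply: measurableT_comp => //; apply: measurable_funM.
rewrite (@ge0_negligible_integral _ _ _ mu _ (~` `[c, C]%classic))//.
- have -> : `]0, +oo[%classic `\` ~` `[c, C]%classic = `[c, C]%classic :> set R.
    apply/seteqP; split => g /=; rewrite !in_itv /= ?andbT.
      by move=> [_ /contrapT].
    move=> cg; split; last by move/(_ cg).
    by move: cg => /andP[cg _]; exact: lt_le_trans cg.
  by apply: eq_integral => g _; rewrite expr0 mul1r.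
- exact: measurableC.
- exact: measurable_funTS.
Qed.

Lemma exp_moment0E x : (exp_moment F c C 0 x)%:E =
  (\int[mu]_(g in `[c, C]) (expR (- (g * x)))%:E)%E.
Proof.
rewrite /exp_moment /Rintegral fineK.
  by apply: eq_integral => g _; rewrite expr0 mul1r.
by apply: integrable_fin_num => //; exact: exp_moment_integrable.
Qed.

Section rearrangement.
Context d (T : measurableType d) (P : probability T R) (D : set T) (X Y Y' : T -> R).
Hypotheses (mD : measurable D) (mX : measurable_fun setT X)
  (mY : measurable_fun setT Y) (mY' : measurable_fun setT Y').
Hypothesis YY' : forall z, P (D `&` [set t | Y t < z]) = P (D `&` [set t | Y' t < z]).

Let k (Z : T -> R) (p : T * R) : \bar R :=
  (\1_D p.1 * \1_(`[c,
    C]%classic : set R) p.2 * (expR (- (p.2 * X p.1)) * expR (- (p.2 * Z p.1))))%:E.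

Let mexp (Z : T -> R) : measurable_fun setT Z ->
  measurable_fun setT (fun p : T * R => expR (- (p.2 * Z p.1))).
Proof.
move=> mZ; apply: measurableT_comp => //; apply: measurableT_comp => //.
by apply: measurable_funM => //; exact: measurableT_comp.
Qed.

Let mk Z : measurable_fun setT Z -> measurable_fun setT (k Z).
Proof.
move=> mZ; apply/measurable_EFinP; apply: measurable_funM; last first.
  by apply: measurable_funM; exact: mexp.
have mI : measurable (`[c, C]%classic : set R) by exact: measurable_itv.
apply: measurable_funM.
  exact: (measurableT_comp (measurable_indic mD) (@measurable_fst _ _ T R)).
exact: (measurableT_comp (measurable_indic mI) (@measurable_snd _ _ T R)).
Qed.

Let k0 Z p : (0 <= k Z p)%E.
Proof. by rewrite lee_fin !mulr_ge0 ?expR_ge0. Qed.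

Let kE Z w g : k Z (w, g) = (\1_D w * \1_(`[c,
  C]%classic : set R) g * expR (- (g * (X w + Z w))))%:E.
Proof. by rewrite /k /= -expRD; congr ((_ * expR _)%:E); ring. Qed.

Let swap Z : measurable_fun setT Z ->
  (\int[P]_(w in D) (exp_moment F c C 0 (X w + Z w)%R)%:E =
   \int[mu]_(g in `[c, C]) \int[P]_(w in D) (expR (- (g * X w)) * expR (- (g * Z w)))%:E)%E.
Proof.
move=> mZ.
transitivity (\int[P]_w \int[mu]_g k Z (w, g))%E.
  rewrite integral_mkcond; apply: eq_integral => w _.
  have [Dw|Dw] := pselect (D w); last first.
    rewrite erestrict_out//; apply/esym/integral0_eq => g _.
    by rewrite kE indicE memNset// !mul0r.
  rewrite erestrict_in// exp_moment0E integral_mkcond; apply: eq_integral => g _.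
  rewrite kE indicE mem_set// mul1r indicE.
  have [cg|cg] := pselect ((`[c, C]%classic : set R) g).
    by rewrite erestrict_in// mem_set// mul1r.
  by rewrite erestrict_out// memNset// mul0r.
rewrite (@fubini_tonelli _ _ _ _ _ P mu (k Z) (mk mZ) (k0 Z)).
rewrite [RHS]integral_mkcond; apply: eq_integral => g _.
have [cg|cg] := pselect ((`[c, C]%classic : set R) g); last first.
  rewrite erestrict_out//; apply: integral0_eq => w _.
  by rewrite kE [X in _ * X * _]indicE memNset// mulr0 mul0r.
rewrite erestrict_in// [RHS]integral_mkcond; apply: eq_integral => w _.
rewrite /k /= [X in _ * X * _]indicE mem_set// mulr1 indicE.
have [Dw|Dw] := pselect (D w).
  by rewrite erestrict_in// mem_set// mul1r.
by rewrite erestrict_out// memNset// mul0r.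
Qed.

Let m_inner Z : measurable_fun setT Z -> measurable_fun (`[c,
  C]%classic : set (measurableTypeR R))
  (fun g : R => \int[P]_(w in D) (expR (- (g * X w)) * expR (- (g * Z w)))%:E)%E.
Proof.
move=> mZ.
have := @measurable_fun_fubini_tonelli_G _ _ _ _ _ P (k Z) (mk mZ) (k0 Z).
move=> /(measurable_funTS (D := `[c, C]%classic)).
apply: eq_measurable_fun => g; rewrite inE => cg.
rewrite /fubini_G [RHS]integral_mkcond; apply: eq_integral => w _.
rewrite /k /= [X in _ * X * _]indicE mem_set// mulr1 indicE.
have [Dw|Dw] := pselect (D w).
  by rewrite erestrict_in// mem_set// mul1r.
by rewrite erestrict_out// memNset// mul0r.
Qed.

Let inner_ge0 Z (g : R) : (0 <= \int[P]_(w in D) (expR (- (g * X w)) * expR (- (g * Z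
  w)))%:E)%E.
Proof. by apply: integral_ge0 => w _; rewrite lee_fin mulr_ge0 ?expR_ge0. Qed.

Let mexpg (g : R) Z : measurable_fun setT Z -> measurable_fun D (fun w => expR (- (g * Z w))).
Proof.
move=> mZ; apply: measurable_funTS; apply: measurableT_comp => //.
by apply: measurableT_comp => //; exact: measurable_funM.
Qed.

Let level (g z : R) Z : 0 < g -> 0 < z ->
  D `&` [set w | z < expR (- (g * Z w))] = D `&` [set w | Z w < - ln z / g].
Proof.
move=> g0 z0; apply/seteqP; split => w /= [Dw H]; split => //.
  by rewrite ltr_pdivlMr// ltrNr mulrC -ltr_expR lnK.
by rewrite -[X in X < _]lnK ?posrE// ltr_expR ltrNr mulrC -ltr_pdivlMr.
Qed.

Let moment_le Z Z' : measurable_fun setT Z -> measurable_fun setT Z' ->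
  (forall g : R, 0 < g ->
    (\int[P]_(w in D) (expR (- (g * X w)) * expR (- (g * Z w)))%:E <=
     \int[P]_(w in D) (expR (- (g * X w)) * expR (- (g * Z' w)))%:E)%E) ->
  (\int[P]_(w in D) (exp_moment F c C 0 (X w + Z w)%R)%:E <=
   \int[P]_(w in D) (exp_moment F c C 0 (X w + Z' w)%R)%:E)%E.
Proof.
move=> mZ mZ' le; rewrite (swap mZ) (swap mZ').
apply: ge0_le_integral; first exact: measurable_itv.
- by move=> g _; exact: inner_ge0.
- exact: m_inner.
- exact: m_inner.
by move=> g; rewrite /= in_itv /= => /andP[cg _]; apply: le; exact: lt_le_trans cg.
Qed.

(** For each fixed rate [g > 0] the exponential of the sum factors, and both factors reverse the
    order, so they are comonotone when [X] and [Y'] are. Rearranging at each [g] and integrating in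
    [g] gives the claim. As [u] is minus this moment, the comonotone copy minimises expected
    utility. *)
Lemma exp_moment_comonotone : (forall s t, D s -> D t -> Y' s < Y' t -> X s <= X t) ->
  (\int[P]_(w in D) (exp_moment F c C 0 (X w + Y w)%R)%:E <=
   \int[P]_(w in D) (exp_moment F c C 0 (X w + Y' w)%R)%:E)%E.
Proof.
move=> co; apply: moment_le => // g g0.
apply: integral_comonotone_max; [exact: mD|exact: mexpg|exact: mexpg|exact: mexpg|..];
  try by move=> ? _; exact: expR_ge0.
- by move=> z z0; rewrite !level.
- move=> s t Ds Dt; rewrite ltr_expR ltrN2 ltr_pM2l// => ts.
  by rewrite ler_expR lerN2 ler_pM2l//; exact: co.
Qed.

Lemma exp_moment_antimonotone : (forall s t, D s -> D t -> Y' s < Y' t -> X t <= X s) ->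
  (\int[P]_(w in D) (exp_moment F c C 0 (X w + Y' w)%R)%:E <=
   \int[P]_(w in D) (exp_moment F c C 0 (X w + Y w)%R)%:E)%E.
Proof.
move=> co; apply: moment_le => // g g0.
apply: integral_antimonotone_min; [exact: mD|exact: mexpg|exact: mexpg|exact: mexpg|..];
  try by move=> ? _; exact: expR_ge0.
- by move=> z z0; rewrite !level.
- move=> s t Ds Dt; rewrite ltr_expR ltrN2 ltr_pM2l// => ts.
  by rewrite ler_expR lerN2 ler_pM2l//; exact: co.
Qed.

End rearrangement.
End utility.

Lemma differentiable_within_derivable (R : realType) (f : R -> R) (a b p : R) :
  differentiable_within `[a, b]%classic f -> a < p < b -> derivable f p 1.
Proof.
move=> df /andP[ap pb].
have /df /cvg_ex[l Hl] : (`[a, b]%classic : set R) p by rewrite /= in_itv /= !ltW.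
have {}Hl : h^-1 *: (f (h + p) - f p) @[h --> 0^'] --> l.
  apply/cvgrPdist_lt => e e0; move/cvgrPdist_lt : Hl => /(_ e e0) [d /= d0 Hd].
  exists (Num.min d (Num.min (p - a) (b - p))); first by rewrite /= !lt_min d0 !subr_gt0 ap pb.
  move=> k /=; rewrite sub0r normrN !lt_min => /and3P[kd ka kb] k0.
  have := Hd (k + p); rewrite /= opprD addrCA subrr addr0 normrN => /(_ kd).
  rewrite addrK [k + p != p](_ : _ = (k != 0)); last by rewrite -subr_eq0 addrK.
  move=> /(_ k0); rewrite in_itv /=.
  have -> : a <= k + p <= b.
    move: ka kb; rewrite !ltr_norml => /andP[? ?] /andP[? ?]; apply/andP; split; lra.
  by move=> /(_ isT); rewrite /GRing.scale /= mulrC.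
apply/cvg_ex; exists l; apply: cvg_trans Hl; apply: near_eq_cvg; apply: nearW => k /=.
by rewrite [k *: 1]mulr1.
Qed.

Lemma derivable_slope (R : realType) (D : R -> R) (p : R) :
  derivable D p 1 -> derive1 D p <= 0 -> forall e, 0 < e -> \forall t \near p,
    (p <= t -> D t <= D p + e * (t - p)) /\ (t <= p -> D p - e * (p - t) <= D t).
Proof.
move=> dD D0 e e0.
have : h^-1 *: (D (h + p) - D p) @[h --> 0^'] --> derive1 D p.
  move: dD; rewrite /derivable.
  rewrite (_ : (fun h : R => h^-1 *: ((D \o shift p) (h *: (1 : R)) - D p)) = (fun h : R =>
    h^-1 *: (D (h + p) - D p))) //.
  by apply/funext => k; rewrite /= [k *: 1]mulr1.
move=> /cvgrPdist_lt /(_ e e0) [d /= d0 Hd].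
exists d => //= t ptd.
have [->|tp] := eqVneq t p; first by rewrite subrr mulr0 addr0 subr0.
have tp0 : t - p != 0 by rewrite subr_eq0.
have := Hd (t - p); rewrite /= sub0r normrN distrC subrK => /(_ ptd tp0).
rewrite ltr_norml => /andP[+ _]; rewrite /GRing.scale /= => H.
have {}H : (t - p)^-1 * (D t - D p) < e by lra.
split => le.
  have tp1 : 0 < t - p by rewrite lt_neqAle eq_sym tp0 subr_ge0.
  by move: H; rewrite ltr_pdivrMl// => H; lra.
have tp1 : 0 < p - t by rewrite lt_neqAle subr_ge0 le andbT eq_sym subr_eq0 eq_sym.
move: H; rewrite -[t - p]opprB invrN mulNr -mulrN opprB ltr_pdivrMl// => H; lra.
Qed.

Lemma abs_continuous_continuous (R : realType) (a b : R) (f : R -> R) p :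
  abs_continuous a b f -> a < p < b -> {for p, continuous f}.
Proof.
move=> acf /andP[ap pb]; apply/cvgrPdist_lt => e e0.
have [d d0 Hd] := acf e e0.
near=> q.
have : `|p - q| < Num.min d (Num.min (p - a) (b - p)).
  by near: q; apply: cvgr_dist_lt => //; rewrite !lt_min d0 !subr_gt0 ap pb.
rewrite !lt_min => /and3P[qp qa qb'].
have aq : a < q by have := ler_norm (p - q); lra.
have qb : q < b by have := ler_norm (- (p - q)); rewrite normrN; lra.
have := Hd 1%N (fun=> Num.min p q) (fun=> Num.max p q).
rewrite !big_ord1.
have [pq|qp'] := leP p q.
  rewrite distrC; apply => //.
    by move=> k _; split => //; exact: ltW.
  by move: qp; rewrite ler0_norm ?subr_le0// opprB.
apply => //.
  by move=> k _; split => //; exact: ltW.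
by move: qp; rewrite gtr0_norm ?subr_gt0.
Unshelve. all: by end_near. Qed.

(** * The function V, its marginal utility and its mixed derivative *)

Section mixed_utility.
Context (R : realType) (M : nat -> R -> R) (Qth : R -> R) (alpha : R).
Hypothesis M_tangent : forall n x y, M n x - (y - x) * M n.+1 x <= M n y.
Hypothesis M_gt0 : forall n x, 0 < M n x.
Hypothesis alpha01 : 0 <= alpha <= 1.
Hypothesis Qth_homo : forall p q, 0 <= p -> p <= q -> q <= 1 -> Qth p <= Qth q.

(* - V at n = 0 and V_x at n = 1; M n stands for [exp_moment F c C n]. *)
Definition mixM (n : nat) (x p : R) : R :=
  (1 - alpha) * M n (x + Qth p) + alpha * M n (x + Qth (1 - p)).

Let a0 : 0 <= alpha. Proof. by case/andP: alpha01. Qed.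
Let a1 : 0 <= 1 - alpha. Proof. by rewrite subr_ge0; case/andP: alpha01. Qed.

Lemma mixM_tangent n x y p : mixM n x p - (y - x) * mixM n.+1 x p <= mixM n y p.
Proof.
have H1 := M_tangent n (x + Qth p) (y + Qth p).
have H2 := M_tangent n (x + Qth (1 - p)) (y + Qth (1 - p)).
have {}H1 := ler_wpM2l a1 H1.
have {}H2 := ler_wpM2l a0 H2.
apply: le_trans (lerD H1 H2); rewrite /mixM.
rewrite le_eqVlt; apply/orP; left; apply/eqP; ring.
Qed.

Lemma mixM_gt0 n x p : 0 < mixM n x p.
Proof.
have H1 := M_gt0 n (x + Qth p); have H2 := M_gt0 n (x + Qth (1 - p)).
rewrite /mixM; have [->|/eqP a0'] := eqVneq alpha 0.
  by rewrite subr0 mul1r mul0r addr0.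
apply: ltr_wpDl; first by rewrite mulr_ge0// ltW.
by rewrite mulr_gt0// lt_neqAle eq_sym a0 andbT; apply/eqP.
Qed.

Lemma M_homo n x y : x <= y -> M n y <= M n x.
Proof. exact: (tangent_homo (M_tangent n) (M_gt0 n.+1)). Qed.

Lemma mixM_homo n p x y : x <= y -> mixM n y p <= mixM n x p.
Proof.
exact: (tangent_homo (fun x y => mixM_tangent n x y p) (fun x => mixM_gt0 n.+1 x p)).
Qed.

Lemma mixM_lt n p x y : x < y -> mixM n y p < mixM n x p.
Proof.
exact: (tangent_lt (fun x y => mixM_tangent n x y p) (fun x => mixM_gt0 n.+1 x p)).
Qed.

Lemma mixM_inj n p x y : mixM n x p = mixM n y p -> x = y.
Proof.
move=> E; apply/eqP; rewrite eq_le; apply/andP; split; rewrite leNgt; apply/negP.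
  by move=> /(mixM_lt n p); rewrite E ltxx.
by move=> /(mixM_lt n p); rewrite E ltxx.
Qed.

Lemma mixM_le n x p : 0 <= p <= 1 -> mixM n x p <= M n (x + Qth 0).
Proof.
move=> /andP[p0 p1]; have -> : M n (x + Qth 0) = (1 - alpha) * M n (x + Qth 0) + alpha * M n (x
  + Qth 0) by ring.
apply: lerD; rewrite ler_wpM2l//; apply: M_homo; rewrite lerD2l; apply: Qth_homo => //.
- by rewrite subr_ge0.
- by rewrite lerBlDr lerDl.
Qed.

Lemma mixM_ge n x p : 0 <= p <= 1 -> M n (x + Qth 1) <= mixM n x p.
Proof.
move=> /andP[p0 p1]; have -> : M n (x + Qth 1) = (1 - alpha) * M n (x + Qth 1) + alpha * M n (x
  + Qth 1) by ring.
apply: lerD; rewrite ler_wpM2l//; apply: M_homo; rewrite lerD2l; apply: Qth_homo => //.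
- by rewrite subr_ge0.
- by rewrite lerBlDr lerDl.
Qed.

Lemma M_derive n (x : R) : is_derive x (1 : R) (M n) (- M n.+1 x).
Proof.
have [dM dME] := tangent_derive (M_tangent n) (M_tangent n.+1) (M_gt0 n.+2) (@M_homo n.+2) x.
by apply: DeriveDef => //; rewrite -derive1E.
Qed.

Lemma M_measurable n : measurable_fun setT (M n).
Proof.
apply: continuous_measurable_fun => x; apply: differentiable_continuous.
by apply/derivable1_diffP; apply: ex_derive; exact: M_derive.
Qed.

Lemma M_continuous n : continuous (M n.+1).
Proof. exact: (tangent_continuous (M_tangent n.+1) (M_gt0 n.+2) (@M_homo n.+2)). Qed.

Hypothesis M1_small : forall e, 0 < e -> exists x, M 1 x <= e.
Hypothesis M1_large : forall e, 0 < e -> exists x, e <= M 1 x.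

Lemma M1_surj y : 0 < y -> exists x, M 1 x = y.
Proof.
move=> y0; have [x1 H1] := M1_small y0; have [x2 H2] := M1_large y0.
have x21 : x2 <= x1.
  rewrite leNgt; apply/negP => /(tangent_lt (M_tangent 1) (M_gt0 2)).
  by rewrite ltNge (le_trans H1).
have [|x _ <-] := @IVT R (M 1) _ _ y x21 (continuous_subspaceT (@M_continuous 0)).
  by rewrite ge_min le_max H1 H2 orbT.
by exists x.
Qed.

Lemma mixM1_continuous p : continuous (mixM 1 ^~ p).
Proof.
exact: (tangent_continuous (fun x y => mixM_tangent 1 x y p) (fun x => mixM_gt0 2 x p)
  (@mixM_homo 2 p)).
Qed.

(** The marginal utility at [p] lies between the translates of [M 1] by [Qth 1] and by [Qth 0]; the
    preimages of [y] under these bracket the solution. *)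
Lemma mixM1_surj y p : 0 <= p <= 1 -> 0 < y -> exists x, mixM 1 x p = y.
Proof.
move=> p01 y0; have [x1 H1] := M1_surj y0.
have L1 : mixM 1 (x1 - Qth 0) p <= y by rewrite -H1 -[in leRHS](subrK (Qth 0) x1);
  exact: mixM_le.
have L2 : y <= mixM 1 (x1 - Qth 1) p by rewrite -H1 -[in leLHS](subrK (Qth 1) x1);
  exact: mixM_ge.
have x21 : x1 - Qth 1 <= x1 - Qth 0 by rewrite lerD2l lerN2; apply: Qth_homo.
have [|x _ <-] := @IVT R (mixM 1 ^~ p) _ _ y x21 (continuous_subspaceT (@mixM1_continuous p)).
  by rewrite ge_min le_max L1 L2 orbT.
by exists x.
Qed.

Section value.
Variable u : R -> R.
Hypothesis uE : forall x, u x = - M 0 x.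
Local Notation V := (Vfun u Qth alpha).

Lemma VfunE x p : V x p = - mixM 0 x p.
Proof. by rewrite /Vfun /mixM !uE !mulrN opprD. Qed.

Lemma derive1_utility x : derive1 u x = M 1 x.
Proof.
have -> : u = - M 0 by apply/funext => z; rewrite uE.
have dM := M_derive 0 x.
by rewrite derive1E derive_val opprK.
Qed.

Lemma dx_Vfun x p : dx V x p = mixM 1 x p.
Proof.
rewrite /dx; have -> : (fun y => V y p) = - (mixM 0 ^~ p) by apply/funext => y; rewrite VfunE.
have [dM dME] := tangent_derive (fun x y => mixM_tangent 0 x y p)
  (fun x y => mixM_tangent 1 x y p) (fun x => mixM_gt0 2 x p) (@mixM_homo 2 p) x.
by rewrite derive1E deriveN// -derive1E dME opprK.
Qed.

Lemma Vfun_tangent y z p : V z p <= V y p + mixM 1 y p * (z - y).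
Proof. by rewrite !VfunE; have := mixM_tangent 0 y z p; lra. Qed.

Lemma Vfun_tangent_strict y z p : y != z -> V z p < V y p + mixM 1 y p * (z - y).
Proof.
rewrite !VfunE => yz.
have := tangent_strict (fun x y => mixM_tangent 0 x y p) (fun x y => mixM_tangent 1 x y p) (fun
  x => mixM_gt0 2 x p) yz.
lra.
Qed.

Lemma SfunP y p : 0 <= p <= 1 -> 0 < y -> mixM 1 (Sfun V y p) p = y.
Proof.
move=> p01 y0; rewrite -dx_Vfun.
have : [set z | dx V z p = y] !=set0.
  by have [z zE] := mixM1_surj p01 y0; exists z; rewrite /= dx_Vfun.
by move=> /getPex.
Qed.

Hypothesis Qth_derivable : forall p, 0 < p < 1 -> derivable Qth p 1.

(* V_xp *)
Definition dp_mixM1 (x p : R) : R :=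
  - ((1 - alpha) * (M 2 (x + Qth p) * derive1 Qth p)) +
  alpha * (M 2 (x + Qth (1 - p)) * derive1 Qth (1 - p)).

Lemma M_Qth_derive n (x p : R) : 0 < p < 1 ->
  is_derive p (1 : R) (fun q => M n (x + Qth q)) (- M n.+1 (x + Qth p) * derive1 Qth p).
Proof.
move=> p01.
have dQ : is_derive p (1 : R) Qth (derive1 Qth p).
  by apply: DeriveDef; [exact: Qth_derivable|rewrite derive1E].
have dM := M_derive n (x + Qth p).
have dS : is_derive p (1 : R) (fun q => x + Qth q) (derive1 Qth p).
  by have := is_deriveD (is_derive_cst x p 1) dQ; rewrite add0r.
exact: (@is_derive1_comp R (M n) (fun q => x + Qth q) p _ _ dM dS).
Qed.

Lemma M_Qth_onem_derive n (x p : R) : 0 < p < 1 ->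
  is_derive p (1 : R) (fun q => M n (x + Qth (1 - q))) (M n.+1 (x + Qth (1 - p)) * derive1 Qth
    (1 - p)).
Proof.
move=> /andP[p0 p1].
have p01' : 0 < 1 - p < 1 by rewrite subr_gt0 p1 ltrBlDr ltrDl.
have dM := M_Qth_derive n x p01'.
have dS : is_derive p (1 : R) (fun q : R => 1 - q) (-1).
  have := is_deriveB (is_derive_cst (1 : R) p 1) (is_derive_id p 1).
  by rewrite sub0r.
have := @is_derive1_comp R (fun q => M n (x + Qth q)) (fun q => 1 - q) p _ _ dM dS.
by rewrite mulrN1 mulNr opprK.
Qed.

Lemma mixM1_derive_p (x p : R) : 0 < p < 1 -> is_derive p (1 : R) (mixM 1 x) (dp_mixM1 x p).
Proof.
move=> p01.
have H1 := is_deriveZ (1 - alpha) (M_Qth_derive 1 x p01).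
have H2 := is_deriveZ alpha (M_Qth_onem_derive 1 x p01).
have H3 := is_deriveD H1 H2.
apply: (is_derive_eq H3); rewrite /dp_mixM1 /GRing.scale /=; ring.
Qed.

(** [dxdp] differentiates in [p] first, while the slope analysis of the candidate differentiates
    [V_x] in [p]. Together with [mixM1_derive_p] this shows that the two orders agree, which brings
    [Phi] into play. *)
Lemma dxdp_Vfun (x p : R) : 0 < p < 1 -> dxdp V x p = dp_mixM1 x p.
Proof.
move=> p01; rewrite /dxdp.
have dV y : derive1 (V y) p = (1 - alpha) * (M 1 (y + Qth p) * derive1 Qth p)
    - alpha * (M 1 (y + Qth (1 - p)) * derive1 Qth (1 - p)).
  have H1 := is_deriveZ (1 - alpha) (M_Qth_derive 0 y p01).
  have H2 := is_deriveZ alpha (M_Qth_onem_derive 0 y p01).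
  have H3 := is_deriveN (is_deriveD H1 H2).
  have -> : V y = - ((1 - alpha) *: (fun q => M 0 (y + Qth q)) + alpha *: (fun q => M 0 (y +
    Qth (1 - q)))).
    by apply/funext => q; rewrite VfunE.
  rewrite derive1E derive_val /GRing.scale /=; ring.
rewrite (_ : (fun y => _) = fun y => (1 - alpha) * derive1 Qth p * M 1 (y + Qth p) -
  alpha * derive1 Qth (1 - p) * M 1 (y + Qth (1 - p))); last first.
  by apply/funext => y; rewrite dV; ring.
have dS (q : R) : is_derive x (1 : R) (fun y => M 1 (y + q)) (- M 2 (x + q)).
  have dT : is_derive x (1 : R) (fun y : R => y + q) 1.
    by have := is_deriveD (is_derive_id x 1) (is_derive_cst q x 1); rewrite addr0.
  by have := @is_derive1_comp R (M 1) (fun y => y + q) x _ _ (M_derive 1 (x + q)) dT;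
    rewrite mulr1.
have H1 := is_deriveZ ((1 - alpha) * derive1 Qth p) (dS (Qth p)).
have H2 := is_deriveZ (alpha * derive1 Qth (1 - p)) (dS (Qth (1 - p))).
have H3 := is_deriveB H1 H2.
rewrite derive1E.
transitivity ('D_1 (((1 - alpha) * derive1 Qth p) *: (fun y => M 1 (y + Qth p)) - (alpha *
  derive1 Qth (1 - p)) *: (fun y => M 1 (y + Qth (1 - p)))) x).
  by [].
rewrite derive_val /dp_mixM1 /GRing.scale /=; ring.
Qed.

End value.
End mixed_utility.

(** * Regularity of the candidate *)

(** The increments of [G] are dominated by [D], with the opposite sign. Right of [p] one has
    [D t <= e * c * (t - p)], whereas a drop of [G] by more than [e * (t - p)] would push [D t]
    above this. The left side is symmetric. *)
Lemma slope_ge0_gap (R : realType) (D G : R -> R) (p c : R) : 0 < c ->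
  derivable D p 1 -> derive1 D p <= 0 -> D p = 0 ->
  (\forall t \near p, [/\ c * `|G t - G p| <= `|D t|,
     G t <= G p -> 0 <= D t & G p <= G t -> D t <= 0]) ->
  slope_ge0 G p.
Proof.
move=> c0 dD D'0 Dp gap e e0.
have ec : 0 < e * c by exact: mulr_gt0.
have HD := derivable_slope dD D'0 ec; rewrite Dp in HD.
apply: filterS2 HD gap => t [Dr Dl] [g1 g2 g3]; split => le.
  rewrite leNgt; apply/negP => lt.
  have e1 : 0 <= e * (t - p) by rewrite mulr_ge0 ?subr_ge0// ltW.
  have Gtp : G t <= G p by lra.
  move: g1; rewrite (ger0_norm (g2 Gtp)) ler0_norm ?subr_le0// => g1.
  have := Dr le; have : c * (e * (t - p)) < c * (G p - G t) by rewrite ltr_pM2l//; lra.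
  have -> : e * c * (t - p) = c * (e * (t - p)) by ring.
  lra.
rewrite leNgt; apply/negP => lt.
have e1 : 0 <= e * (p - t) by rewrite mulr_ge0 ?subr_ge0// ltW.
have Gpt : G p <= G t by lra.
move: g1; rewrite (ler0_norm (g3 Gpt)) ger0_norm ?subr_ge0// => g1.
have := Dl le; have : c * (e * (p - t)) < c * (G t - G p) by rewrite ltr_pM2l//; lra.
have -> : e * c * (p - t) = c * (e * (p - t)) by ring.
lra.
Qed.

Section optimal_quantile.
Context (R : realType) (M : nat -> R -> R) (Qth : R -> R) (alpha : R).
Hypothesis M_tangent : forall n x y, M n x - (y - x) * M n.+1 x <= M n y.
Hypothesis M_gt0 : forall n x, 0 < M n x.
Hypothesis alpha01 : 0 <= alpha <= 1.
Hypothesis Qth_homo : forall p q, 0 <= p -> p <= q -> q <= 1 -> Qth p <= Qth q.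
Hypothesis M1_small : forall e, 0 < e -> exists x, M 1 x <= e.
Hypothesis M1_large : forall e, 0 < e -> exists x, e <= M 1 x.
Hypothesis Qth_derivable : forall p, 0 < p < 1 -> derivable Qth p 1.
Variable k : R.
Hypothesis k0 : 0 <= k.
Hypothesis Qth_lip : forall p q, 0 <= p <= 1 -> 0 <= q <= 1 -> `|Qth p - Qth q| <= k * `|p - q|.
Local Notation W := (mixM M Qth alpha 1).
Local Notation Wp := (dp_mixM1 M Qth alpha).

Let a0 : 0 <= alpha. Proof. by case/andP: alpha01. Qed.
Let a1 : 0 <= 1 - alpha. Proof. by rewrite subr_ge0; case/andP: alpha01. Qed.

Local Notation W_ := (mixM M Qth alpha).
Let Wtan n p x y : W_ n x p - (y - x) * W_ n.+1 x p <= W_ n y p.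
Proof. exact: mixM_tangent. Qed.
Let Wgt0 n p x : 0 < W_ n x p. Proof. exact: mixM_gt0. Qed.
Let Whomo n p x y : x <= y -> W_ n y p <= W_ n x p. Proof. exact: mixM_homo. Qed.
Let Wlt n p x y : x < y -> W_ n y p < W_ n x p. Proof. exact: mixM_lt. Qed.
Let Wle n x p : 0 <= p <= 1 -> W_ n x p <= M n (x + Qth 0). Proof. exact: mixM_le. Qed.
Let Wge n x p : 0 <= p <= 1 -> M n (x + Qth 1) <= W_ n x p. Proof. exact: mixM_ge. Qed.

Lemma mixM1_lip_ge B t x y : 0 <= t <= 1 -> x <= B -> y <= B ->
  M 2 (B + Qth 1) * `|x - y| <= `|W x t - W y t|.
Proof.
move=> t01 xB yB.
have H := tangent_lip_ge (Wtan 1 t) (Wgt0 2 t) (@Whomo 2 t) xB yB.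
apply: le_trans H; rewrite ler_wpM2r//.
exact: Wge.
Qed.

Lemma mixM1_lip_p B x s t : - B <= x -> 0 <= s <= 1 -> 0 <= t <= 1 ->
  `|W x s - W x t| <= M 2 (- B + Qth 0) * (k * `|s - t|).
Proof.
move=> Bx s01 t01.
have Q0 p : 0 <= p <= 1 -> - B + Qth 0 <= x + Qth p.
  by move=> /andP[p0 p1]; apply: lerD => //; apply: Qth_homo.
have onem01 (p : R) : 0 <= p <= 1 -> 0 <= 1 - p <= 1.
  by move=> /andP[p0 p1]; rewrite subr_ge0 p1 lerBlDr lerDl p0.
have L p q : 0 <= p <= 1 -> 0 <= q <= 1 ->
    `|M 1 (x + Qth p) - M 1 (x + Qth q)| <= M 2 (- B + Qth 0) * (k * `|p - q|).
  move=> p01 q01.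
  apply: le_trans (tangent_lip (M_tangent 1) (M_gt0 2) (@M_homo _ _ M_tangent M_gt0 2) (Q0 _
    p01) (Q0 _ q01)) _.
  rewrite ler_wpM2l//; first exact: ltW.
  by rewrite opprD addrACA subrr add0r; exact: Qth_lip.
have L1 := L _ _ s01 t01.
have L2 := L _ _ (onem01 _ s01) (onem01 _ t01).
have E : `|1 - s - (1 - t)| = `|s - t| by rewrite opprB addrC addrA subrK distrC.
rewrite E in L2.
have -> : W x s - W x t = (1 - alpha) * (M 1 (x + Qth s) - M 1 (x + Qth t)) +
  alpha * (M 1 (x + Qth (1 - s)) - M 1 (x + Qth (1 - t))) by rewrite /mixM; ring.
apply: le_trans (ler_normD _ _) _; rewrite !normrM (ger0_norm a0) (ger0_norm a1).
have -> : M 2 (- B + Qth 0) * (k * `|s - t|) = (1 - alpha) * (M 2 (- B + Qth 0) * (k * `|s -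
  t|)) +
  alpha * (M 2 (- B + Qth 0) * (k * `|s - t|)) by ring.
by apply: lerD; rewrite ler_wpM2l.
Qed.

Variables (Qb h : R -> R).
Hypothesis hE : forall p, 0 < p < 1 -> W (Qb p) p = h p.
Hypothesis h_ac : forall a b, 0 < a -> a <= b -> b < 1 -> abs_continuous a b h.

Lemma h_gt0 p : 0 < p < 1 -> 0 < h p.
Proof. by move=> /hE <-; exact: mixM_gt0. Qed.

Lemma h_continuous p : 0 < p < 1 -> {for p, continuous h}.
Proof.
move=> /andP[p0 p1]; apply: (@abs_continuous_continuous _ (p / 2) ((1 + p) / 2)).
  by apply: h_ac; lra.
by apply/andP; split; lra.
Qed.

(** On [[a, b]] the continuous function [h] has a maximum and a positive minimum. Since [W] lies
    between two translates of [M 1], solving for these two values bounds [Qb] from both sides. *)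
Lemma Qb_bounded a b : 0 < a -> a <= b -> b < 1 ->
  exists B, forall p, a <= p <= b -> - B <= Qb p <= B.
Proof.
move=> a_0 ab b1.
have ch : {within `[a, b], continuous h}.
  apply: continuous_in_subspaceT => p; rewrite inE /= in_itv /= => /andP[ap pb].
  by apply: h_continuous; rewrite (lt_le_trans a_0 ap) (le_lt_trans pb).
have [cM + HM] := EVT_max ab ch; rewrite in_itv /= => /andP[acM cMb].
have [cm + Hm] := EVT_min ab ch; rewrite in_itv /= => /andP[acm cmb].
have hM0 : 0 < h cM by apply: h_gt0; rewrite (lt_le_trans a_0 acM) (le_lt_trans cMb).
have hm0 : 0 < h cm by apply: h_gt0; rewrite (lt_le_trans a_0 acm) (le_lt_trans cmb).
have [x1 H1] := M1_surj M_tangent M_gt0 M1_small M1_large hM0.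
have [x2 H2] := M1_surj M_tangent M_gt0 M1_small M1_large hm0.
exists (Num.max `|x1 - Qth 1| `|x2 - Qth 0|) => p /andP[ap pb].
have p01 : 0 < p < 1 by rewrite (lt_le_trans a_0 ap) (le_lt_trans pb).
have p01' : 0 <= p <= 1 by case/andP: p01 => /ltW -> /ltW ->.
have pab : p \in `[a, b] by rewrite in_itv /= ap pb.
have L1 : x1 - Qth 1 <= Qb p.
  rewrite leNgt; apply/negP => /(Wlt 1 p); rewrite ltNge hE//.
  rewrite (le_trans (HM _ pab))// -H1 -[in leLHS](subrK (Qth 1) x1).
  exact: Wge.
have L2 : Qb p <= x2 - Qth 0.
  rewrite leNgt; apply/negP => /(Wlt 1 p); rewrite ltNge hE//.
  rewrite (le_trans _ (Hm _ pab))// -H2 -[in leRHS](subrK (Qth 0) x2).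
  exact: Wle.
apply/andP; split.
  apply: le_trans L1; rewrite lerNl le_max; apply/orP; left.
  by rewrite -normrN ler_norm.
by apply: le_trans L2 _; rewrite le_max ler_norm orbT.
Qed.

(** On bounded sets [W] falls at a linear rate at least [c] in its first argument and is Lipschitz
    in [p], so increments of [Qb] are controlled by those of [h] and of [p]. This passes absolute
    continuity on to [Qb]. *)
Lemma Qb_modulus a b : 0 < a -> a <= b -> b < 1 -> exists c K, [/\ 0 < c, 0 <= K &
  forall s t, a <= s <= b -> a <= t <= b ->
    c * `|Qb t - Qb s| <= `|h t - h s| + K * `|t - s|].
Proof.
move=> a_0 ab b1; have [B HB] := Qb_bounded a_0 ab b1.
exists (M 2 (B + Qth 1)), (M 2 (- B + Qth 0) * k); split => //.
  by rewrite mulr_ge0// ltW.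
move=> s t sab tab.
have in01 p : a <= p <= b -> 0 < p < 1.
  by move=> /andP[ap pb]; rewrite (lt_le_trans a_0 ap) (le_lt_trans pb).
have in01' p : a <= p <= b -> 0 <= p <= 1.
  by move=> /in01 /andP[/ltW -> /ltW ->].
have /andP[Bs sB] := HB _ sab; have /andP[Bt tB] := HB _ tab.
apply: le_trans (mixM1_lip_ge (in01' _ tab) tB sB) _.
have -> : W (Qb t) t - W (Qb s) t = (h t - h s) + (W (Qb s) s - W (Qb s) t).
  by rewrite !hE ?in01//; ring.
apply: le_trans (ler_normD _ _) _; rewrite lerD2l.
by rewrite -mulrA (distrC t); apply: mixM1_lip_p => //; exact: in01'.
Qed.

Lemma Qb_abs_continuous a b : 0 < a -> a <= b -> b < 1 -> abs_continuous a b Qb.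
Proof.
move=> a_0 ab b1; have [c [K [c0 K0 HcK]]] := Qb_modulus a_0 ab b1 => e e0.
have ce : 0 < c * e / 2 by rewrite divr_gt0// mulr_gt0.
have [d1 d10 Hd1] := h_ac a_0 ab b1 ce.
have K1 : 0 < K + 1 by rewrite ltr_pwDr.
exists (Num.min d1 (c * e / 2 / (K + 1))).
  by rewrite lt_min d10 divr_gt0.
move=> n s t H1 H2; rewrite lt_min => /andP[S1 S2].
have {}Hd1 := Hd1 n s t H1 H2 S1.
have S3 : K * (\sum_(i < n) (t i - s i)) <= c * e / 2.
  have s0 : 0 <= \sum_(i < n) (t i - s i).
    by apply: sumr_ge0 => i _; rewrite subr_ge0; have [] := H1 i (ltn_ord i).
  move: S2; rewrite ltr_pdivlMr// mulrDr mulr1 mulrC => S2; lra.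
have : c * \sum_(i < n) `|Qb (t i) - Qb (s i)| <=
    \sum_(i < n) `|h (t i) - h (s i)| + K * (\sum_(i < n) (t i - s i)).
  rewrite !mulr_sumr -big_split /=; apply: ler_sum => i _.
  have [as_ st tb] := H1 i (ltn_ord i).
  have -> : t i - s i = `|t i - s i| by rewrite ger0_norm// subr_ge0.
  by apply: HcK; rewrite ?as_ ?tb ?(le_trans st)// (le_trans as_).
rewrite -(ltr_pM2l c0) => H; apply: le_lt_trans H _; lra.
Qed.

Lemma Qb_continuous p : 0 < p < 1 -> {for p, continuous Qb}.
Proof.
move=> /andP[p0 p1]; apply: (@abs_continuous_continuous _ (p / 2) ((1 + p) / 2)).
  by apply: Qb_abs_continuous; lra.
by apply/andP; split; lra.
Qed.

(* W (Qb t) t - W (Qb p) t = h t - W (Qb p) t, and W is decreasing in its first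
   argument. *)
Let Qb_gap (p : R) : 0 < p < 1 -> exists2 c, 0 < c & \forall t \near p,
  [/\ c * `|Qb t - Qb p| <= `|h t - W (Qb p) t|,
      Qb t <= Qb p -> 0 <= h t - W (Qb p) t & Qb p <= Qb t -> h t - W (Qb p) t <= 0].
Proof.
move=> /andP[p0 p1].
have [|||B HB] := @Qb_bounded (p / 2) ((1 + p) / 2); [lra|lra|lra|].
exists (M 2 (B + Qth 1)); first exact: M_gt0.
near=> t.
have : `|p - t| < Num.min (p / 2) ((1 - p) / 2).
  by near: t; apply: cvgr_dist_lt => //; rewrite lt_min; apply/andP; split; lra.
rewrite lt_min => /andP[]; rewrite !ltr_norml => /andP[? ?] /andP[? ?].
have tab : p / 2 <= t <= (1 + p) / 2 by apply/andP; split; lra.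
have pab : p / 2 <= p <= (1 + p) / 2 by apply/andP; split; lra.
have t01 : 0 < t < 1 by apply/andP; split; lra.
have t01' : 0 <= t <= 1 by apply/andP; split; lra.
have /andP[_ tB] := HB _ tab; have /andP[_ pB] := HB _ pab.
rewrite -hE//; split; first exact: mixM1_lip_ge.
- by move=> tp; rewrite subr_ge0; exact: Whomo.
- by move=> pt; rewrite subr_le0; exact: Whomo.
Unshelve. all: by end_near. Qed.

(** With the first argument frozen at [Qb p], the function [h - W (Qb p)] vanishes at [p] and has a
    derivative of known sign there; differentiating [Qb] itself is avoided. *)
Lemma Qb_slope p : 0 < p < 1 -> derivable h p 1 -> derive1 h p <= Wp (Qb p) p ->
  slope_ge0 Qb p.
Proof.
move=> p01 dh hW; have [c c0 gap] := Qb_gap p01.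
have dW : is_derive p (1 : R) (W (Qb p)) (Wp (Qb p) p) by exact: mixM1_derive_p.
apply: (slope_ge0_gap (D := h - W (Qb p)) c0) gap.
- exact: derivableB.
- by rewrite derive1E deriveB// -derive1E derive_val subr_le0.
- by rewrite !fctE hE// subrr.
Qed.

Lemma Qb_slopeN p : 0 < p < 1 -> derivable h p 1 -> Wp (Qb p) p <= derive1 h p ->
  slope_ge0 (- Qb) p.
Proof.
move=> p01 dh hW; have [c c0 gap] := Qb_gap p01.
have dW : is_derive p (1 : R) (W (Qb p)) (Wp (Qb p) p) by exact: mixM1_derive_p.
apply: (slope_ge0_gap (D := W (Qb p) - h) c0).
- exact: derivableB.
- by rewrite derive1E deriveB// derive_val -derive1E subr_le0.
- by rewrite !fctE hE// subrr.
apply: filterS gap => t [g1 g2 g3]; rewrite !fctE; split.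
- by rewrite -opprD normrN [leRHS]distrC.
- by rewrite lerN2 => /g3; rewrite subr_le0 subr_ge0.
- by rewrite lerN2 => /g2; rewrite subr_ge0 subr_le0.
Qed.

End optimal_quantile.

(** * Tail integrals over (a, 1) *)

Section tail.
Context (R : realType) (f : R -> R).
Local Notation leb := (@lebesgue_measure R).
Hypothesis mf : measurable_fun (`]0, 1[%classic : set R) f.
Hypothesis f0 : forall p, 0 < p < 1 -> 0 <= f p.

Definition tail (a : R) : \bar R := (\int[leb]_(s in `]a, 1%R[) (f s)%:E)%E.

Let sub01 a b : 0 <= a -> b <= 1 -> `]a, b[%classic `<=` (`]0, 1[%classic : set R).
Proof.
move=> a0 b1 p; rewrite /= !in_itv /= => /andP[ap pb].
by rewrite (le_lt_trans a0 ap) (lt_le_trans pb b1).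
Qed.

Lemma measurable_tail a b : 0 <= a -> b <= 1 ->
  measurable_fun (`]a, b[%classic : set R) (EFin \o f).
Proof.
move=> a0 b1; apply/measurable_EFinP; apply: measurable_funS mf => //; exact: sub01.
Qed.

Lemma tail_ge0 a : 0 <= a -> (0 <= tail a)%E.
Proof.
move=> a0; apply: integral_ge0 => p pa; rewrite lee_fin f0//.
by have := sub01 a0 (lexx 1) pa; rewrite /= in_itv.
Qed.

Lemma tail_homo a b : 0 <= a -> a <= b -> (tail b <= tail a)%E.
Proof.
move=> a0 ab; apply: ge0_subset_integral => //.
- exact: measurable_tail.
- by move=> p pa; rewrite lee_fin f0//; have := sub01 a0 (lexx 1) pa; rewrite /= in_itv.
- by move=> p; rewrite /= !in_itv /= => /andP[bp ->]; rewrite (le_lt_trans ab).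
Qed.

(** Monotone convergence as [q] decreases to [a]. It turns estimates known only at points
    accumulating at [a] from the right into estimates at [a]. *)
Lemma tail_le a (B : \bar R) : 0 <= a < 1 -> (forall q, a < q < 1 -> (tail q <= B)%E) ->
  (tail a <= B)%E.
Proof.
move=> /andP[a0 a1] H.
(* The denominator starts at 2, so that [q 0] is already below 1. *)
pose q n : R := a + (1 - a) * n.+2%:R^-1.
have q_a n : a < q n by rewrite ltrDl mulr_gt0 ?subr_gt0// invr_gt0.
have q_1 n : q n < 1.
  rewrite /q -ltrBrDl gtr_pMr ?subr_gt0//.
  by rewrite invf_lt1// ltr1n.
have : (\int[leb]_(s in `](q n), 1%R[) (f s)%:E)%E @[n --> \oo] -->
    (\int[leb]_(s in \bigcup_n `](q n), 1%R[%classic) (f s)%:E)%E.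
  apply: ge0_nondecreasing_set_cvg_integral => //.
  - apply/nondecreasing_seqP => n; apply/subsetPset => p; rewrite /= !in_itv /= => /andP[qp ->].
    rewrite andbT; apply: le_lt_trans qp; rewrite lerD2l ler_wpM2l ?subr_ge0 ?(ltW a1)//.
    by rewrite lef_pV2 ?posrE// ler_nat.
  - by move=> n; apply: measurable_tail => //; rewrite (le_trans a0)// ltW.
  - move=> n p; rewrite /= in_itv /= => /andP[qp p1]; rewrite lee_fin f0//.
    by rewrite p1 (le_lt_trans a0)// (lt_trans (q_a n)).
have -> : \bigcup_n `](q n), 1%R[%classic = `]a, 1[%classic :> set R.
  apply/seteqP; split => p /=.
    by move=> [n _]; rewrite /= !in_itv /= => /andP[qp ->]; rewrite (lt_trans (q_a n)).
  rewrite in_itv /= => /andP[ap p1].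
  have pa0 : 0 < (p - a) / (1 - a) by rewrite divr_gt0// subr_gt0.
  pose n := Num.Def.archi_bound ((p - a) / (1 - a))^-1.
  exists n => //=; rewrite in_itv /= p1 andbT /q -ltrBrDl -ltr_pdivlMl ?subr_gt0// mulrC.
  rewrite -[ltRHS]invrK ltf_pV2 ?posrE ?invr_gt0//.
  apply: (@lt_trans _ _ n%:R); first by apply: archi_boundP; rewrite invr_ge0 ltW.
  by rewrite ltr_nat.
rewrite /tail => /cvg_lim <- //; apply: lime_le.
  apply: ereal_nondecreasing_is_cvgn; apply/nondecreasing_seqP => n.
  apply: tail_homo; first by rewrite (le_trans a0)// ltW.
  rewrite lerD2l ler_wpM2l ?subr_ge0 ?(ltW a1)//.
  by rewrite lef_pV2 ?posrE// ler_nat.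
by apply: nearW => n; apply: H; rewrite q_a q_1.
Qed.

Lemma tail_split a b : 0 <= a -> a < b -> b < 1 ->
  (tail a = \int[leb]_(s in `]a, b[) (f s)%:E + tail b)%E.
Proof.
move=> a0 ab b1.
have E : `]a, 1[%classic = `]a, b[%classic `|` `[b, 1[%classic :> set R.
  apply/seteqP; split => p /=; rewrite !in_itv /=.
    by move=> /andP[-> ->]; case: (ltP p b); [left|right].
  move=> [/andP[-> pb]|/andP[bp ->]]; first by rewrite (lt_trans pb).
  by rewrite (lt_le_trans ab).
rewrite /tail E ge0_integral_setU//.
- congr (_ + _)%E; rewrite -integral_itv_obnd_cbnd//.
  by apply: measurable_tail => //; rewrite (le_trans a0)// ltW.
- by rewrite -E; exact: measurable_tail.
- rewrite -E => p pa; rewrite lee_fin f0//.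
  by have := sub01 a0 (lexx 1) pa; rewrite /= in_itv.
- apply/disj_setPS => p [] /=; rewrite !in_itv /= => /andP[_ pb] /andP[+ _].
  by rewrite leNgt pb.
Qed.

End tail.

(** * Consequences of the obstacle problem *)

Section solution.
Context (R : realType) (M : nat -> R -> R) (Qth : R -> R) (alpha : R).
Hypothesis M_tangent : forall n x y, M n x - (y - x) * M n.+1 x <= M n y.
Hypothesis M_gt0 : forall n x, 0 < M n x.
Hypothesis alpha01 : 0 <= alpha <= 1.
Hypothesis Qth_homo : forall p q, 0 <= p -> p <= q -> q <= 1 -> Qth p <= Qth q.
Hypothesis M1_small : forall e, 0 < e -> exists x, M 1 x <= e.
Hypothesis M1_large : forall e, 0 < e -> exists x, e <= M 1 x.
Hypothesis Qth_derivable : forall p, 0 < p < 1 -> derivable Qth p 1.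
Variable k : R.
Hypothesis k0 : 0 <= k.
Hypothesis Qth_lip : forall p q, 0 <= p <= 1 -> 0 <= q <= 1 -> `|Qth p - Qth q| <= k * `|p - q|.
Variable u : R -> R.
Hypothesis uE : forall x, u x = - M 0 x.
Variables (H Qrho : R -> R) (lambda p0 : R).
Hypothesis lambda0 : 0 < lambda.
Hypothesis p001 : 0 < p0 < 1.
Hypothesis p0_le : forall p, 0 < p < p0 -> M 1 (Qth 0) <= lambda * Qrho (1 - p).
Hypothesis Qrho_ge0 : forall p, 0 < p < 1 -> 0 <= Qrho p.
Hypothesis Qrho_homo : forall p q, 0 < p -> p <= q -> q < 1 -> Qrho p <= Qrho q.
Local Notation V := (Vfun u Qth alpha).
Hypothesis sol : solution V Qrho lambda p0 H.
Local Notation h := (derive1 H).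
Local Notation W := (mixM M Qth alpha 1).
Local Notation Wp := (dp_mixM1 M Qth alpha).
Local Notation leb := (@lebesgue_measure R).

Let Qb p := Sfun V (h p) p.

Lemma sol_h_gt0 p : 0 < p < 1 -> 0 < h p.
Proof. by have [[_ _ + _] _ _ _] := sol => H0; exact: H0. Qed.

Let h_ac a b : 0 < a -> a <= b -> b < 1 -> abs_continuous a b h.
Proof. by have [[_ + _ _] _ _ _] := sol => H0; exact: H0. Qed.

Let hE p : 0 < p < 1 -> W (Qb p) p = h p.
Proof.
move=> p01; apply: SfunP => //; last exact: sol_h_gt0.
by case/andP: p01 => /ltW -> /ltW ->.
Qed.

Let dxE x p : dx V x p = W x p.
Proof. exact: dx_Vfun. Qed.

Lemma Qb_eq0 p : 0 < p <= p0 -> Qb p = 0.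
Proof.
move=> /andP[pp pp0]; have p01 : 0 < p < 1.
  by rewrite pp (le_lt_trans pp0)//; case/andP: p001.
have [_ _ _ +] := sol => /(_ p); rewrite pp pp0 => /(_ isT) hp.
have := hE p01; rewrite hp dxE.
exact: mixM_inj.
Qed.

Let Qbc p : 0 < p < 1 -> {for p, continuous Qb}.
Proof.
exact: (Qb_continuous M_tangent M_gt0 alpha01 Qth_homo M1_small M1_large k0 Qth_lip hE h_ac).
Qed.

Let Qbac a b : 0 < a -> a <= b -> b < 1 -> abs_continuous a b Qb.
Proof.
exact: (Qb_abs_continuous M_tangent M_gt0 alpha01 Qth_homo M1_small M1_large k0 Qth_lip hE
  h_ac).
Qed.

(** A vanishing minimum means that both entries are non-negative and that one of them is zero:
    strictly above the obstacle it must be the differential expression, which gives the reverse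
    inequality. *)
Let ae_ode : {ae leb, forall p, p0 < p < 1 -> [/\ derivable h p 1,
  derive1 h p <= Wp (Qb p) p, lambda * Defs.eta Qrho p <= H p &
  (lambda * Defs.eta Qrho p < H p -> Wp (Qb p) p <= derive1 h p)]}.
Proof.
have [_ + _ _] := sol; apply: filterS; first exact: (ae_filter_ringOfSetsType leb).
move=> p Hp pp.
have [dh] := Hp pp.
have p01 : 0 < p < 1.
  by case/andP: pp => pp0 ->; rewrite (lt_trans _ pp0)//; case/andP: p001.
rewrite /Phi -/(Qb p) (_ : dxdp V (Qb p) p = Wp (Qb p) p); last exact: dxdp_Vfun.
rewrite /Num.min; case: ltP => le E; split => //; lra.
Qed.

(** Beyond [p0] the inequality between [h'] and [Wp] makes the slopes of [Qb] non-negative almost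
    everywhere. Up to [p0] the candidate is 0, and the two pieces meet at [p0]. *)
Lemma Qb_homo p q : 0 < p -> p <= q -> q < 1 -> Qb p <= Qb q.
Proof.
move=> pp pq q1.
have [qp0|p0q] := leP q p0.
  by rewrite !Qb_eq0// ?pp ?(lt_le_trans pp pq)//= (le_trans pq).
have [p00 p01] := andP p001.
have step s : p0 <= s -> s <= q -> Qb s <= Qb q.
  move=> p0s sq; apply: abs_continuous_homo => //.
    by apply: Qbac => //; exact: lt_le_trans p0s.
  move: ae_ode; apply: filterS; first exact: (ae_filter_ringOfSetsType leb).
  move=> t Ht /andP[st tq].
  have [|dh hW _ _] := Ht; first by rewrite (le_lt_trans p0s st) (lt_trans tq).
  apply: (Qb_slope M_tangent M_gt0 alpha01 Qth_homo M1_small M1_large Qth_derivable hE h_ac) =>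
    //.
  by rewrite (lt_trans tq)// (lt_trans _ st)// (lt_le_trans p00 p0s).
have [p0p|pp0] := leP p0 p; first exact: step.
rewrite (@Qb_eq0 p) ?pp ?(ltW pp0)// -(@Qb_eq0 p0) ?p00 ?lexx//.
by apply: step => //; exact: ltW.
Qed.

Lemma Qb_ge0 p : 0 < p < 1 -> 0 <= Qb p.
Proof.
move=> /andP[pp p1]; have [p00 p01] := andP p001.
have [pp0|p0p] := leP p p0; first by rewrite Qb_eq0// pp.
by rewrite -(@Qb_eq0 p0) ?p00 ?lexx//; apply: Qb_homo => //; exact: ltW.
Qed.

Lemma Qb_Qplus : Qplus Qb.
Proof.
split; [exact: Qb_ge0|exact: Qb_homo|move=> p p01].
by apply: cvg_at_right_filter; exact: Qbc.
Qed.

(** Strictly above the obstacle [Wp <= h'] holds almost everywhere, so [- Qb] has non-negative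
    slopes there and is non-decreasing. *)
Lemma Qb_flat a b : p0 <= a -> a <= b -> b < 1 ->
  (forall q, a < q < b -> lambda * Defs.eta Qrho q < H q) -> Qb b <= Qb a.
Proof.
move=> p0a ab b1 Hab; have [p00 p01] := andP p001.
rewrite -lerN2; change ((- Qb) a <= (- Qb) b); apply: abs_continuous_homo => //.
  move=> e e0; have [d d0 Hd] := Qbac (lt_le_trans p00 p0a) ab b1 e0.
  exists d => // n s t H1 H2 H3.
  have -> : \sum_(i < n) `|(- Qb) (t i) - (- Qb) (s i)| = \sum_(i < n) `|Qb (t i) - Qb (s i)|.
    by apply: eq_bigr => i _; rewrite !fctE opprK addrC distrC.
  exact: Hd.
move: ae_ode; apply: filterS; first exact: (ae_filter_ringOfSetsType leb).
  move=> t Ht /andP[st tq].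
have [|dh hW _ hW'] := Ht; first by rewrite (le_lt_trans p0a st) (lt_trans tq).
apply: (Qb_slopeN M_tangent M_gt0 alpha01 Qth_homo M1_small M1_large Qth_derivable hE h_ac) =>
  //.
  by rewrite (lt_trans tq)// (lt_trans _ st)// (lt_le_trans p00 p0a).
by apply: hW'; apply: Hab; rewrite st.
Qed.

Let Qr p := Qrho (1 - p).

Lemma h_measurable : measurable_fun (`]0, 1[%classic : set R) h.
Proof.
apply: open_continuous_measurable_fun => // p; rewrite inE /= in_itv /= => p01.
exact: (h_continuous h_ac).
Qed.

Lemma Qr_measurable : measurable_fun (`]0, 1[%classic : set R) Qr.
Proof.
have -> : Qr = \- (fun p => - Qr p) by apply/funext => p; rewrite /= opprK.
apply: measurable_funN; apply: homo_measurable_itv => p q pp pq q1.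
rewrite lerN2 /Qr; apply: Qrho_homo; [by rewrite subr_gt0|by rewrite lerD2l lerN2|].
by rewrite ltrBlDr ltrDl.
Qed.

Lemma Qr_ge0 p : 0 < p < 1 -> 0 <= Qr p.
Proof. by move=> /andP[pp p1]; rewrite Qrho_ge0// subr_gt0 p1 ltrBlDr ltrDl. Qed.

Let h_ge0 p : 0 < p < 1 -> 0 <= h p.
Proof. by move=> /sol_h_gt0 /ltW. Qed.

Local Notation Th := (tail h).
Local Notation Tr := (tail Qr).

(** The fundamental theorem applies on [[a, b n]] inside the open interval; the limit of [H] at 1,
    where [H] vanishes, and monotone convergence of the integrals let [b n] tend to 1. *)
Lemma tail_hE a : 0 < a < 1 -> Th a = (- H a)%:E.
Proof.
move=> /andP[a0 a1].
have [[dH _ _ Hlim] _ H1 _] := sol.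
pose b n : R := 1 - (1 - a) * n.+2%:R^-1.
have b_a n : a < b n.
  by rewrite /b ltrBrDr -ltrBrDl gtr_pMr ?subr_gt0// invf_lt1// ltr1n.
have b_1 n : b n < 1 by rewrite /b ltrBlDr ltrDl mulr_gt0 ?subr_gt0// invr_gt0.
have int_b n : (\int[leb]_(s in `[a, (b n)]) (h s)%:E)%E = (H (b n) - H a)%:E.
  rewrite EFinB; apply: continuous_FTC2 => //.
  - apply: continuous_in_subspaceT => p; rewrite inE /= in_itv /= => /andP[ap pb].
    by apply: (h_continuous h_ac); rewrite (lt_le_trans a0 ap) (le_lt_trans pb).
  - have cH p : 0 < p < 1 -> {for p, continuous H}.
      by move=> p01; apply: differentiable_continuous; apply/derivable1_diffP; exact: dH.
    split.
    + move=> p; rewrite in_itv /= => /andP[ap pb].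
      by apply: dH; rewrite (lt_trans a0 ap) (lt_trans pb).
    + by apply: cvg_at_right_filter; apply: cH; rewrite a0.
    + by apply: cvg_at_left_filter; apply: cH; rewrite b_1 (lt_trans a0).
have lim1 : (\int[leb]_(s in `[a, (b n)]) (h s)%:E)%E @[n --> \oo] --> (- H a)%:E.
  rewrite (_ : (fun n => _) = (fun n => (H (b n) - H a)%:E)); last exact/funext.
  apply: cvg_EFin; first by near=> n.
  rewrite -[X in _ --> X]add0r -H1; apply: cvgB; last exact: cvg_cst.
  have /cvg_at_leftP Hl := Hlim; apply: Hl; split; first by move=> n; exact: b_1.
  rewrite -[X in _ --> X]subr0 /b; apply: cvgB; first exact: cvg_cst.
  rewrite -[X in _ --> X](mulr0 (1 - a)); apply: cvgM; first exact: cvg_cst.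
  have := @cvg_harmonic R; rewrite -(cvg_shiftS _) /= /harmonic; exact.
have lim2 : (\int[leb]_(s in `[a, (b n)]) (h s)%:E)%E @[n --> \oo] -->
    (\int[leb]_(s in \bigcup_n `[a, (b n)]%classic) (h s)%:E)%E.
  apply: ge0_nondecreasing_set_cvg_integral => //.
  - apply/nondecreasing_seqP => n; apply/subsetPset => p; rewrite /= !in_itv /= => /andP[-> pb].
    rewrite (le_trans pb)// lerD2l lerN2 ler_wpM2l ?subr_ge0 ?(ltW a1)//.
    by rewrite lef_pV2 ?posrE// ler_nat.
  - move=> n; apply/measurable_EFinP; apply: measurable_funS h_measurable => // p.
    rewrite /= !in_itv /= => /andP[ap pb].
    by rewrite (lt_le_trans a0 ap) (le_lt_trans pb).
  - move=> n p; rewrite /= in_itv /= => /andP[ap pb]; rewrite lee_fin h_ge0//.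
    by rewrite (lt_le_trans a0 ap) (le_lt_trans pb).
have E : \bigcup_n `[a, (b n)]%classic = `[a, 1[%classic :> set R.
  apply/seteqP; split => p /=.
    by move=> [n _]; rewrite /= !in_itv /= => /andP[-> pb]; rewrite (le_lt_trans pb).
  rewrite in_itv /= => /andP[ap p1].
  have pa0 : 0 < (1 - p) / (1 - a) by rewrite divr_gt0// subr_gt0.
  pose n := Num.Def.archi_bound ((1 - p) / (1 - a))^-1.
  exists n => //=; rewrite in_itv /= ap /= /b lerBrDr -lerBrDl.
  rewrite mulrC -ler_pdivlMr ?subr_gt0//.
  rewrite -[leRHS]invrK lef_pV2 ?posrE ?invr_gt0//.
  apply: (@le_trans _ _ n%:R); first by apply/ltW/archi_boundP; rewrite invr_ge0 ltW.
  by rewrite ler_nat (ltnW (leqnSn n.+1)).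
rewrite E in lim2.
rewrite /tail integral_itv_obnd_cbnd//; first exact/esym/(cvg_unique _ lim1 lim2).
apply: (measurable_tail h_measurable) => //; exact: ltW.
Unshelve. all: by end_near. Qed.

(** Right of [a] the non-increasing [Qr] is at most [Qr a]. Finiteness is what allows the
    real-valued integral in [eta] to be read as an extended one. *)
Lemma tail_Qr_fin a : 0 < a < 1 -> Tr a \is a fin_num.
Proof.
move=> /andP[a0 a1]; rewrite ge0_fin_numE; last by apply: tail_ge0; [exact: Qr_ge0|exact: ltW].
apply: (@le_lt_trans _ _ (\int[leb]_(s in `]a, 1%R[) (cst (Qr a)%:E s))%E); last first.
  rewrite integral_cst//= lebesgue_measure_itv /= lte_fin a1.
  by rewrite -EFinB -EFinM ltry.
apply: ge0_le_integral => //.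
- by move=> p; rewrite /= in_itv /= => /andP[ap p1]; rewrite lee_fin Qr_ge0// p1 (lt_trans a0).
- by apply: (measurable_tail Qr_measurable) => //; exact: ltW.
- move=> p; rewrite /= in_itv /= => /andP[ap p1]; rewrite lee_fin /Qr.
  apply: Qrho_homo; [by rewrite subr_gt0|by rewrite lerD2l lerN2 ltW|].
  by rewrite ltrBlDr ltrDl.
Qed.

Lemma tail_QrE a : 0 < a < 1 -> Tr a = (- Defs.eta Qrho a)%:E.
Proof.
move=> a01; rewrite -[LHS]fineK ?tail_Qr_fin//; congr EFin.
exact: (esym (opprK _)).
Qed.

(** The almost everywhere condition holds somewhere in every non-degenerate interval, since such an
    interval is not null. *)
Let dense a b : p0 <= a -> a < b -> b < 1 -> exists2 q,
  a < q < b & lambda * Defs.eta Qrho q <= H q.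
Proof.
move=> p0a ab b1; apply: contrapT => nq.
have [N [mN N0 HN]] := ae_ode.
have sub : `]a, b[%classic `<=` N.
  move=> q; rewrite /= in_itv /= => aqb; apply: HN => /= Hq; apply: nq.
  exists q => //; case/andP: aqb => aq qb.
  by have [] := Hq; first by rewrite (le_lt_trans p0a aq) (lt_trans qb).
have : (leb `]a, b[%classic <= leb N)%E by apply: le_measure; rewrite ?inE.
by rewrite N0 lebesgue_measure_itv /= lte_fin ab -EFinB lee_fin leNgt subr_gt0 ab.
Qed.

(** From [p0] on, this is the obstacle inequality on a dense set, extended by [tail_le]. Before [p0]
    the integrands themselves compare: there [h] is the marginal utility at wealth 0, which is at
    most [M 1 (Qth 0)] and hence at most [lambda * Qr]. *)
Lemma tail_h_le a : 0 <= a < 1 -> (Th a <= lambda%:E * Tr a)%E.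
Proof.
have [p00 p01] := andP p001.
have le1 s : p0 <= s < 1 -> (Th s <= lambda%:E * Tr s)%E.
  move=> /andP[p0s s1]; have s0 : 0 < s := lt_le_trans p00 p0s.
  apply: (tail_le h_measurable h_ge0); first by rewrite s1 ltW.
  move=> q /andP[sq q1]; have [q' /andP[sq' q'q] Hq'] := dense p0s sq q1.
  have q'01 : 0 < q' < 1 by rewrite (lt_trans s0 sq') (lt_trans q'q).
  apply: (@le_trans _ _ (Th q')).
    apply: (tail_homo h_measurable h_ge0); last exact: ltW.
    by case/andP: q'01 => /ltW.
  apply: (@le_trans _ _ (lambda%:E * Tr q')%E).
    by rewrite tail_hE// tail_QrE// -EFinM lee_fin mulrN lerN2.
  rewrite lee_wpmul2l//; first by rewrite lee_fin ltW.
  by apply: (tail_homo Qr_measurable Qr_ge0); exact: ltW.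
move=> /andP[a0 a1]; have [p0a|ap0] := leP p0 a; first by apply: le1; rewrite p0a.
rewrite (tail_split h_measurable h_ge0 a0 ap0 p01) (tail_split Qr_measurable Qr_ge0 a0 ap0 p01).
rewrite ge0_muleDr//; last 2 first.
- apply: integral_ge0 => p; rewrite /= in_itv /= => /andP[ap pp0]; rewrite lee_fin Qr_ge0//.
  by rewrite (le_lt_trans a0 ap) (lt_trans pp0).
- by apply: tail_ge0; [exact: Qr_ge0|exact: ltW].
apply: leeD; last by apply: le1; rewrite lexx.
rewrite -ge0_integralZl//; last 3 first.
- by apply: (measurable_tail Qr_measurable) => //; exact: ltW.
- move=> p; rewrite /= in_itv /= => /andP[ap pp0]; rewrite lee_fin Qr_ge0//.
  by rewrite (le_lt_trans a0 ap) (lt_trans pp0).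
- by rewrite lee_fin ltW.
apply: ge0_le_integral => //.
- move=> p; rewrite /= in_itv /= => /andP[ap pp0]; rewrite lee_fin h_ge0//.
  by rewrite (le_lt_trans a0 ap) (lt_trans pp0).
- by apply: (measurable_tail h_measurable) => //; exact: ltW.
- apply: measurable_funeM; apply: (measurable_tail Qr_measurable) => //; exact: ltW.
move=> p; rewrite /= in_itv /= => /andP[ap pp0].
have pp : 0 < p := le_lt_trans a0 ap.
rewrite -EFinM lee_fin; apply: le_trans (p0_le _); last by rewrite pp.
have [_ _ _ +] := sol => /(_ p); rewrite pp (ltW pp0) => /(_ isT) ->.
rewrite dxE -[X in M 1 X]add0r.
by apply: mixM_le => //; rewrite (ltW pp) (ltW (lt_trans pp0 p01)).
Qed.

(** At [a], the infimum of the level set, continuity gives [Qb a <= z], while [Qb] exceeds [z]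
    immediately afterwards. By [Qb_flat] contact points accumulate at [a] from the right, and the
    reverse inequality passes to the limit. *)
Lemma tail_h_eq z : 0 < z -> (exists2 p, 0 < p < 1 & z < Qb p) ->
  exists2 a, 0 < a < 1 & Th a = (lambda%:E * Tr a)%E /\ forall p, 0 < p < 1 ->
    (z < Qb p) = (a < p).
Proof.
move=> z0 [p1 p1_01 zp1]; have [p00 p01] := andP p001.
pose A := [set p | 0 < p < 1 /\ z < Qb p].
have hA : has_inf A by split; [exists p1|exists 0 => p [/andP[/ltW]]].
pose a := inf A.
have ap p : 0 < p < 1 -> a < p -> z < Qb p.
  move=> /andP[pp p1'] ap'; have [q [/andP[qq q1] zq] qp] : exists2 q, A q & q < p.
    have /inf_adherent : 0 < p - a by rewrite subr_gt0.
    move=> /(_ _ hA) [q Aq]; rewrite -/a addrC subrK => qp; by exists q.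
  by apply: lt_le_trans zq _; apply: Qb_homo => //; exact: ltW.
have p0A q : A q -> p0 < q.
  move=> [/andP[qq q1] zq]; rewrite ltNge; apply/negP => qp0.
  by move: zq; rewrite Qb_eq0 ?qq// ltNge (ltW z0).
have p0a : p0 <= a by apply: lb_le_inf; [exact: hA.1|move=> q /p0A /ltW].
have a0 : 0 < a := lt_le_trans p00 p0a.
have a1 : a < 1.
  by apply: le_lt_trans (_ : p1 < 1); [apply: ge_inf; [exact: hA.2|split]|case/andP: p1_01].
have a01 : 0 < a < 1 by rewrite a0.
have Qa : Qb a <= z.
  rewrite leNgt; apply/negP => za.
  have : \forall q \near a, z < Qb q by apply: (cvgr_gt _ (Qbc a01)).
  move=> [e /= e0 He].
  (* A point left of [a], close enough that [Qb] still exceeds [z] and positive thanks to [a / 2];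
     it would lie in the level set below its infimum. *)
  pose q := a - Num.min (e / 2) (a / 2).
  have m0 : 0 < Num.min (e / 2) (a / 2) by rewrite lt_min !divr_gt0.
  have me : Num.min (e / 2) (a / 2) <= e / 2 by rewrite ge_min lexx.
  have ma : Num.min (e / 2) (a / 2) <= a / 2 by rewrite ge_min lexx orbT.
  have Aq : A q.
    split; first by rewrite /q; apply/andP; split; lra.
    by apply: He; rewrite /= /q opprB addrC subrK gtr0_norm//; lra.
  have : a <= q by apply: ge_inf => //; exact: hA.2.
  rewrite /q; lra.
exists a => //; split; last first.
  move=> p p01'; apply/idP/idP; last exact: ap.
  rewrite ltNge => zp; rewrite ltNge; apply: contra zp => pa.
  by apply: le_trans Qa; apply: Qb_homo => //; case/andP: p01'.
apply/eqP; rewrite eq_le; apply/andP; split; first by apply: tail_h_le; rewrite a1 ltW.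
have [[b /andP[ab b1] Hb]|nb] := pselect (exists2 b, a < b < 1 & forall q, a < q < b ->
  lambda * Defs.eta Qrho q < H q).
  exfalso; have := Qb_flat p0a (ltW ab) b1 Hb.
  have b01 : 0 < b < 1 by rewrite b1 (lt_trans a0).
  by have := lt_le_trans (le_lt_trans Qa (ap _ b01 ab)) => /[apply]; rewrite ltxx.
have li : 0 < lambda^-1 by rewrite invr_gt0.
suff T : (Tr a <= (lambda^-1)%:E * Th a)%E.
  have l0 : (0 <= lambda%:E)%E by rewrite lee_fin ltW.
  apply: (@le_trans _ _ (lambda%:E * ((lambda^-1)%:E * Th a))%E); first exact: lee_wpmul2l.
  by rewrite muleA -EFinM mulfV ?gt_eqF// mul1e.
apply: (tail_le Qr_measurable Qr_ge0); first by rewrite a1 ltW.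
move=> q /andP[aq q1].
have [q' /andP[aq' q'q] Hq'] : exists2 q', a < q' < q & H q' <= lambda * Defs.eta Qrho q'.
  apply: contrapT => nq; apply: nb; exists q; first by rewrite aq.
  move=> q' aq'; rewrite ltNge; apply/negP => le; apply: nq; by exists q'.
have q'01 : 0 < q' < 1 by rewrite (lt_trans a0 aq') (lt_trans q'q).
apply: (@le_trans _ _ (Tr q')).
  apply: (tail_homo Qr_measurable Qr_ge0); last exact: ltW.
  by case/andP: q'01 => /ltW.
apply: (@le_trans _ _ ((lambda^-1)%:E * Th q')%E).
  rewrite tail_hE// tail_QrE// -EFinM lee_fin mulrN lerN2.
  by rewrite ler_pdivrMl.
rewrite lee_wpmul2l//; first by rewrite lee_fin ltW.
by apply: (tail_homo h_measurable h_ge0); exact: ltW.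
Qed.

End solution.

(** * Comparison of the objectives *)

Section uniform_tail.
Context d (T : measurableType d) (R : realType) (P : probability T R).
Local Notation leb := (@lebesgue_measure R).
Variables (U : T -> R) (D : set T).
Hypothesis uU : uniform01 P U.
Hypothesis mD : measurable D.
Hypothesis D01 : forall w, D w -> 0 < U w < 1.
Hypothesis PD : P D = 1%E.

Let mU : measurable_fun setT U. Proof. by case: uU. Qed.

Let m01 : measurable [set w | 0 < U w < 1]. Proof. exact: measurable_set_itvoo. Qed.

Let mfU (f : R -> \bar R) S : measurable S -> S `<=` [set w | 0 < U w < 1] ->
  measurable_fun (`]0, 1[%classic : set R) f -> measurable_fun S (f \o U).
Proof.
move=> mS S01 mf.
refine (measurable_comp (F := (`]0, 1[%classic : set R)) _ _ mf _) => //.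
- by move=> _ [w /S01 /= w01 <-]; rewrite in_itv.
- exact: measurable_funTS.
Qed.

Let null_diff : P ([set w | 0 < U w < 1] `\` D) = 0%E.
Proof.
apply/eqP; rewrite eq_le measure_ge0 andbT -(full_setC mD PD).
apply: le_measure; rewrite ?inE; [exact: measurableD|exact: measurableC|by move=> w []].
Qed.

Lemma uniform01_integral_full (f : R -> \bar R) :
  measurable_fun (`]0, 1[%classic : set R) f -> (forall p, 0 < p < 1 -> (0 <= f p)%E) ->
  (\int[P]_(w in D) f (U w) = \int[leb]_(p in `]0%R, 1%R[) f p)%E.
Proof.
move=> mf f0; rewrite -(uniform01_integral uU mf f0).
rewrite [RHS](@ge0_negligible_integral _ _ _ P _ ([set w | 0 < U w < 1] `\` D))//.
- congr (integral _ _ _); rewrite setDD; apply/seteqP; split => w; last by case.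
  by move=> Dw; split => //; exact: D01.
- exact: measurableD.
- exact: mfU.
- by move=> w /= /f0.
Qed.

(* S is, up to null sets, an upper level set of U. *)
Lemma uniform01_upper_tail (S : set T) : measurable S -> S `<=` D -> S !=set0 ->
  (forall s t, S s -> D t -> ~ S t -> U t <= U s) ->
  exists2 b, 0 <= b < 1 & forall f : R -> R, measurable_fun (`]0, 1[%classic : set R) f ->
    (forall p, 0 < p < 1 -> 0 <= f p) ->
    (\int[P]_(w in S) (f (U w))%:E = tail f b)%E.
Proof.
move=> mS SD [s0 Ss0] up.
pose A := [set U w | w in S].
have hA : has_inf A.
  by split; [exists (U s0), s0|exists 0 => _ [w /SD /D01 /andP[/ltW + _] <-]].
pose b := inf A.
have b0 : 0 <= b.
  by apply: lb_le_inf; [exact: hA.1|move=> _ [w /SD /D01 /andP[/ltW + _] <-]].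
have b1 : b < 1.
  apply: (@le_lt_trans _ _ (U s0)); first by apply: ge_inf; [exact: hA.2|exists s0].
  by have /SD/D01/andP[] := Ss0.
exists b; first by rewrite b0.
move=> f mf f0.
pose O := [set w | 0 < U w < 1].
pose B := O `&` [set w | b < U w].
have mB : measurable B by apply: measurableI => //; exact: measurable_set_ltr.
(* Off this null set [S] coincides with the event [b < U]: the first part holds the points missing
   from [D], the second the tie at the infimum [b]. *)
pose N := (O `\` D) `|` (O `&` [set w | U w = b]).
have mE : measurable (O `&` [set w | U w = b]).
  by apply: measurableI => //; exact: measurable_set_eqr.
have mN : measurable N by apply: measurableU => //; exact: measurableD.
have P1 : P (O `&` [set w | U w = b]) = 0%E.
  apply/eqP; rewrite eq_le measure_ge0 andbT.
  have <- : P (U @^-1` [set b]) = 0%E.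
    rewrite (uniform01_law uU)//; apply/eqP; rewrite eq_le measure_ge0 andbT.
    rewrite -(lebesgue_measure_set1 b); apply: le_measure; rewrite ?inE//.
    exact: measurableI.
  have mUb : measurable (U @^-1` [set b]) by rewrite -[X in measurable X]setTI; exact: mU.
  by apply: le_measure; rewrite ?inE//; move=> w [].
have PN : P N = 0%E.
  apply/eqP; rewrite eq_le measure_ge0 andbT.
  apply: (@le_trans _ _ (P (O `\` D) + P (O `&` [set w | U w = b]))%E).
    by apply: measureU2 => //; exact: measurableD.
  by rewrite [X in (X + _)%E](null_diff) add0e P1.
have SO : S `<=` O by move=> w /SD /D01.
have BO : B `<=` O by move=> w [].
have SB : S `\` N = B `\` N.
  apply/seteqP; split => w.
    move=> [Sw nN]; split => //; split; first exact: SO.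
    have : b <= U w by apply: ge_inf; [exact: hA.2|exists w].
    rewrite le_eqVlt => /predU1P[E|//]; exfalso; apply: nN; right; split => //; exact: SO.
  move=> [[Ow bw] nN]; split => //.
  have Dw : D w by apply: contrapT => nD; apply: nN; left.
  apply: contrapT => nS.
  have [y [s Ss <-] sw] : exists2 y, A y & y < U w.
    have /inf_adherent : 0 < U w - b by rewrite subr_gt0.
    by move=> /(_ _ hA) [y Ay]; rewrite -/b addrC subrK => yw; exists y.
  by have := up _ _ Ss Dw nS; rewrite leNgt sw.
rewrite (@ge0_negligible_integral _ _ _ P _ N)//; last 2 first.
- by apply: (mfU (f := EFin \o f)) => //; exact/measurable_EFinP.
- by move=> w /SO /= /f0.
rewrite SB -(@ge0_negligible_integral _ _ _ P _ N)//; last 2 first.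
- by apply: (mfU (f := EFin \o f)) => //; exact/measurable_EFinP.
- by move=> w /BO /= /f0.
pose g : R -> \bar R := (fun p => (f p)%:E) \_ `]b, 1[%classic.
transitivity (\int[P]_(w in O) g (U w))%E.
  rewrite /B [RHS]integral_mkcond [LHS]integral_mkcond; apply: eq_integral => w _.
  have [Ow|Ow] := pselect (O w); last by rewrite !erestrict_out//; case.
  rewrite [RHS]erestrict_in// /g; have [bw|bw] := pselect (b < U w).
    rewrite !erestrict_in//=; rewrite in_itv /= bw; by case/andP: Ow.
  rewrite !erestrict_out//; last by case.
  by rewrite /= in_itv /= => /andP[].
have sub : `]b, 1[%classic `<=` (`]0, 1[%classic : set R).
  by move=> p; rewrite /= !in_itv /= => /andP[bp ->]; rewrite (le_lt_trans b0).
rewrite (uniform01_integral uU).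
- rewrite /g /tail -integral_mkcondr; congr (integral _ _ _).
  by apply/seteqP; split => p; [case|move=> pb; split => //; exact: sub].
- apply/(measurable_restrict _ _ _) => //.
  by apply/measurable_EFinP; apply: measurable_funS mf => // p [].
- move=> p p01; rewrite /g; have [pb|pb] := pselect ((`]b, 1[%classic : set R) p).
    by rewrite erestrict_in// lee_fin f0.
  by rewrite erestrict_out.
Qed.

End uniform_tail.

Section core.
(* h = H', Qr p = Q_rho(1 - p) and Qb = Qbar. *)
Context (R : realType) (h Qr Qb : R -> R) (lambda : R).
Local Notation leb := (@lebesgue_measure R).
Hypothesis lambda0 : 0 < lambda.
Hypothesis mh : measurable_fun (`]0, 1[%classic : set R) h.
Hypothesis mQr : measurable_fun (`]0, 1[%classic : set R) Qr.
Hypothesis mQb : measurable_fun (`]0, 1[%classic : set R) Qb.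
Hypothesis h0 : forall p, 0 < p < 1 -> 0 <= h p.
Hypothesis Qr0 : forall p, 0 < p < 1 -> 0 <= Qr p.
Hypothesis Qb0 : forall p, 0 < p < 1 -> 0 <= Qb p.
Hypothesis tail_le : forall a, 0 <= a < 1 -> (tail h a <= lambda%:E * tail Qr a)%E.
Hypothesis tail_eq : forall z, 0 < z -> (exists2 p, 0 < p < 1 & z < Qb p) ->
  exists2 a, 0 < a < 1 & tail h a = (lambda%:E * tail Qr a)%E /\
    forall p, 0 < p < 1 -> (z < Qb p) = (a < p).

Let lam0 : (0 <= lambda%:E)%E. Proof. by rewrite lee_fin ltW. Qed.

Lemma integral_Qb_eq :
  (\int[leb]_(p in `]0%R, 1%R[) (h p * Qb p)%:E =
   lambda%:E * \int[leb]_(p in `]0%R, 1%R[) (Qr p * Qb p)%:E)%E.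
Proof.
have i01 (p : R) : `]0, 1[%classic p -> 0 < p < 1 by rewrite /= in_itv.
have mlQ : measurable_fun (`]0, 1[%classic : set R) (fun p => lambda * Qr p).
  by apply: measurable_funM.
rewrite -ge0_integralZl//; last 2 first.
- by apply/measurable_EFinP; exact: measurable_funM.
- by move=> p /i01 p01; rewrite lee_fin mulr_ge0 ?Qr0 ?Qb0.
transitivity (\int[leb]_(p in `]0%R, 1%R[) (lambda * Qr p * Qb p)%:E)%E; last first.
  by apply: eq_integral => p _; rewrite -EFinM mulrA.
have m01 : measurable (`]0, 1[%classic : set R) by exact: measurable_itv.
have hi p : `]0, 1[%classic p -> 0 <= h p by move=> /i01 /h0.
have Qi p : `]0, 1[%classic p -> 0 <= Qb p by move=> /i01 /Qb0.
have li p : `]0, 1[%classic p -> 0 <= lambda * Qr p.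
  by move=> /i01 p01; rewrite mulr_ge0 ?Qr0// ltW.
rewrite (ge0_layer_cake leb m01 mQb mh Qi hi) (ge0_layer_cake leb m01 mQb mlQ Qi li).
apply: eq_integral => z; rewrite inE /= in_itv /= andbT => z0.
have [ex|nex] := pselect (exists2 p, 0 < p < 1 & z < Qb p); last first.
  have -> : `]0, 1[%classic `&` [set t | z < Qb t] = set0.
    apply/seteqP; split => // p [/i01 p01 zp]; apply: nex; by exists p.
  by rewrite !integral_set0.
have [a /andP[a0 a1] [E aP]] := tail_eq z0 ex.
have -> : `]0, 1[%classic `&` [set t | z < Qb t] = `]a, 1[%classic.
  apply/seteqP; split => p.
    by move=> [/i01 p01]; rewrite /= in_itv /= aP// => ->; case/andP: p01.
  rewrite /= !in_itv /= => /andP[ap p1]; have p01 : 0 < p < 1 by rewrite p1 (lt_trans a0).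
  by rewrite p01 aP.
rewrite -/(tail h a) E /tail -ge0_integralZl//; last 2 first.
- by apply: (measurable_tail mQr) => //; exact: ltW.
- move=> p; rewrite /= in_itv /= => /andP[ap p1]; rewrite lee_fin Qr0//.
  by rewrite p1 (lt_trans a0).
Qed.

Section on_space.
Context d (T : measurableType d) (P : probability T R).
Variables (U X : T -> R) (D : set T).
Hypothesis uU : uniform01 P U.
Hypothesis mD : measurable D.
Hypothesis D01 : forall w, D w -> 0 < U w < 1.
Hypothesis PD : P D = 1%E.
Hypothesis mX : measurable_fun setT X.
Hypothesis X0 : forall w, D w -> 0 <= X w.
Hypothesis XU : forall s t, D s -> D t -> X s < X t -> U s <= U t.

Let mU : measurable_fun setT U. Proof. by case: uU. Qed.

Lemma measurable_comp_uniform (f : R -> R) : measurable_fun (`]0, 1[%classic : set R) f ->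
  measurable_fun D (fun w => f (U w)).
Proof.
move=> mf; refine (measurable_comp (F := (`]0, 1[%classic : set R)) _ _ mf _) => //.
- by move=> _ [w /D01 /= w01 <-]; rewrite in_itv.
- exact: measurable_funTS.
Qed.

Lemma integral_comonotone_le :
  (\int[P]_(w in D) (h (U w) * X w)%:E <=
   lambda%:E * \int[P]_(w in D) (Qr (U w) * X w)%:E)%E.
Proof.
have mhU := measurable_comp_uniform mh.
have mQU := measurable_comp_uniform mQr.
have mXD : measurable_fun D X by exact: measurable_funTS.
have hU0 w : D w -> 0 <= h (U w) by move=> /D01 /h0.
have QU0 w : D w -> 0 <= Qr (U w) by move=> /D01 /Qr0.
have mlQ : measurable_fun D (fun w => lambda * Qr (U w)) by exact: measurable_funM.
have lQ0 w : D w -> 0 <= lambda * Qr (U w) by move=> Dw; rewrite mulr_ge0 ?QU0// ltW.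
rewrite -ge0_integralZl//; last 2 first.
- by apply/measurable_EFinP; exact: measurable_funM.
- by move=> w Dw; rewrite lee_fin mulr_ge0 ?QU0 ?X0.
rewrite [leRHS](_ : _ = \int[P]_(w in D) (lambda * Qr (U w) * X w)%:E)%E; last first.
  by apply: eq_integral => w _; rewrite -EFinM mulrA.
rewrite (ge0_layer_cake P mD mXD mhU X0 hU0) (ge0_layer_cake P mD mXD mlQ X0 lQ0).
apply: ge0_le_integral.
- exact: measurable_itv.
- by move=> z _; apply: integral_ge0 => w [Dw _]; rewrite lee_fin hU0.
- exact: (measurable_layer P mD mhU mXD hU0).
- exact: (measurable_layer P mD mlQ mXD lQ0).
move=> z _; pose S := D `&` [set w | z < X w].
have mS : measurable S.
  by apply: measurableI => //; exact: measurable_set_ltr.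
rewrite -/S; have [S0|S0] := eqVneq S set0; first by rewrite S0 !integral_set0.
have [|||b b01 Hb] := @uniform01_upper_tail _ _ _ P U D uU mD D01 PD S mS.
- by move=> w [].
- exact/set0P.
- move=> s t [Ds zs] Dt nSt; apply: XU => //; apply: le_lt_trans zs => /=.
  by rewrite leNgt; apply/negP => zt; apply: nSt.
rewrite (Hb _ mh h0).
apply: le_trans (tail_le b01) _; rewrite -(Hb _ mQr Qr0).
rewrite -ge0_integralZl//.
- apply/measurable_EFinP; apply: measurable_funS mQU => //; by move=> w [].
- by move=> w [Dw _]; rewrite lee_fin QU0.
Qed.

Section objective.
Variables (v0 : R -> R -> R) (x : R).
Hypothesis v0_ge0 : forall y p, 0 <= v0 y p.
Hypothesis v0_tangent : forall y p, 0 < p < 1 ->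
  v0 (Qb p) p + h p * Qb p <= v0 y p + h p * y.
Hypothesis v0_tangent_strict : forall y p, 0 < p < 1 -> y != Qb p ->
  v0 (Qb p) p + h p * Qb p < v0 y p + h p * y.
Hypothesis mvQb : measurable_fun (`]0, 1[%classic : set R) (fun p => v0 (Qb p) p).
Hypothesis mvX : measurable_fun D (fun w => v0 (X w) (U w)).
Hypothesis vQb_fin : (\int[leb]_(p in `]0%R, 1%R[) (v0 (Qb p) p)%:E < +oo)%E.
Hypothesis budget_Qb : (\int[leb]_(p in `]0%R, 1%R[) (Qr p * Qb p)%:E = x%:E)%E.
Hypothesis budget_X : (\int[P]_(w in D) (Qr (U w) * X w)%:E <= x%:E)%E.

Let gap w := v0 (X w) (U w) + h (U w) * X w - (v0 (Qb (U w)) (U w) + h (U w) * Qb (U w)).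

Let mhU : measurable_fun D (fun w => h (U w)). Proof. exact: measurable_comp_uniform. Qed.
Let mQbU : measurable_fun D (fun w => Qb (U w)). Proof. exact: measurable_comp_uniform. Qed.
Let mvQbU : measurable_fun D (fun w => v0 (Qb (U w)) (U w)).
Proof. exact: (measurable_comp_uniform mvQb). Qed.
Let mXD : measurable_fun D X. Proof. exact: measurable_funTS. Qed.

Let mgap : measurable_fun D gap.
Proof.
apply: measurable_funB; first by apply: measurable_funD => //; exact: measurable_funM.
by apply: measurable_funD => //; exact: measurable_funM.
Qed.

Let gap0 w : D w -> 0 <= gap w.
Proof. by move=> Dw; rewrite subr_ge0; apply: v0_tangent; exact: D01. Qed.

(** [gap] is the excess over the tangent at the candidate. Its definition is integrated as an
    identity between sums of non-negative terms, valid even with infinite integrals, and only the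
    finite number [lambda * x] is cancelled. *)
Lemma gap_bound : (\int[leb]_(p in `]0%R,
  1%R[) (v0 (Qb p) p)%:E + \int[P]_(w in D) (gap w)%:E <=
  \int[P]_(w in D) (v0 (X w) (U w))%:E)%E.
Proof.
have i01 (p : R) : `]0, 1[%classic p -> 0 < p < 1 by rewrite /= in_itv.
have AE : (\int[P]_(w in D) (v0 (Qb (U w)) (U w))%:E = \int[leb]_(p in `]0%R,
  1%R[) (v0 (Qb p) p)%:E)%E.
  apply: (@uniform01_integral_full _ _ _ P U D uU mD D01 PD (fun p => (v0 (Qb p) p)%:E)).
    exact/measurable_EFinP.
  by move=> p _; rewrite lee_fin.
have BE : (\int[P]_(w in D) (h (U w) * Qb (U w))%:E = (lambda * x)%:E)%E.
  rewrite EFinM -budget_Qb -integral_Qb_eq.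
  apply: (@uniform01_integral_full _ _ _ P U D uU mD D01 PD (fun p => (h p * Qb p)%:E)).
    by apply/measurable_EFinP; exact: measurable_funM.
  by move=> p p01; rewrite lee_fin mulr_ge0 ?h0 ?Qb0.
have B'le : (\int[P]_(w in D) (h (U w) * X w)%:E <= (lambda * x)%:E)%E.
  by apply: le_trans integral_comonotone_le _; rewrite EFinM lee_wpmul2l.
have hQ0 w : D w -> 0 <= h (U w) * Qb (U w) by move=> /D01 p01; rewrite mulr_ge0 ?h0 ?Qb0.
have hX0 w : D w -> 0 <= h (U w) * X w by move=> Dw; rewrite mulr_ge0 ?X0 ?h0 ?D01.
have mhQ : measurable_fun D (fun w => h (U w) * Qb (U w)) by exact: measurable_funM.
have mhX : measurable_fun D (fun w => h (U w) * X w) by exact: measurable_funM.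
have E : (\int[P]_(w in D) (v0 (Qb (U w)) (U w))%:E + \int[P]_(w in D) (h (U w) * Qb (U w))%:E
    + \int[P]_(w in D) (gap w)%:E =
  \int[P]_(w in D) (v0 (X w) (U w))%:E + \int[P]_(w in D) (h (U w) * X w)%:E)%E.
  rewrite -!ge0_integralD//.
  all: try (by apply/measurable_EFinP).
  all: try (by move=> w Dw; rewrite lee_fin ?hQ0 ?hX0 ?gap0 ?addr_ge0 ?hQ0).
  - by apply: eq_integral => w _; rewrite -!EFinD; congr EFin; rewrite /gap; ring.
  - by apply/measurable_EFinP; exact: measurable_funD.
rewrite -AE -(@leeD2rE _ (lambda * x)%:E)//.
rewrite addeAC -BE E; apply: leeD => //; by rewrite BE.
Qed.

Lemma objective_le : (\int[leb]_(p in `]0%R, 1%R[) (v0 (Qb p) p)%:E <=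
  \int[P]_(w in D) (v0 (X w) (U w))%:E)%E.
Proof.
apply: le_trans gap_bound; rewrite leeDl//.
by apply: integral_ge0 => w Dw; rewrite lee_fin gap0.
Qed.

(** The finite value of the candidate can be cancelled in [gap_bound], so [gap] has integral 0 and
    vanishes almost surely; strictness of the tangent inequality then leaves only [X = Qb (U)]. *)
Lemma objective_eq : (\int[P]_(w in D) (v0 (X w) (U w))%:E <=
    \int[leb]_(p in `]0%R, 1%R[) (v0 (Qb p) p)%:E)%E ->
  {ae P, forall w, D w -> X w = Qb (U w)}.
Proof.
move=> le.
have fin : (\int[leb]_(p in `]0%R, 1%R[) (v0 (Qb p) p)%:E)%E \is a fin_num.
  by rewrite ge0_fin_numE//; apply: integral_ge0 => p _; rewrite lee_fin.
have g0 : (\int[P]_(w in D) (gap w)%:E = 0)%E.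
  apply/eqP; rewrite eq_le; apply/andP; split; last first.
    by apply: integral_ge0 => w Dw; rewrite lee_fin gap0.
  by have := le_trans gap_bound le; rewrite -[leRHS]adde0 leeD2lE.
have /ae_eq_integral_abs : measurable_fun D (EFin \o gap) by exact/measurable_EFinP.
move=> /(_ P mD) [+ _] => /(_ _) [].
  rewrite -[RHS]g0; apply: eq_integral => w; rewrite inE => Dw /=.
  by rewrite ger0_norm ?gap0.
move=> N [mN N0 HN]; exists N; split => // w /= nw; apply: HN => /= H; apply: nw => Dw.
have := H Dw => /eqP; rewrite eqe => /eqP gw.
apply/eqP; apply: contraT => ne.
by have := v0_tangent_strict (D01 Dw) ne; rewrite -subr_gt0 -/(gap w) gw ltxx.
Qed.

End objective.

End on_space.
End core.

(** * Adaptedness of the pricing kernel *)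

Section parametric_Rintegral.
Context (R : realType) d (T : measurableType d) (D : set R) (f : R * T -> R).
Local Notation leb := (@lebesgue_measure R).
Hypothesis mD : measurable D.
Hypothesis mf : measurable_fun (D `*` setT) f.

(** Tonelli makes the integrals of the positive and the negative part measurable in the parameter.
    [fine] of their difference is the real integral at every parameter, including those where it
    takes a default value. *)
Lemma measurable_parametric_Rintegral :
  measurable_fun setT (fun w => \int[leb]_(s in D) f (s, w)).
Proof.
have mDT : measurable (D `*` [set: T]) by exact: measurableX.
pose g : R * T -> \bar R := (EFin \o f) \_ (D `*` setT).
have mg : measurable_fun setT g.
  by apply/(measurable_restrictT _ _).1 => //; exact/measurable_EFinP.
have gE w : (fun s => g (s, w)) = (fun s => (f (s, w))%:E) \_ D.
  apply/funext => s; rewrite /g; have [Ds|Ds] := pselect (D s).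
    by rewrite !erestrict_in.
  by rewrite !erestrict_out//; case.
have mp : measurable_fun setT (fun w => \int[leb]_s g^\+ (s, w))%E.
  exact: (@measurable_fun_fubini_tonelli_G _ _ _ _ _ leb (g^\+)%E
    (measurable_funepos mg) (funepos_ge0 g)).
have mn : measurable_fun setT (fun w => \int[leb]_s g^\- (s, w))%E.
  exact: (@measurable_fun_fubini_tonelli_G _ _ _ _ _ leb (g^\-)%E
    (measurable_funeneg mg) (funeneg_ge0 g)).
have E : (fun w => \int[leb]_(s in D) f (s, w)) =
    fine \o (fun w => \int[leb]_s g^\+ (s, w) - \int[leb]_s g^\- (s, w))%E.
  apply/funext => w; rewrite /Rintegral /=; congr fine.
  rewrite integral_mkcond -gE [LHS]integralE; congr (_ - _)%E;
    by apply: eq_integral => s _; rewrite ?funeposE ?funenegE.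
rewrite E; apply: measurableT_comp; first exact: fine_measurable.
exact: emeasurable_funB.
Qed.

End parametric_Rintegral.

Section adapted.
Context {R : realType} {d : measure_display} {Omega : measurableType d}
  (P : probability Omega R) (m : nat) (W : 'I_m -> R -> Omega -> R) (T : R).
Hypothesis T0 : 0 <= T.
Local Notation FT := (augmented_filtration P W T).
Local Notation OmegaT := (g_sigma_algebraType (filtration_gen P W T)).

Lemma measurable_wrtP (X : Omega -> R) : measurable_wrt FT X <->
  measurable_fun (setT : set OmegaT) (X : OmegaT -> R).
Proof.
split => [mX _ A mA|mX A mA]; first by rewrite setTI; exact: mX.
by have := mX measurableT A mA; rewrite setTI.
Qed.

Lemma measurable_wrt_comp (X : Omega -> R) (g : R -> R) : measurable_fun setT g ->
  measurable_wrt FT X -> measurable_wrt FT (g \o X).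
Proof.
move=> mg mX A mA; apply: (mX (g @^-1` A)).
by rewrite -[X in measurable X]setTI; exact: mg.
Qed.

Variables (r : R -> Omega -> R) (theta : 'I_m -> R -> Omega -> R) (I : R -> Omega -> R).
Hypothesis r_prog : progressively_measurable P W T r.
Hypothesis theta_prog : forall i, progressively_measurable P W T (theta i).
Hypothesis I_ito : ito_integral P W T theta I.

(** Progressive measurability at the final time is joint measurability with respect to the Borel
    sets of [[0, T]] and [FT], which survives integration over time. This is what makes the
    candidate claim admissible. *)
Lemma pricing_kernel_adapted : measurable_wrt FT (fun w =>
  expR (- (\int[lebesgue_measure]_(s in `[0, T]) (r s w + 2^-1 * sqnorm theta s w)) - I T w)).
Proof.
have TT : 0 <= T <= T by rewrite T0 lexx.
apply/measurable_wrtP; apply: measurableT_comp => //.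
apply: measurable_funB; last by apply/measurable_wrtP; exact: (I_ito.1 T TT).
apply: measurableT_comp => //.
apply: (@measurable_parametric_Rintegral R _ OmegaT `[0, T]%classic
  (fun z => r z.1 z.2 + 2^-1 * sqnorm theta z.1 z.2)) => //.
apply: measurable_funD; first exact: r_prog.
apply: measurable_funM => //.
rewrite /sqnorm; apply: measurable_sum => i.
apply: measurable_funX; exact: theta_prog.
Qed.

End adapted.

(** * The equality case of the rearrangement inequality *)

Lemma addeI_fin (R : realDomainType) (a b c : \bar R) : (a \is a fin_num)%E ->
  (a + b = a + c)%E -> b = c.
Proof. by move=> fa abc; rewrite -(addeK b fa) -(addeK c fa) !(addeC _ a) abc. Qed.

Section antimonotone_unique.
Context d (T : measurableType d) (R : realType) (P : probability T R).
Local Notation leb := (@lebesgue_measure R).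
Variables (D : set T) (rho X Y : T -> R) (x : R).
Hypotheses (mD : measurable D) (mrho : measurable_fun setT rho)
  (mX : measurable_fun setT X) (mY : measurable_fun setT Y).
Hypothesis rho0 : forall w, 0 <= rho w.
Hypothesis rho_atomless : forall z, P [set w | rho w = z] = 0%E.
Hypothesis X0 : forall w, D w -> 0 <= X w.
Hypothesis Y0 : forall w, D w -> 0 <= Y w.
Hypothesis XY : forall z, P (D `&` [set w | z < X w]) = P (D `&` [set w | z < Y w]).
Hypothesis Yrho : forall s t, D s -> D t -> Y s < Y t -> rho t <= rho s.
Hypothesis EX : (\int[P]_(w in D) (rho w * X w)%:E <= x%:E)%E.
Hypothesis EY : (\int[P]_(w in D) (rho w * Y w)%:E = x%:E)%E.

Let SX z := D `&` [set w | z < X w].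
Let SY z := D `&` [set w | z < Y w].
Let mSX z : measurable (SX z).
Proof. by apply: measurableI => //; exact: measurable_set_ltr. Qed.
Let mSY z : measurable (SY z).
Proof. by apply: measurableI => //; exact: measurable_set_ltr. Qed.
Let phiX z := (\int[P]_(w in SX z) (rho w)%:E)%E.
Let phiY z := (\int[P]_(w in SY z) (rho w)%:E)%E.
Let mrhoS S : measurable_fun S (EFin \o rho).
Proof. by apply: measurable_funTS; exact/measurable_EFinP. Qed.

Let order z s t : (SY z `\` SX z) s -> (SX z `\` SY z) t -> rho s <= rho t.
Proof.
move=> [[Ds zs] _] [[Dt _] nt]; apply: Yrho => //.
apply: le_lt_trans zs => /=; rewrite leNgt; apply/negP => zt; exact: nt.
Qed.

(** [Y] is large where [rho] is small, so among sets of this probability its upper level set carries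
    the least mass of [rho]. *)
Let phi_le z : (phiY z <= phiX z)%E.
Proof.
apply: bathtub => //.
- exact: measurable_funTS.
- by rewrite /SY /SX XY.
- exact: order.
Qed.

(** A Markov bound: on the level set [rho] is at most [rho * Y / z], whose integral is finite. *)
Let phiY_fin z : 0 < z -> phiY z \is a fin_num.
Proof.
move=> z0; rewrite ge0_fin_numE; last by apply: integral_ge0 => w _; rewrite lee_fin.
apply: (@le_lt_trans _ _ ((z^-1)%:E * x%:E)%E); last by rewrite -EFinM ltry.
have zi : 0 <= z^-1 by rewrite invr_ge0 ltW.
have mrY S : measurable_fun S (fun w => (rho w * Y w)%:E).
  by apply: measurable_funTS; apply/measurable_EFinP; exact: measurable_funM.
rewrite -EY -ge0_integralZl//; last first.
  by move=> w Dw; rewrite lee_fin mulr_ge0// Y0.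
apply: (@le_trans _ _ (\int[P]_(w in SY z) ((z^-1)%:E * (rho w * Y w)%:E))%E).
  apply: ge0_le_integral => //.
  - by move=> w _; rewrite lee_fin.
  - exact: measurable_funeM.
  - move=> w [Dw zw]; rewrite -EFinM lee_fin mulrCA ler_peMr//.
    by rewrite mulrC ler_pdivlMr// mul1r ltW.
apply: ge0_subset_integral => //.
- exact: measurable_funeM.
- by move=> w Dw; rewrite -EFinM lee_fin !mulr_ge0// Y0.
- by move=> w [].
Qed.

(** By the layer cake the costs of [X] and [Y] are the integrals of [phiX] and [phiY] over the
    levels. The larger function has the smaller or equal integral, so the two agree almost
    everywhere. *)
Let phi_ae : {ae leb, forall z, 0 < z -> phiX z = phiY z}.
Proof.
have mD' : measurable (`]0, +oo[%classic : set R) by exact: measurable_itv.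
have mrhoD : measurable_fun D rho by exact: measurable_funTS.
have mphiX : measurable_fun (`]0, +oo[%classic : set R) phiX.
  by apply: (measurable_layer P) => //; exact: measurable_funTS.
have mphiY : measurable_fun (`]0, +oo[%classic : set R) phiY.
  by apply: (measurable_layer P) => //; exact: measurable_funTS.
have mXD : measurable_fun D X by exact: measurable_funTS.
have mYD : measurable_fun D Y by exact: measurable_funTS.
have rhoD w : D w -> 0 <= rho w by [].
move: EX EY; rewrite (ge0_layer_cake P mD mXD mrhoD X0 rhoD) (ge0_layer_cake P mD mYD mrhoD Y0
  rhoD).
rewrite -/phiX -/phiY => IX IY.
have pX0 z : (0 <= phiX z)%E by apply: integral_ge0 => w _; rewrite lee_fin.
have pY0 z : (0 <= phiY z)%E by apply: integral_ge0 => w _; rewrite lee_fin.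
have iX : leb.-integrable `]0, +oo[ phiX.
  apply/integrableP; split => //; under eq_integral do rewrite gee0_abs//.
  by apply: le_lt_trans IX _; exact: ltry.
have iY : leb.-integrable `]0, +oo[ phiY.
  apply/integrableP; split => //; under eq_integral do rewrite gee0_abs//.
  by rewrite [X in (X < _)%E]IY ltry.
have mB : measurable_fun (`]0, +oo[%classic : set R) (fun z => phiX z - phiY z)%E.
  exact: emeasurable_funB.
have dif z : `]0, +oo[%classic z -> (0 <= phiX z - phiY z)%E.
  by rewrite /= in_itv /= andbT => z0; rewrite sube_ge0 ?phi_le// phiY_fin ?orbT.
have I0 : (\int[leb]_(z in `]0%R, +oo[) `|phiX z - phiY z| = 0)%E.
  transitivity (\int[leb]_(z in `]0%R, +oo[) (phiX z - phiY z))%E.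
    by apply: eq_integral => z; rewrite inE => z0; rewrite gee0_abs// dif.
  apply/eqP; rewrite eq_le; apply/andP; split; last by apply: integral_ge0 => z /dif.
  rewrite integralB//.
  by rewrite [X in (_ - X)%E]IY lee_subel_addr// add0e.
have [N [mN N0 HN]] := (ae_eq_integral_abs leb mD' mB).1 I0.
exists N; split => // z /= nz; apply: HN => /= H; apply: nz => z0.
have zi : `]0, +oo[%classic z by rewrite /= in_itv /= z0.
by rewrite -[LHS](subeK (phiX z) (phiY_fin z0)) (H zi) add0e.
Qed.

(** After cancelling the finite common part, the two differences have equal probability and equal
    [rho]-mass. A constant [c] separates the values of [rho] on them, which forces [rho = c] almost
    everywhere on the first, a null event. *)
Let null_level z : 0 < z -> phiX z = phiY z ->
  P (SX z `\` SY z) = 0%E /\ P (SY z `\` SX z) = 0%E.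
Proof.
move=> z0 E.
have mA : measurable (SX z `\` SY z) by exact: measurableD.
have mB : measurable (SY z `\` SX z) by exact: measurableD.
have PE : P (SX z `\` SY z) = P (SY z `\` SX z).
  rewrite !measureD//; try by rewrite -ge0_fin_numE// fin_num_measure.
  by rewrite setIC; congr (_ - _)%E; exact: XY.
suff : P (SX z `\` SY z) = 0%E by move=> H; split => //; rewrite -PE.
have split_ A B : measurable A -> measurable B ->
    (\int[P]_(w in A) (rho w)%:E = \int[P]_(w in A `&` B) (rho w)%:E + \int[P]_(w in A `\` B)
      (rho w)%:E)%E.
  move=> mA' mB'; rewrite -ge0_integral_setU//.
  - congr (integral _ _ _); apply/seteqP; split => [w Aw|w [[]|[]]//].
    by have [Bw|Bw] := pselect (B w); [left|right].
  - exact: measurableI.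
  - exact: measurableD.
  - by move=> w _; rewrite lee_fin.
  - by apply/disj_setPS => w [[_ Bw] [_ nBw]].
have IE : (\int[P]_(w in SX z `\` SY z) (rho w)%:E = \int[P]_(w in SY z `\` SX z) (rho w)%:E)%E.
  have fI : (\int[P]_(w in SX z `&` SY z) (rho w)%:E)%E \is a fin_num.
    rewrite ge0_fin_numE; last by apply: integral_ge0 => w _; rewrite lee_fin.
    apply: (@le_lt_trans _ _ (phiY z)); last by rewrite -ge0_fin_numE ?phiY_fin//;
      apply: integral_ge0 => w _; rewrite lee_fin.
    apply: ge0_subset_integral => //; first exact: measurableI.
    by move=> w _; rewrite lee_fin.
  move: E; rewrite /phiX /phiY (split_ (SX z) (SY z))// (split_ (SY z) (SX z))// (setIC (SY z)).
  by move=> H; exact: (addeI_fin fI H).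
apply: contrapT => P0.
have Apos : (0 < P (SX z `\` SY z))%E by rewrite lt_neqAle measure_ge0 andbT eq_sym; apply/eqP.
have [t0 St0] : exists t, (SY z `\` SX z) t.
  apply: contrapT => nex; apply: P0; rewrite PE (_ : _ `\` _ = set0) ?measure0//.
  by apply/seteqP; split => // w Sw; apply: nex; exists w.
have [s0 Ss0] : exists t, (SX z `\` SY z) t.
  apply: contrapT => nex; apply: P0; rewrite (_ : _ `\` _ = set0) ?measure0//.
  by apply/seteqP; split => // w Sw; apply: nex; exists w.
(* If the differences were not null, both would be non-empty, so this supremum is genuine: it bounds
   [rho] from above on one and from below on the other. *)
pose c := sup [set rho w | w in SY z `\` SX z].
have hs : has_sup [set rho w | w in SY z `\` SX z].
  by split; [exists (rho t0), t0|exists (rho s0) => _ [w Sw <-]; exact: order Sw Ss0].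
have cY w : (SY z `\` SX z) w -> rho w <= c.
  by move=> Sw; apply: (ub_le_sup hs.2); exists w.
have cX w : (SX z `\` SY z) w -> c <= rho w.
  move=> Sw; apply: ge_sup; first exact: hs.1.
  by move=> _ [t St <-]; exact: order St Sw.
have c0 : 0 <= c by apply: le_trans (rho0 t0) (cY _ St0).
have I1 : (\int[P]_(w in SY z `\` SX z) (rho w)%:E <= c%:E * P (SX z `\` SY z))%E.
  rewrite PE -integral_cst//; apply: ge0_le_integral => //.
  by move=> w _; rewrite lee_fin.
have I2 : (\int[P]_(w in SX z `\` SY z) (rho w - c)%:E + c%:E * P (SX z `\` SY z) =
    \int[P]_(w in SX z `\` SY z) (rho w)%:E)%E.
  rewrite -integral_cst// -ge0_integralD//.
  - by apply: eq_integral => w _; rewrite -EFinD subrK.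
  - by move=> w Sw; rewrite lee_fin subr_ge0 cX.
  - by apply: measurable_funTS; apply/measurable_EFinP; exact: measurable_funB.
have I3 : (\int[P]_(w in SX z `\` SY z) `|(rho w - c)%:E| = 0)%E.
  rewrite (eq_integral (fun w => (rho w - c)%:E)); last first.
    by move=> w; rewrite inE => Sw; rewrite gee0_abs// lee_fin subr_ge0 cX.
  apply/eqP; rewrite eq_le; apply/andP; split; last first.
    by apply: integral_ge0 => w Sw; rewrite lee_fin subr_ge0 cX.
  have : (\int[P]_(w in SX z `\` SY z) (rho w - c)%:E + c%:E * P (SX z `\` SY z) <= c%:E * P
    (SX z `\` SY z))%E.
    by rewrite I2 IE.
  by rewrite -[leRHS]add0e leeD2rE// fin_numM// fin_num_measure.
have mrc : measurable_fun (SX z `\` SY z) (fun w => (rho w - c)%:E).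
  by apply: measurable_funTS; apply/measurable_EFinP; exact: measurable_funB.
have [N [mN N0 HN]] := (ae_eq_integral_abs P mA mrc).1 I3.
apply: P0; apply/eqP; rewrite eq_le measure_ge0 andbT.
have mc : measurable [set w | rho w = c] by exact: measurable_set_eqr.
apply: (@le_trans _ _ (P ([set w | rho w = c] `|` N))).
  apply: le_measure; rewrite ?inE//; first exact: measurableU.
  move=> w Sw; have [Nw|Nw] := pselect (N w); first by right.
  left; apply: contrapT => nc; apply: Nw; apply: HN => /= /(_ Sw) /eqP;
    rewrite eqe subr_eq0 => /eqP; exact: nc.
apply: (@le_trans _ _ (P [set w | rho w = c] + P N)%E); first exact: measureU2.
by rewrite [X in (X + _)%E](rho_atomless c) add0e N0.
Qed.

(** Almost every level is good, so one can be chosen between any two non-negative rationals. If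
    [X w] and [Y w] differ, some chosen level separates them and puts [w] in a null difference of
    level sets; countably many such sets remain null. *)
Lemma antimonotone_unique : {ae P, forall w, D w -> X w = Y w}.
Proof.
have [N [mN N0 HN]] := phi_ae.
have good (q : rat * rat) : exists z : R, 0 <= ratr q.1 :> R -> ratr q.1 < ratr q.2 :> R ->
    [/\ ratr q.1 < z, z < ratr q.2 & phiX z = phiY z].
  have [[q0 q12]|nq] := pselect (0 <= ratr q.1 :> R /\ ratr q.1 < ratr q.2 :> R); last first.
    by exists 0 => ? ?; exfalso; exact: nq.
  apply: contrapT => nz.
  have sub : `]ratr q.1, ratr q.2[%classic `<=` (N : set R).
    move=> z; rewrite /= in_itv /= => /andP[qz zq]; apply: HN => /= H.
    apply: nz; exists z => _ _; split => //; apply: H; exact: le_lt_trans qz.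
  have : (leb `]ratr q.1, ratr q.2[%classic <= leb N)%E by apply: le_measure; rewrite ?inE.
  by rewrite N0 lebesgue_measure_itv /= lte_fin q12 -EFinB lee_fin leNgt subr_gt0 q12.
have [z_ zP] := choice good.
(* Pairs of rationals are enumerated through [unpickle]; codes of no admissible pair contribute the
   empty set. *)
pose bad (n : nat) : set T := if (unpickle n : option (rat * rat)) is Some q then
  if (0 <= ratr q.1 :> R) && (ratr q.1 < ratr q.2 :> R) then
    (SX (z_ q) `\` SY (z_ q)) `|` (SY (z_ q) `\` SX (z_ q)) else set0 else set0.
have nbad n : P.-negligible (bad n).
  rewrite /bad; case: unpickle => [q|]; last exact: negligible_set0.
  case: ifPn => [/andP[q0 q12]|_]; last exact: negligible_set0.
  have [qz zq pE] := zP _ q0 q12.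
  have [PA PB] := null_level (le_lt_trans q0 qz) pE.
  apply: negligibleU; [exists (SX (z_ q) `\` SY (z_ q))|exists (SY (z_ q) `\` SX (z_ q))];
    split => //; exact: measurableD.
have : P.-negligible (\bigcup_n bad n) by exact: negligible_bigcup.
apply: negligibleS => w /= /not_implyP[Dw ne].
have pick (a b : R) : 0 <= a -> a < b -> exists q : rat * rat,
    [/\ 0 <= ratr q.1 :> R, ratr q.1 < ratr q.2 :> R, a < ratr q.1 & ratr q.2 < b].
  move=> a0 ab; have [q2] := rat_in_itvoo ab; rewrite in_itv /= => /andP[aq2 q2b].
  have [q1] := rat_in_itvoo aq2; rewrite in_itv /= => /andP[aq1 q12].
  by exists (q1, q2); split => //=; rewrite (le_trans a0)// ltW.
have inbad (q : rat * rat) : 0 <= ratr q.1 :> R -> ratr q.1 < ratr q.2 :> R ->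
    ((SX (z_ q) `\` SY (z_ q)) `|` (SY (z_ q) `\` SX (z_ q))) w -> (\bigcup_n bad n) w.
  move=> q0 q12 H; exists (pickle q); first exact: I.
  have E : unpickle (pickle q) = Some q := pickleK q.
  by rewrite /bad E q0 q12.
have : X w != Y w by apply/eqP.
rewrite neq_lt => /orP[lt|lt].
  have [q [q0 q12 Xq qY]] := pick _ _ (X0 Dw) lt.
  have [qz zq _] := zP _ q0 q12.
  apply: (inbad q) => //; right; split; first by split => //=; exact: lt_trans qY.
  by move=> [_ /=]; rewrite ltNge (ltW (lt_trans Xq qz)).
have [q [q0 q12 Xq qY]] := pick _ _ (Y0 Dw) lt.
have [qz zq _] := zP _ q0 q12.
apply: (inbad q) => //; left; split; first by split => //=; exact: lt_trans qY.
by move=> [_ /=]; rewrite ltNge (ltW (lt_trans Xq qz)).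
Qed.

End antimonotone_unique.

(** * The robust utility *)

(** Clamping the argument to [[0, 1]] extends monotonicity to the whole line, where it implies
    measurability. *)
Lemma measurable_homo01 (R : realType) (Q : R -> R) :
  (forall p q, 0 <= p -> p <= q -> q <= 1 -> Q p <= Q q) ->
  measurable_fun setT (fun p : R => Q (Num.min 1 (Num.max 0 p))).
Proof.
move=> Qh; apply: nondecreasing_measurable => // p q pq; apply: Qh.
- by rewrite le_min ler01 le_max lexx.
- by rewrite le_min !ge_min lexx /= ge_max !le_max lexx pq !orbT.
- by rewrite ge_min lexx.
Qed.

Lemma measurable_homo01_comp (R : realType) d (T : measurableType d) (U : T -> R) (Q : R -> R) :
  (forall p q, 0 <= p -> p <= q -> q <= 1 -> Q p <= Q q) ->
  measurable_fun setT U -> (forall w, 0 <= U w <= 1) -> measurable_fun setT (Q \o U).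
Proof.
move=> Qh mU U01; have -> : Q \o U = (fun p : R => Q (Num.min 1 (Num.max 0 p))) \o U.
  by apply/funext => w /=; have /andP[u0 u1] := U01 w; rewrite max_r// min_r.
by apply: measurableT_comp => //; exact: measurable_homo01.
Qed.

Lemma RV_of_measurable (R : realType) d (T : measurableType d) (P : probability T R) (f : T ->
  R) :
  measurable_fun setT f -> exists Y : {RV P >-> R}, forall w, Y w = f w.
Proof.
move=> mf; pose Y : {RV P >-> R} := HB.pack f (isMeasurableFun.Build _ _ _ _ f mf).
by exists Y.
Qed.

Section quantile_transform_law.
Context d (T : measurableType d) (R : realType) (P : probability T R).
Variable Y : {RV P >-> R}.
Local Notation Qth := (quantile01 (distr_fun Y)).
Hypothesis Qth_homo : forall p q, 0 <= p -> p <= q -> q <= 1 -> Qth p <= Qth q.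

(** Inside [(0, 1)] this is [quantile_law]. The extended quantile defines the copy at every sample
    point, and equality of distribution functions yields equality of laws. *)
Lemma quantile_transform_same_law (U : T -> R) : uniform01 P U -> (forall w, 0 <= U w <= 1) ->
  exists Y' : {RV P >-> R}, same_law Y' Y /\ forall w, Y' w = Qth (U w).
Proof.
move=> uU U01; have [mU _] := uU.
have [Y' Y'E] := RV_of_measurable P (measurable_homo01_comp Qth_homo mU U01).
exists Y'; split => //.
pose D := [set w | 0 < U w < 1].
have mD : measurable D by exact: measurable_set_itvoo.
have PD : P D = 1%E by exact: uniform01_ae.
have gtE z : P [set w | z < Y' w] = P [set w | z < Y w].
  transitivity (P (D `&` [set w | z < Y' w])).
    by symmetry; apply: prob_full => //; exact: measurable_set_ltr.
  rewrite -(quantile_law uU); congr (P _); apply/seteqP; split => w /= [w01]; rewrite Y'E /=;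
    by case/andP: (w01) => w0 w1; rewrite /quantile01 !leNgt w0 w1.
have dE z : distr_fun Y' z = distr_fun Y z.
  have : (1 - distr_fun Y' z)%:E = (1 - distr_fun Y z)%:E.
    by apply: etrans (prob_gt Y z); apply: etrans (gtE z); symmetry; exact: prob_gt.
  by move=> [] /addrI /oppr_inj.
move=> A mA.
have le1 (Z : {RV P >-> R}) z : distribution P Z `]-oo, z]%classic = (distr_fun Z z)%:E.
  rewrite distr_funE; congr (P _); apply/seteqP; split => w; by rewrite /= in_itv.
pose toR (Z : {RV P >-> R}) : {mfun T >-> measurableTypeR R} :=
  HB.pack (Z : T -> R) (isMeasurableFun.Build _ _ T (measurableTypeR R) Z (@measurable_funPT _
    _ _ _ Z)).
pose m1 := distribution P (toR Y'); pose m2 := distribution P (toR Y).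
transitivity (m1 A); first by [].
transitivity (m2 A); last by [].
apply: finite_measure_itvNyc_unique mA.
  by apply: (@le_lt_trans _ _ 1%E); [exact: probability_le1|exact: ltry].
move=> z; transitivity (distribution P Y' `]-oo, z]%classic); first by [].
by rewrite le1 dE -le1.
Qed.

End quantile_transform_law.

Lemma ge0_integral_lincomb (R : realType) d (T : measurableType d) (P : {measure set T ->
  \bar R})
    (D : set T) (a b : R) (f g : T -> R) : measurable D -> 0 <= a -> 0 <= b ->
  (forall w, D w -> 0 <= f w) -> (forall w, D w -> 0 <= g w) ->
  measurable_fun D f -> measurable_fun D g ->
  (\int[P]_(w in D) (a * f w + b * g w)%:E =
   a%:E * \int[P]_(w in D) (f w)%:E + b%:E * \int[P]_(w in D) (g w)%:E)%E.
Proof.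
move=> mD a0 b0 f0 g0 mf mg.
have mf' : measurable_fun D (EFin \o f) by exact/measurable_EFinP.
have mg' : measurable_fun D (EFin \o g) by exact/measurable_EFinP.
have f0' w : D w -> (0 <= (EFin \o f) w)%E by move=> Dw; rewrite lee_fin f0.
have g0' w : D w -> (0 <= (EFin \o g) w)%E by move=> Dw; rewrite lee_fin g0.
have H1 := ge0_integralZl P mD mf' f0' (a0 : (0 <= a%:E)%E).
have H2 := ge0_integralZl P mD mg' g0' (b0 : (0 <= b%:E)%E).
rewrite -H1 -H2.
rewrite -ge0_integralD//.
- by move=> w Dw; rewrite -EFinM lee_fin mulr_ge0// f0.
- by apply: measurable_funeM; exact/measurable_EFinP.
- by move=> w Dw; rewrite -EFinM lee_fin mulr_ge0// g0.
- by apply: measurable_funeM; exact/measurable_EFinP.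
Qed.

Section robust_utility.
Context d (T : measurableType d) (R : realType) (P : probability T R).
Context (mass : R) (F : cumulativeBounded 0 mass) (c C alpha : R).
Local Notation mu := (lebesgue_stieltjes_measure F).
Hypothesis c0 : 0 < c.
Hypothesis mu_fin : (mu `[c, C]%classic < +oo)%E.
Hypothesis mu_pos : (0 < mu `[c, C]%classic)%E.
Hypothesis mu_supp : mu (~` `[c, C]%classic) = 0%E.
Hypothesis alpha01 : 0 <= alpha <= 1.
Variable vartheta : {RV P >-> R}.
Local Notation Qth := (quantile01 (distr_fun vartheta)).
Hypothesis Qth_homo : forall p q, 0 <= p -> p <= q -> q <= 1 -> Qth p <= Qth q.
Local Notation M := (exp_moment F c C).
Variables (X U : T -> R) (D : set T).
Hypothesis mX : measurable_fun setT X.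
Hypothesis uU : uniform01 P U.
Hypothesis U01 : forall w, 0 <= U w <= 1.
Hypothesis mD : measurable D.
Hypothesis PD : P D = 1%E.
Hypothesis XU : forall s t, D s -> D t -> X s < X t -> U s <= U t.

Let mM0 : measurable_fun setT (M 0).
Proof.
exact: (M_measurable (exp_moment_tangent c0 mu_fin) (exp_moment_gt0 c0 mu_fin mu_pos)).
Qed.

Let mMXY (Y : T -> R) S : measurable_fun setT Y ->
  measurable_fun S (fun w => (M 0 (X w + Y w))%:E).
Proof.
move=> mY; apply: measurable_funTS; apply/measurable_EFinP.
by apply: measurableT_comp => //; exact: measurable_funD.
Qed.

Lemma expected_utilityE (Y : T -> R) : measurable_fun setT Y ->
  'E_P[(fun w => utility F (X w + Y w))]%E = (- \int[P]_(w in D) (M 0 (X w + Y w))%:E)%E.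
Proof.
move=> mY; rewrite unlock -(integral_full mD PD); last exact: mMXY.
rewrite -integral_ge0N; last by move=> w _; rewrite lee_fin ltW// exp_moment_gt0.
by apply: eq_integral => w _; rewrite (utilityE c0 mu_supp) EFinN.
Qed.

Lemma same_law_sublevel (Y Y' : {RV P >-> R}) z : same_law Y Y' ->
  P (D `&` [set w | Y w < z]) = P (D `&` [set w | Y' w < z]).
Proof.
move=> YY'.
have E (Z : {RV P >-> R}) : P (D `&` [set w | Z w < z]) = distribution P Z `]-oo, z[%classic.
  rewrite (prob_full mD _ PD); last exact: measurable_set_ltr.
  by congr (P _); apply/seteqP; split => w; rewrite /= in_itv.
by rewrite !E YY'.
Qed.

Let XU' s t : D s -> D t -> U s < U t -> X s <= X t.
Proof. by move=> Ds Dt st; rewrite leNgt; apply/negP => /(XU Dt Ds); rewrite leNgt st. Qed.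

(** Both extrema are attained, by the genuine random variables [Y0] and [Y1], so they are plain
    integrals and the mixture of the two is a single integral of [mixM]. *)
Lemma robust_utilityE : robust_utility (utility F) vartheta alpha X =
  (- \int[P]_(w in D) (mixM M Qth alpha 0 (X w) (U w))%:E)%E.
Proof.
have /andP[a0 a1] := alpha01.
have V01 w : 0 <= 1 - U w <= 1.
  by have /andP[u0 u1] := U01 w; rewrite subr_ge0 u1 lerBlDr lerDl.
have [Y0 [Y0v Y0E]] := quantile_transform_same_law Qth_homo uU U01.
have [Y1 [Y1v Y1E]] := quantile_transform_same_law Qth_homo (uniform01_onem uU) V01.
have mY (Y : {RV P >-> R}) : measurable_fun setT (Y : T -> R) by exact: measurable_funPT.
have infE : ereal_inf [set 'E_P[(fun w => utility F (X w + Y w))]%E |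
    Y in [set Y : {RV P >-> R} | same_law Y vartheta]] =
    (- \int[P]_(w in D) (M 0 (X w + Qth (U w)))%:E)%E.
  have E0 : (- \int[P]_(w in D) (M 0 (X w + Qth (U w)))%:E)%E =
      'E_P[(fun w => utility F (X w + Y0 w))]%E.
    have H : (\int[P]_(w in D) (M 0 (X w + Qth (U w)))%:E = \int[P]_(w in D) (M 0 (X w + Y0
      w))%:E)%E.
      by apply: eq_integral => w _; rewrite Y0E.
    rewrite H.
 symmetry.
 exact: (expected_utilityE (mY Y0)).
  apply/eqP; rewrite eq_le; apply/andP; split.
    by rewrite E0; apply: ereal_inf_lbound; exists Y0.
  apply: le_ereal_inf_tmp => _ [Y Yv <-].
  rewrite E0 (expected_utilityE (mY Y)) (expected_utilityE (mY Y0)) leeN2.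
  apply: (exp_moment_comonotone c0 mu_fin mD mX (mY Y) (mY Y0)).
    by move=> z; apply: same_law_sublevel => A mA; rewrite Yv// Y0v.
  move=> s t Ds Dt; rewrite !Y0E => Q; apply: XU' => //.
  rewrite ltNge; apply/negP => ts; move: Q; rewrite ltNge Qth_homo//.
    by case/andP: (U01 t).
  by case/andP: (U01 s).
have supE : ereal_sup [set 'E_P[(fun w => utility F (X w + Y w))]%E |
    Y in [set Y : {RV P >-> R} | same_law Y vartheta]] =
    (- \int[P]_(w in D) (M 0 (X w + Qth (1 - U w)))%:E)%E.
  have E1 : (- \int[P]_(w in D) (M 0 (X w + Qth (1 - U w)))%:E)%E =
      'E_P[(fun w => utility F (X w + Y1 w))]%E.
    have H : (\int[P]_(w in D) (M 0 (X w + Qth (1 - U w)))%:E = \int[P]_(w in D) (M 0 (X w + Y1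
      w))%:E)%E.
      by apply: eq_integral => w _; rewrite Y1E.
    rewrite H.
 symmetry.
 exact: (expected_utilityE (mY Y1)).
  apply/eqP; rewrite eq_le; apply/andP; split; last first.
    by rewrite E1; apply: ereal_sup_ubound; exists Y1.
  apply: ge_ereal_sup => _ [Y Yv <-].
  rewrite E1 (expected_utilityE (mY Y)) (expected_utilityE (mY Y1)) leeN2.
  apply: (exp_moment_antimonotone c0 mu_fin mD mX (mY Y) (mY Y1)).
    by move=> z; apply: same_law_sublevel => A mA; rewrite Yv// Y1v.
  move=> s t Ds Dt; rewrite !Y1E => Q; apply: XU' => //.
  rewrite ltNge; apply/negP => ts; move: Q; rewrite ltNge Qth_homo//.
  - by case/andP: (V01 t).
  - by rewrite lerD2l lerN2.
  - by case/andP: (V01 s).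
rewrite /robust_utility infE supE !muleN.
have mI (Z : {RV P >-> R}) : measurable_fun D (fun w => (M 0 (X w + Z w))%:E) by exact: mMXY.
have Mpos x : 0 < M 0 x by exact: exp_moment_gt0.
have M0 x : (0 <= (M 0 x)%:E)%E by rewrite lee_fin ltW// exp_moment_gt0.
have m0 : measurable_fun D (fun w => M 0 (X w + Qth (U w))).
  apply/measurable_EFinP.
  by have := mI Y0; congr (measurable_fun _ _); apply/funext => w; rewrite Y0E.
have m1 : measurable_fun D (fun w => M 0 (X w + Qth (1 - U w))).
  apply/measurable_EFinP.
  by have := mI Y1; congr (measurable_fun _ _); apply/funext => w; rewrite Y1E.
have a1' : 0 <= 1 - alpha by rewrite subr_ge0.
have E := ge0_integral_lincomb P mD a1' a0 (fun w _ => ltW (Mpos _)) (fun w _ => ltW (Mpos _))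
  m0 m1.
transitivity (- ((1 - alpha)%:E * \int[P]_(w in D) (M 0 (X w + Qth (U w)))%:E +
  alpha%:E * \int[P]_(w in D) (M 0 (X w + Qth (1 - U w)))%:E))%E; last first.
  by rewrite -E.
(* Negation distributes over the sum even for infinite values because both terms are
   non-negative. *)
rewrite oppeD// ge0_adde_def// inE mule_ge0// ?lee_fin ?subr_ge0//; apply: integral_ge0 => w _;
  exact: M0.
Qed.

End robust_utility.

(** * The threshold below which the candidate vanishes *)

Section pbar.
Context (R : realType) (u Qth Qrho : R -> R) (lambda : R).
Hypothesis lambda0 : 0 < lambda.
Hypothesis du0 : 0 < derive1 u (Qth 0).
Hypothesis Qrho_homo : forall p q, 0 < p -> p <= q -> q < 1 -> Qrho p <= Qrho q.
Hypothesis Qrho_0 : Qrho p @[p --> 0^'+] --> (0 : R).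
Hypothesis Qrho_1 : Qrho p @[p --> 1^'-] --> +oo.
Let S := [set p : R | 0 < p < 1 /\ derive1 u (Qth 0) <= lambda * Qrho (1 - p)].

Let S_mem : exists2 p : R, 0 < p < 1 & S p.
Proof.
move/cvgryPge : Qrho_1 => /(_ (derive1 u (Qth 0) / lambda)) [e /= e0 He].
pose q : R := 1 - Num.min (e / 2) (1 / 2).
have m0 : 0 < Num.min (e / 2) (1 / 2) by rewrite lt_min !divr_gt0.
have m1 : Num.min (e / 2) (1 / 2) <= 1 / 2 by rewrite ge_min lexx orbT.
have me : Num.min (e / 2) (1 / 2) <= e / 2 by rewrite ge_min lexx.
have q01 : 0 < 1 - q < 1 by apply/andP; split; rewrite /q; lra.
exists (1 - q) => //; split => //; rewrite mulrC -ler_pdivrMr// subKr.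
apply: He; last by rewrite /q; lra.
by rewrite /= /q subKr gtr0_norm//; lra.
Qed.

Let S_gap : exists2 p1 : R, 0 < p1 < 1 & forall p, S p -> p <= p1.
Proof.
have dl : 0 < derive1 u (Qth 0) / lambda by rewrite divr_gt0.
move/cvgrPdist_lt : Qrho_0 => /(_ _ dl) [e /= e0 He].
pose q : R := Num.min (e / 2) (1 / 2).
have m0 : 0 < q by rewrite lt_min !divr_gt0.
have m1 : q <= 1 / 2 by rewrite ge_min lexx orbT.
have me : q <= e / 2 by rewrite ge_min lexx.
exists (1 - q); first by apply/andP; split; lra.
move=> p [/andP[p0 p1] H]; rewrite leNgt; apply/negP => qp.
have := He q; rewrite /= !sub0r !normrN gtr0_norm// => /(_ _ m0).
have qe : q < e by lra.
move=> /(_ qe) Hq.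
have Hp : Qrho (1 - p) <= Qrho q by apply: Qrho_homo; lra.
move: H; rewrite mulrC -ler_pdivrMr// => H.
by have := lt_le_trans (le_lt_trans (ler_norm _) Hq) (le_trans H Hp); rewrite ltxx.
Qed.

(** The defining set is non-empty because [Qrho] blows up at 1, and stays away from 1 because [Qrho]
    tends to 0 at 0. *)
Lemma pbar_itv : 0 < pbar u Qth Qrho lambda < 1.
Proof.
have [p /andP[p0 _] Sp] := S_mem; have [p1 /andP[_ p11] HS] := S_gap.
apply/andP; split.
  by apply: (lt_le_trans p0); apply: ub_le_sup => //; exists p1.
by apply: le_lt_trans p11; apply: ge_sup => //; exists p.
Qed.

(** Monotonicity of [Qrho] makes the defining set downward closed in [(0, 1)], so it contains every
    positive point below its supremum. *)
Lemma pbar_le p : 0 < p < pbar u Qth Qrho lambda -> derive1 u (Qth 0) <= lambda * Qrho (1 - p).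
Proof.
move=> /andP[p0 pb]; have [p' _ Sp'] := S_mem.
have hs : has_sup S by split; [exists p'|have [p1 _ HS] := S_gap; exists p1].
have [q [/andP[q0 q1] Hq] pq] : exists2 q, S q & p < q.
  apply: contrapT => nq; move: pb; rewrite ltNge => /negP; apply.
  apply: ge_sup; first by exists p'.
  by move=> q Sq; rewrite leNgt; apply/negP => pq; apply: nq; exists q.
apply: (le_trans Hq); rewrite ler_pM2l//; apply: Qrho_homo; lra.
Qed.

End pbar.

(** * Optimality *)

Lemma measurable_closed_unit (R : realType) (f : R -> R) :
  measurable_fun (`]0, 1[%classic : set R) f -> measurable_fun (`[0, 1]%classic : set R) f.
Proof.
move=> mf; have -> : `[0, 1]%classic = `]0, 1[%classic `|` ([set 0] `|` [set 1]) :> set R.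
  apply/seteqP; split => p /=; rewrite !in_itv /=.
    move=> /andP[]; rewrite le_eqVlt => /predU1P[<- _|p0]; first by right; left.
    by rewrite le_eqVlt => /predU1P[->|->]; [right; right|left; rewrite p0].
  by move=> [/andP[p0 p1]|[->|->]]; rewrite ?ler01 ?lexx ?ltW.
apply/measurable_funU => //; first by apply: measurableU; exact: measurable_set1.
split => //; apply/measurable_funU; try exact: measurable_set1.
by split; exact: measurable_fun_set1.
Qed.

Lemma right_continuous_lt (R : realType) (Q Q' : R -> R) (p : R) : 0 < p < 1 ->
  Q q @[q --> p^'+] --> Q p -> (forall q, p <= q -> q < 1 -> Q' p <= Q' q) -> Q p < Q' p ->
  exists2 q, p < q < 1 & forall s, p < s < q -> Q s < Q' s.
Proof.
move=> /andP[p0 p1] Qc Q'h lt.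
have d0 : 0 < Q' p - Q p by rewrite subr_gt0.
move/cvgrPdist_lt : Qc => /(_ _ d0) [e /= e0 He].
pose m : R := Num.min e (1 - p).
have m0 : 0 < m by rewrite lt_min e0 subr_gt0.
have me : m <= e by rewrite ge_min lexx.
have m1 : m <= 1 - p by rewrite ge_min lexx orbT.
exists (p + m / 2); first by apply/andP; split; lra.
move=> s /andP[ps sq]; have := He s; rewrite /= distrC gtr0_norm ?subr_gt0// => /(_ _ ps).
have se : s - p < e by lra.
move=> /(_ se); rewrite distrC => /(le_lt_trans (ler_norm _)) H.
have s1 : s < 1 by lra.
have := Q'h s (ltW ps) s1; lra.
Qed.

(** A strict inequality between the two functions at [p] persists on some interval to the right, by
    right continuity of the smaller and monotonicity of the larger. [U] visits this interval with
    positive probability. *)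
Lemma uniform01_ae_eq (R : realType) d (T : measurableType d) (P : probability T R) (U : T -> R)
    (D : set T) (Q Q' : R -> R) : uniform01 P U -> P.-negligible (~` D) -> Qplus Q ->
      Qplus Q' ->
  {ae P, forall w, D w -> Q (U w) = Q' (U w)} -> forall p, 0 < p < 1 -> Q p = Q' p.
Proof.
move=> uU nD QQ QQ' aeQ p p01.
have key Q1 Q2 : Qplus Q1 -> Qplus Q2 -> {ae P, forall w, D w -> Q1 (U w) = Q2 (U w)} ->
    Q1 p < Q2 p -> False.
  move=> [_ _ Q1c] [_ Q2h _] H12 lt.
  have [p0 p1] := andP p01.
  have Qh q : p <= q -> q < 1 -> Q2 p <= Q2 q by exact: Q2h.
  have [q /andP[pq q1] Hq] := right_continuous_lt p01 (Q1c p p01) Qh lt.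
  have neg : P.-negligible (U @^-1` `]p, q[%classic).
    apply: negligibleS (negligibleU nD H12) => w /=; rewrite in_itv /= => wpq.
    have [Dw|nDw] := pselect (D w); [right => /= /(_ Dw) E|by left].
    by have := Hq _ wpq; rewrite E ltxx.
  have mS : measurable (U @^-1` `]p, q[%classic).
    by rewrite -[X in measurable X]setTI; apply: uU.1 => //; exact: measurable_itv.
  have S0 : P (U @^-1` `]p, q[%classic) = 0%E by exact/(negligibleP P mS).
  have := uniform01_law uU (measurable_itv `]p, q[); rewrite S0 (_ : _ `&` _ = `]p, q[%classic).
    by rewrite lebesgue_measure_itv /= lte_fin pq => -[] /eqP;
      rewrite eq_sym subr_eq0 (gt_eqF pq).
  apply/setIidPl => s /=; rewrite !in_itv /= => /andP[ps sq].
  by rewrite (lt_trans p0 ps) ltW// (lt_trans sq).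
apply/eqP; rewrite eq_le; apply/andP; split; rewrite leNgt; apply/negP => lt.
  by apply: (key Q' Q QQ' QQ _ lt); apply: filterS aeQ => w H Dw; rewrite H.
exact: (key Q Q' QQ QQ' aeQ lt).
Qed.

Section optimality.
Context (R : realType) d (T : measurableType d) (P : probability T R).
Local Notation leb := (@lebesgue_measure R).
Variables (rho : {RV P >-> R}) (h Qb : R -> R) (lambda x : R).
Local Notation Frho := (distr_fun rho).
Local Notation Qrho := (quantile Frho).
Local Notation Qr := (fun p : R => Qrho (1 - p)).
Hypothesis rho_ge0 : forall w, 0 <= rho w.
Hypothesis rho_atomless : forall z, P [set w | rho w = z] = 0%E.
Hypothesis lambda0 : 0 < lambda.
Hypothesis mh : measurable_fun (`]0, 1[%classic : set R) h.
Hypothesis mQr : measurable_fun (`]0, 1[%classic : set R) Qr.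
Hypothesis h0 : forall p, 0 < p < 1 -> 0 <= h p.
Hypothesis Qr0 : forall p, 0 < p < 1 -> 0 <= Qr p.
Hypothesis QbQ : Qplus Qb.
Hypothesis tail_le : forall a, 0 <= a < 1 -> (tail h a <= lambda%:E * tail Qr a)%E.
Hypothesis tail_eq : forall z, 0 < z -> (exists2 p, 0 < p < 1 & z < Qb p) ->
  exists2 a, 0 < a < 1 & tail h a = (lambda%:E * tail Qr a)%E /\
    forall p, 0 < p < 1 -> (z < Qb p) = (a < p).
Variable v0 : R -> R -> R.
Hypothesis v0_ge0 : forall y p, 0 <= v0 y p.
Hypothesis v0_tangent : forall y p, 0 < p < 1 ->
  v0 (Qb p) p + h p * Qb p <= v0 y p + h p * y.
Hypothesis v0_tangent_strict : forall y p, 0 < p < 1 -> y != Qb p ->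
  v0 (Qb p) p + h p * Qb p < v0 y p + h p * y.
Hypothesis mv0Q : forall Q, measurable_fun (`]0, 1[%classic : set R) Q ->
  measurable_fun (`]0, 1[%classic : set R) (fun p => v0 (Q p) p).
Hypothesis mv0X : forall X U : T -> R, measurable_fun setT X -> measurable_fun setT U ->
  (forall w, 0 <= U w <= 1) -> measurable_fun setT (fun w => v0 (X w) (U w)).
Hypothesis v0_fin : (\int[leb]_(p in `]0%R, 1%R[) (v0 (Qb p) p)%:E < +oo)%E.
Hypothesis budget_Qb : quantile_budget Qrho Qb = x%:E.

Let xi (w : T) : R := 1 - Frho (rho w).
Let D0 : set T := [set w | 0 < xi w < 1].

Let xi_uniform : uniform01 P xi.
Proof.
have := @lex_rank_uniform _ _ _ P (cst 0) rho (measurable_cst _) (measurable_funPT rho)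
  rho_atomless.
by rewrite lex_rank_cst.
Qed.

Let xi01 w : 0 <= xi w <= 1.
Proof. by rewrite subr_ge0 distr_fun_le1 lerBlDr lerDl distr_fun_ge0. Qed.

Let m01 (U : T -> R) : measurable_fun setT U -> measurable [set w | 0 < U w < 1].
Proof. exact: measurable_set_itvoo. Qed.

Let mxi : measurable_fun setT xi. Proof. by case: xi_uniform. Qed.
Let mD0 : measurable D0. Proof. exact: m01. Qed.
Let PD0 : P D0 = 1%E. Proof. exact: uniform01_ae. Qed.
Let mrho : measurable_fun setT (rho : T -> R). Proof. exact: measurable_funPT. Qed.

Let Qplus_measurable Q : Qplus Q -> measurable_fun (`]0, 1[%classic : set R) Q.
Proof. by move=> [_ Qh _]; exact: homo_measurable_itv. Qed.

Let mQb : measurable_fun (`]0, 1[%classic : set R) Qb. Proof. exact: Qplus_measurable. Qed.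
Let Qb0 p : 0 < p < 1 -> 0 <= Qb p. Proof. by case: QbQ => H _ _; exact: H. Qed.
Let Qb_h p q : 0 < p -> p <= q -> q < 1 -> Qb p <= Qb q. Proof. by case: QbQ => _ H _;
  exact: H. Qed.

Let budgetE : (\int[leb]_(p in `]0%R, 1%R[) (Qr p * Qb p)%:E = x%:E)%E.
Proof. by rewrite -budget_Qb; apply: eq_integral => p _; rewrite mulrC. Qed.

Let v0_Qb_uniform U D : uniform01 P U -> measurable D -> (forall w, D w -> 0 < U w < 1) ->
  P D = 1%E -> (\int[P]_(w in D) (v0 (Qb (U w)) (U w))%:E =
    \int[leb]_(p in `]0%R, 1%R[) (v0 (Qb p) p)%:E)%E.
Proof.
move=> uU mD D01 PD.
apply: (uniform01_integral_full uU mD D01 PD (f := fun p => (v0 (Qb p) p)%:E)).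
  by apply/measurable_EFinP; exact: mv0Q.
by move=> p _; rewrite lee_fin.
Qed.

Section competitor.
Variables (Q : R -> R) (QQ : Qplus Q) (budget_Q : quantile_budget Qrho Q = x%:E).

(** A quantile function becomes a claim, which turns the quantile problem into an instance of the
    comparison on the sample space. The restriction discards junk values of [Q] outside [(0, 1)]. *)
Let X : T -> R := (Q \o xi) \_ D0.
Let mX : measurable_fun setT X.
Proof.
apply/(measurable_restrictT _ _).1 => //.
by apply: (measurable_comp_uniform xi_uniform) => //; exact: Qplus_measurable.
Qed.
Let XE w : D0 w -> X w = Q (xi w). Proof. by move=> Dw; rewrite /X restrict_in. Qed.
Let X0 w : D0 w -> 0 <= X w. Proof. by move=> Dw; rewrite XE//; case: QQ => H _ _;
  exact: H. Qed.
Let XU s t : D0 s -> D0 t -> X s < X t -> xi s <= xi t.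
Proof.
move=> Ds Dt; rewrite !XE// => lt; rewrite leNgt; apply/negP => ts.
case: QQ => _ Qh _; move: lt; rewrite ltNge Qh//; [|exact: ltW|].
  by case/andP: Dt.
by case/andP: Ds.
Qed.
Let budget_X : (\int[P]_(w in D0) (Qr (xi w) * X w)%:E <= x%:E)%E.
Proof.
rewrite -budget_Q le_eqVlt; apply/orP; left; apply/eqP.
have mf : measurable_fun (`]0, 1[%classic : set R) (fun p : R => (Q p * Qr p)%:E).
  by apply/measurable_EFinP; apply: measurable_funM => //; exact: Qplus_measurable.
have f0 p : 0 < p < 1 -> (0 <= (Q p * Qr p)%:E)%E.
  by move=> p01; rewrite lee_fin mulr_ge0 ?Qr0//; case: QQ => H _ _; exact: H.
rewrite /quantile_budget -(uniform01_integral_full xi_uniform mD0 _ PD0 mf f0)//.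
by apply: eq_integral => w; rewrite inE => Dw; rewrite XE// mulrC.
Qed.

Let value_X : (\int[P]_(w in D0) (v0 (X w) (xi w))%:E =
  \int[leb]_(p in `]0%R, 1%R[) (v0 (Q p) p)%:E)%E.
Proof.
have mf : measurable_fun (`]0, 1[%classic : set R) (fun p : R => (v0 (Q p) p)%:E).
  by apply/measurable_EFinP; apply: mv0Q; exact: Qplus_measurable.
have f0 p : 0 < p < 1 -> (0 <= (v0 (Q p) p)%:E)%E by rewrite lee_fin.
rewrite -(uniform01_integral_full xi_uniform mD0 _ PD0 mf f0)//.
by apply: eq_integral => w; rewrite inE => Dw; rewrite XE.
Qed.

Let mvX : measurable_fun D0 (fun w => v0 (X w) (xi w)).
Proof. by apply: measurable_funTS; exact: mv0X. Qed.

Lemma quantile_value_le : (\int[leb]_(p in `]0%R, 1%R[) (v0 (Qb p) p)%:E <=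
  \int[leb]_(p in `]0%R, 1%R[) (v0 (Q p) p)%:E)%E.
Proof.
rewrite -value_X.
exact: (objective_le lambda0 mh mQr mQb h0 Qr0 Qb0 tail_le tail_eq xi_uniform mD0
  (fun w H => H) PD0 mX X0 XU v0_ge0 v0_tangent (mv0Q mQb) mvX budgetE budget_X).
Qed.

Lemma quantile_value_eq : (\int[leb]_(p in `]0%R, 1%R[) (v0 (Q p) p)%:E <=
  \int[leb]_(p in `]0%R, 1%R[) (v0 (Qb p) p)%:E)%E -> forall p, 0 < p < 1 -> Q p = Qb p.
Proof.
rewrite -value_X => le.
have ae := objective_eq lambda0 mh mQr mQb h0 Qr0 Qb0 tail_le tail_eq xi_uniform mD0
  (fun w H => H) PD0 mX X0 XU v0_ge0 v0_tangent v0_tangent_strict (mv0Q mQb) mvX v0_fin budgetE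
    budget_X le.
apply: (uniform01_ae_eq xi_uniform (full_ae mD0 PD0) QQ QbQ).
by apply: filterS ae => w H Dw; rewrite -H// XE.
Qed.

End competitor.

Lemma quantile_optimal :
  optimal [set Q | Qplus Q /\ quantile_budget Qrho Q = x%:E]
    (fun Q => - \int[leb]_(p in `]0%R, 1%R[) (v0 (Q p) p)%:E)%E Qb /\
  forall Q, optimal [set Q | Qplus Q /\ quantile_budget Qrho Q = x%:E]
    (fun Q => - \int[leb]_(p in `]0%R, 1%R[) (v0 (Q p) p)%:E)%E Q ->
  forall p, 0 < p < 1 -> Q p = Qb p.
Proof.
split; first by split => // Q [QQ bQ]; rewrite leeN2; exact: quantile_value_le.
move=> Q [[QQ bQ] Qopt]; apply: quantile_value_eq => //.
by rewrite -leeN2; apply: Qopt.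
Qed.

Let Xbar w := Qb (xi w).

Let mXbar : measurable_fun setT Xbar.
Proof.
refine (measurable_comp (F := (`[0,
  1]%classic : set R)) _ _ (measurable_closed_unit mQb) mxi) => //.
by move=> _ [w _ <-]; rewrite /= in_itv /= xi01.
Qed.

Let Xbar0 w : D0 w -> 0 <= Xbar w. Proof. exact: Qb0. Qed.

Let Xbar_rho s t : D0 s -> D0 t -> Xbar s < Xbar t -> rho t <= rho s.
Proof.
move=> Ds Dt lt; rewrite leNgt; apply/negP => st; move: lt; rewrite ltNge /Xbar Qb_h//.
- by case/andP: Dt.
- by rewrite lerD2l lerN2; apply: distr_fun_homo; exact: ltW.
- by case/andP: Ds.
Qed.

Let Xbar_xi s t : D0 s -> D0 t -> Xbar s < Xbar t -> xi s <= xi t.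
Proof. by move=> Ds Dt /(Xbar_rho Ds Dt) ts; rewrite lerD2l lerN2; exact: distr_fun_homo. Qed.

Let rho_level U D z : uniform01 P U -> measurable D -> (forall w, D w -> 0 < U w < 1) ->
  P D = 1%E -> P (D `&` [set w | z < Qr (U w)]) = P (D `&` [set w | z < rho w]).
Proof.
move=> uU mD D01 PD; have uV := uniform01_onem uU.
transitivity (P [set w | z < rho w]); last first.
  by symmetry; apply: prob_full => //; exact: measurable_set_ltr.
rewrite -(quantile_law uV).
have mS : measurable [set w | 0 < 1 - U w < 1 /\ z < Qrho (1 - U w)].
  have -> : [set w | 0 < 1 - U w < 1 /\ z < Qrho (1 - U w)] =
      U @^-1` (`]0, 1[%classic `&` (Qr @^-1` `]z, +oo[%classic)).
    apply/seteqP; split => w /=; rewrite !in_itv /= andbT => -[/andP[u0 u1] zQ]; split => //;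
      apply/andP; split; lra.
  rewrite -[X in measurable X]setTI; apply: uU.1 => //; apply: mQr => //; exact: measurable_itv.
rewrite -(prob_full mD mS PD); congr (P _); apply/seteqP; split => w /= [Dw].
  move=> zQ; split => //; split => //; have /andP[u0 u1] := D01 w Dw; apply/andP; split; lra.
by move=> [].
Qed.

Let Qr_lt p q : 0 < p < 1 -> 0 < q < 1 -> Qr p < Qr q -> q <= p.
Proof.
move=> /andP[p0 p1] /andP[q0 q1] lt; rewrite leNgt; apply/negP => pq; move: lt; rewrite ltNge.
rewrite quantile_homo//; [exact: distr_fun_Ny|exact: distr_fun_y|..]; lra.
Qed.

Let mQrU U D : uniform01 P U -> (forall w, D w -> 0 < U w < 1) ->
  measurable_fun D (fun w => Qr (U w)).
Proof. by move=> uU D01; exact: (measurable_comp_uniform uU D01 mQr). Qed.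

(** [rho] and [Qr (xi)] have the same law and both are antimonotone with [Xbar], so each of the two
    costs is minimal and neither exceeds the other. The almost sure identity of [rho] and [Qr (xi)]
    is bypassed. *)
Lemma cost_Xbar : (\int[P]_(w in D0) (rho w * Xbar w)%:E = x%:E)%E.
Proof.
have mrD : measurable_fun D0 (rho : T -> R) by exact: measurable_funTS.
have mXD : measurable_fun D0 Xbar by exact: measurable_funTS.
have mQD : measurable_fun D0 (fun w => Qr (xi w)) by exact: mQrU.
have QD0 w : D0 w -> 0 <= Qr (xi w) by exact: Qr0.
have E : (\int[P]_(w in D0) (Xbar w * Qr (xi w))%:E = x%:E)%E.
  have mf : measurable_fun (`]0, 1[%classic : set R) (fun p : R => (Qb p * Qr p)%:E).
    by apply/measurable_EFinP; exact: measurable_funM.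
  have f0 p : 0 < p < 1 -> (0 <= (Qb p * Qr p)%:E)%E.
    by move=> p01; rewrite lee_fin mulr_ge0 ?Qr0// Qb0.
  by rewrite -budget_Qb /quantile_budget -(uniform01_integral_full xi_uniform mD0 _ PD0 mf f0).
have -> : (\int[P]_(w in D0) (rho w * Xbar w)%:E = \int[P]_(w in D0) (Xbar w * rho w)%:E)%E.
  by apply: eq_integral => w _; rewrite mulrC.
have lev z : P (D0 `&` [set w | z < Qr (xi w)]) = P (D0 `&` [set w | z < rho w]).
  exact: rho_level.
apply/eqP; rewrite eq_le -E; apply/andP; split.
  apply: integral_antimonotone_min => //.
  move=> s t Ds Dt st; rewrite leNgt; apply/negP => /(Xbar_rho Ds Dt); by rewrite leNgt st.
apply: integral_antimonotone_min => //.
move=> s t Ds Dt st; rewrite /Xbar; have ts := Qr_lt Ds Dt st.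
by apply: Qb_h => //; [case/andP: Dt|case/andP: Ds].
Qed.

Variables (FT : set (set T)) (J : (T -> R) -> \bar R).
Hypothesis FT_measurable : FT `<=` measurable.
Hypothesis Xbar_adapted : measurable_wrt FT Xbar.
Hypothesis JE : forall (X U : T -> R) (D : set T), measurable_fun setT X -> uniform01 P U ->
  (forall w, 0 <= U w <= 1) -> measurable D -> P D = 1%E ->
  (forall s t, D s -> D t -> X s < X t -> U s <= U t) ->
  J X = (- \int[P]_(w in D) (v0 (X w) (U w))%:E)%E.

Let feasible := [set X : T -> R | [/\ measurable_wrt FT X,
  ('E_P[(fun w => (rho w * X w)%R)] <= x%:E)%E & {ae P, forall w, 0 <= X w}]].

Let costE X D : measurable_fun setT X -> measurable D -> P D = 1%E ->
  'E_P[(fun w => (rho w * X w)%R)]%E = (\int[P]_(w in D) (rho w * X w)%:E)%E.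
Proof.
move=> mX mD PD; rewrite unlock -(integral_full mD PD)//.
by apply/measurable_EFinP; exact: measurable_funM.
Qed.

Let Xbar_feasible : feasible Xbar.
Proof.
split => //; first by rewrite (costE mXbar mD0 PD0) cost_Xbar.
by apply: filterS (full_ae mD0 PD0) => w; exact: Xbar0.
Qed.

Let J_Xbar : J Xbar = (- \int[leb]_(p in `]0%R, 1%R[) (v0 (Qb p) p)%:E)%E.
Proof. by rewrite (JE mXbar xi_uniform xi01 mD0 PD0 Xbar_xi) v0_Qb_uniform. Qed.

Section claim.
Variable X : T -> R.
Hypothesis feasX : feasible X.
Let U := lex_rank P X rho.
(** Non-negativity of [X] and [0 < U < 1] hold only almost surely; on [D] both hold pointwise. *)
Let D := [set w | 0 < U w < 1] `&` [set w | 0 <= X w].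

Let mX : measurable_fun setT X.
Proof. by move=> _ A mA; rewrite setTI; apply: FT_measurable; case: feasX => H _ _;
  exact: H. Qed.
Let uU : uniform01 P U. Proof. exact: lex_rank_uniform. Qed.
Let U01 w : 0 <= U w <= 1. Proof. by rewrite lex_rank_ge0 lex_rank_le1. Qed.
Let mXge : measurable [set w | 0 <= X w]. Proof. exact: measurable_set_ler. Qed.
Let mU : measurable_fun setT U. Proof. by case: uU. Qed.
Let mD : measurable D. Proof. by apply: measurableI => //; exact: m01. Qed.
Let PD : P D = 1%E.
Proof.
apply: full_setI => //; [exact: m01|exact: uniform01_ae|].
by apply: ae_full => //; case: feasX.
Qed.
Let D01 w : D w -> 0 < U w < 1. Proof. by case. Qed.
Let X0 w : D w -> 0 <= X w. Proof. by case. Qed.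
Let XU s t : D s -> D t -> X s < X t -> U s <= U t. Proof. by move=> _ _;
  exact: lex_rank_comonotone. Qed.
Let cost_X D' : measurable D' -> P D' = 1%E -> (\int[P]_(w in D') (rho w * X w)%:E <= x%:E)%E.
Proof. by move=> mD' PD'; rewrite -(costE mX mD' PD'); case: feasX. Qed.

Let budget_X : (\int[P]_(w in D) (Qr (U w) * X w)%:E <= x%:E)%E.
Proof.
apply: le_trans (cost_X mD PD).
have mrD : measurable_fun D (rho : T -> R) by exact: measurable_funTS.
have mXD : measurable_fun D X by exact: measurable_funTS.
have mQD : measurable_fun D (fun w => Qr (U w)) by exact: mQrU.
have QD0 w : D w -> 0 <= Qr (U w) by move=> Dw; apply: Qr0; exact: D01.
have sw (f : T -> R) : (\int[P]_(w in D) (f w * X w)%:E = \int[P]_(w in D) (X w * f w)%:E)%E.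
  by apply: eq_integral => w _; rewrite mulrC.
rewrite !sw; apply: integral_antimonotone_min => //.
  by move=> z _; exact: rho_level.
move=> s t Ds Dt st; rewrite leNgt; apply/negP => lt.
have ts := Qr_lt (D01 Ds) (D01 Dt) st; have {}lt := XU Ds Dt lt.
have E : U s = U t by apply/eqP; rewrite eq_le lt ts.
by move: st; rewrite E ltxx.
Qed.

Let mvX : measurable_fun D (fun w => v0 (X w) (U w)).
Proof. by apply: measurable_funTS; exact: mv0X. Qed.

Lemma J_le : (J X <= J Xbar)%E.
Proof.
rewrite J_Xbar (JE mX uU U01 mD PD XU) leeN2.
exact: (objective_le lambda0 mh mQr mQb h0 Qr0 Qb0 tail_le tail_eq uU mD
  D01 PD mX X0 XU v0_ge0 v0_tangent (mv0Q mQb) mvX budgetE budget_X).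
Qed.

(** The right-hand side depends on neither [V] nor [E], so [Qb (U)] and [Qb (xi)] have the same
    level probabilities. *)
Let level_Qb V E z : uniform01 P V -> measurable E -> (forall w, E w -> 0 < V w < 1) ->
  P E = 1%E -> P (E `&` [set w | z < Qb (V w)]) = leb (`]0, 1[%classic `&` Qb @^-1` `]z,
    +oo[%classic).
Proof.
move=> uV mE E01 PE; pose A : set R := `]0, 1[%classic `&` Qb @^-1` `]z, +oo[%classic.
have mA : measurable A by apply: mQb => //; exact: measurable_itv.
transitivity (P (V @^-1` A)).
  have mS : measurable (V @^-1` A) by rewrite -[X in measurable X]setTI; exact: uV.1.
  rewrite -(prob_full mE mS PE); congr (P _); apply/seteqP; split => w /= [Ew].
    by move=> zQ; split => //; rewrite /A /= !in_itv /= andbT; split => //; exact: E01.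
  by rewrite /A /= !in_itv /= andbT => -[].
rewrite (uniform01_law uV mA); congr (leb _); apply/setIidPl => p [] /=; rewrite !in_itv /=.
by move=> /andP[-> /ltW ->].
Qed.

Lemma J_eq : (J Xbar <= J X)%E -> {ae P, forall w, X w = Xbar w}.
Proof.
rewrite J_Xbar (JE mX uU U01 mD PD XU) leeN2 => le.
have ae := objective_eq lambda0 mh mQr mQb h0 Qr0 Qb0 tail_le tail_eq uU mD
  D01 PD mX X0 XU v0_ge0 v0_tangent v0_tangent_strict (mv0Q mQb) mvX v0_fin budgetE budget_X le.
(* Comparing the two claims requires [U] and [xi] to lie in [(0, 1)] on a common set of full
   probability. *)
pose D1 := D `&` D0.
have mD1 : measurable D1 by exact: measurableI.
have PD1 : P D1 = 1%E by exact: full_setI.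
have mQbU : measurable_fun D1 (fun w => Qb (U w)).
  by apply: (measurable_comp_uniform uU) => //; move=> w [/D01].
have lev z : P (D1 `&` [set w | z < X w]) = P (D1 `&` [set w | z < Xbar w]).
  transitivity (P (D1 `&` [set w | z < Qb (U w)])).
    have [N [mN N0 HN]] := ae.
    have m1 : measurable (D1 `&` [set w | z < X w]) by apply: measurableI => //;
      exact: measurable_set_ltr.
    have m2 : measurable (D1 `&` [set w | z < Qb (U w)]).
      have := mQbU mD1 _ (measurable_itv `]z, +oo[); congr (measurable _).
      by apply/seteqP; split => w /=; rewrite in_itv /= andbT.
    have PN : P (~` N) = 1%E.
      by apply: eq_trans (probability_setC P mN) _; rewrite [X in (_ - X)%E]N0 sube0.
    have mNC : measurable (~` N) by exact: measurableC.
    rewrite -(prob_full mNC m1 PN) -(prob_full mNC m2 PN); congr (P _).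
    have XN w : (~` N) w -> D1 w -> X w = Qb (U w).
      by move=> nN [Dw _]; apply: contrapT => ne; apply: nN; apply: HN => /= /(_ Dw).
    by apply/seteqP; split => w /= [nN [Dw zX]]; (split => //; split => //); move: zX;
      rewrite XN.
  rewrite (level_Qb z uU mD1 _ PD1); last by move=> w [/D01].
  by rewrite (level_Qb z xi_uniform mD1 _ PD1)//; move=> w [].
have X0' w : D1 w -> 0 <= X w by move=> [/X0].
have Xb0' w : D1 w -> 0 <= Xbar w by move=> [_]; exact: Xbar0.
have Xbr s t : D1 s -> D1 t -> Xbar s < Xbar t -> rho t <= rho s.
  by move=> [_ Ds] [_ Dt]; exact: Xbar_rho.
have EY : (\int[P]_(w in D1) (rho w * Xbar w)%:E = x%:E)%E.
  by rewrite -(costE mXbar mD1 PD1) (costE mXbar mD0 PD0) cost_Xbar.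
have := antimonotone_unique mD1 mrho mX mXbar rho_ge0 rho_atomless X0' Xb0' lev Xbr (cost_X mD1
  PD1) EY.
by have := full_ae mD1 PD1; apply: filterS2 => w Dw; apply.
Qed.

End claim.

Lemma claim_optimal : optimal feasible J Xbar /\
  forall X, optimal feasible J X -> {ae P, forall w, X w = Xbar w}.
Proof.
split; first by split => // X; exact: J_le.
by move=> X [feasX Xopt]; apply: J_eq => //; exact: Xopt.
Qed.

End optimality.

Section mixM_measurable.
Context (R : realType) (M : nat -> R -> R) (Qth : R -> R) (alpha : R).
Hypothesis M_tangent : forall n x y, M n x - (y - x) * M n.+1 x <= M n y.
Hypothesis M_gt0 : forall n x, 0 < M n x.
Hypothesis alpha01 : 0 <= alpha <= 1.
Hypothesis Qth_homo : forall p q, 0 <= p -> p <= q -> q <= 1 -> Qth p <= Qth q.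

Let mM n : measurable_fun setT (M n).
Proof. exact: M_measurable. Qed.

Lemma measurable_mixM n d (T : measurableType d) (D : set T) (X Y Z : T -> R) :
  measurable_fun D X -> measurable_fun D Y -> measurable_fun D Z ->
  measurable_fun D (fun w => (1 - alpha) * M n (X w + Y w) + alpha * M n (X w + Z w)).
Proof.
move=> mX mY mZ; apply: measurable_funD; apply: measurable_funM => //;
  by apply: measurableT_comp => //; exact: measurable_funD.
Qed.

Lemma measurable_mixM_itv n Q : measurable_fun (`]0, 1[%classic : set R) Q ->
  measurable_fun (`]0, 1[%classic : set R) (fun p => mixM M Qth alpha n (Q p) p).
Proof.
move=> mQ; have Qh p q : 0 < p -> p <= q -> q < 1 -> Qth p <= Qth q.
  by move=> p0 pq q1; apply: Qth_homo => //; exact: ltW.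
by apply: measurable_mixM => //; [exact: homo_measurable_itv|exact: Qr_measurable].
Qed.

Lemma measurable_mixM_comp n d (T : measurableType d) (X U : T -> R) :
  measurable_fun setT X -> measurable_fun setT U -> (forall w, 0 <= U w <= 1) ->
  measurable_fun setT (fun w => mixM M Qth alpha n (X w) (U w)).
Proof.
move=> mX mU U01; apply: measurable_mixM => //.
  exact: measurable_homo01_comp.
apply: (measurable_homo01_comp (U := fun w => 1 - U w)) => //.
  exact: measurable_funB.
by move=> w; have /andP[u0 u1] := U01 w; rewrite subr_ge0 u1 lerBlDr lerDl.
Qed.

(** For [Q >= 0] the integrand is at most the constant [M n (Qth 0)], since [M n] decreases and
    [Qth] is least at 0. This provides the finite value that uniqueness needs. *)
Lemma integral_mixM_fin n (Q : R -> R) : measurable_fun (`]0, 1[%classic : set R) Q ->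
  (forall p, 0 < p < 1 -> 0 <= Q p) ->
  (\int[lebesgue_measure]_(p in `]0%R, 1%R[) (mixM M Qth alpha n (Q p) p)%:E < +oo)%E.
Proof.
move=> mQ Q0.
apply: (@le_lt_trans _ _ (\int[lebesgue_measure]_(p in `]0%R,
  1%R[) (cst (M n (Qth 0))%:E p))%E).
  apply: ge0_le_integral => //.
  - by move=> p _; rewrite lee_fin ltW// mixM_gt0.
  - by apply/measurable_EFinP; exact: measurable_mixM_itv.
  - move=> p; rewrite /= in_itv /= => p01; rewrite lee_fin.
    apply: (le_trans (mixM_le M_tangent M_gt0 alpha01 Qth_homo n (Q p) _)).
      by case/andP: p01 => p0 p1; rewrite !ltW.
    by apply: (M_homo M_tangent M_gt0); rewrite lerDr Q0.
rewrite integral_cst//= lebesgue_measure_itv /= lte_fin ltr01 -EFinB subr0 mule1.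
exact: ltry.
Qed.

End mixM_measurable.

Lemma quantile_pos_ge0 (R : realType) d (T : measurableType d) (P : probability T R)
    (Y : {RV P >-> R}) p : (forall w, 0 < Y w) -> 0 < p < 1 -> 0 <= quantile (distr_fun Y) p.
Proof.
move=> Y0 p01; have /andP[p0 _] := p01.
have F0 : (distr_fun Y 0)%:E = 0%E :> \bar R.
  rewrite distr_funE; apply: etrans (measure0 P); congr (P _).
  by apply/seteqP; split => // w /=; rewrite leNgt Y0.
apply: (quantile_ge (@distr_fun_homo _ _ _ _ Y) (distr_fun_Ny Y) (distr_fun_y Y)) => //.
by case: F0 => ->; exact: ltW.
Qed.

Theorem theorem3p11 (R : realType) (d : measure_display)
  (Omega : measurableType d) (P : probability Omega R)
  (P_complete : measure_is_complete P)
  (m : nat) (W : 'I_m -> R -> Omega -> R) (W_bm : brownian_motion P W)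
  (T : R) (T_gt0 : 0 < T)
  (FT_proper : augmented_filtration P W T `<` (measurable : set (set Omega)))
  (mass : R) (mass_gt0 : 0 < mass) (F : cumulativeBounded 0 mass)
  (F_supp : exists K : set R, [/\ compact K, K `<=` `]0, +oo[ &
     lebesgue_stieltjes_measure F (~` K) = 0%E])
  (vartheta : {RV P >-> R})
  (Qth_lipschitz : exists k : R,
     k.-lipschitz_(`[0, 1]) (quantile01 (distr_fun vartheta)))
  (Qth_differentiable :
     differentiable_within `[0, 1] (quantile01 (distr_fun vartheta)))
  (alpha : R) (alpha_01 : 0 <= alpha <= 1)
  (r : R -> Omega -> R) (r_prog : progressively_measurable P W T r)
  (r_lb : exists c : R, {ae P, forall w, forall t, 0 <= t <= T -> c <= r t w})
  (r_int : {ae P, forall w,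
     lebesgue_measure.-integrable `[0, T] (EFin \o (r ^~ w))})
  (theta : 'I_m -> R -> Omega -> R)
  (theta_prog : forall i, progressively_measurable P W T (theta i))
  (theta_neq0 : exists i t w, 0 <= t <= T /\ theta i t w <> 0)
  (theta_sq : {ae P, forall w,
     (\int[lebesgue_measure]_(s in `[0%R, T]) (sqnorm theta s w)%:E < +oo)%E})
  (I : R -> Omega -> R) (I_ito : ito_integral P W T theta I)
  (Z_martingale : martingale P W T (fun t w =>
     expR (- I t w
           - 2^-1 * \int[lebesgue_measure]_(s in `[0, t]) sqnorm theta s w)))
  (rho : {RV P >-> R})
  (rhoE : forall w, rho w =
     expR (- (\int[lebesgue_measure]_(s in `[0, T])
                (r s w + 2^-1 * sqnorm theta s w)) - I T w))
  (Qrho_derivable : forall p, 0 < p < 1 ->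
     derivable (quantile (distr_fun rho)) p 1)
  (Qrho_C1 : forall p, 0 < p < 1 ->
     {for p, continuous (derive1 (quantile (distr_fun rho)))})
  (Qrho_0 : quantile (distr_fun rho) p @[p --> 0^'+] --> (0 : R))
  (Qrho_1 : quantile (distr_fun rho) p @[p --> 1^'-] --> +oo)
  (Frho_continuous : continuous (distr_fun rho))
  (x lambda : R) (x_gt0 : 0 < x) (lambda_gt0 : 0 < lambda) (H : R -> R) :
  let u := utility F in
  let Qth := quantile01 (distr_fun vartheta) in
  let Frho := distr_fun rho in
  let Qrho := quantile Frho in
  let V := Vfun u Qth alpha in
  let Qbar := fun p => Sfun V (derive1 H p) p in
  let Xbar := fun w => Qbar (1 - Frho (rho w)) in
  let feasibleQ := [set Q | Qplus Q /\ quantile_budget Qrho Q = x%:E] in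
  let feasibleX := [set X : Omega -> R |
    [/\ measurable_wrt (augmented_filtration P W T) X,
        ('E_P[(fun w => (rho w * X w)%R)] <= x%:E)%E &
        {ae P, forall w, 0 <= X w}]] in
  let J := robust_utility u vartheta alpha in
  solution V Qrho lambda (pbar u Qth Qrho lambda) H ->
  quantile_budget Qrho Qbar = x%:E ->
  (optimal feasibleQ (quantile_value V) Qbar /\
   forall Q, optimal feasibleQ (quantile_value V) Q ->
     forall p, 0 < p < 1 -> Q p = Qbar p) /\
  (optimal feasibleX J Xbar /\
   forall X, optimal feasibleX J X -> {ae P, forall w, X w = Xbar w}).
Proof.
move=> u Qth Frho Qrho V Qbar Xbar feasibleQ feasibleX J sol budget.
have [c [C [c0 mu_fin mu_pos mu_supp]]] := supported_itv mass_gt0 F_supp.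
have M_tangent := exp_moment_tangent c0 mu_fin.
have M_gt0 := exp_moment_gt0 c0 mu_fin mu_pos.
have M1_small := exp_moment1_small c0 mu_fin.
have M1_large := exp_moment1_large c0 mu_fin mu_pos.
have uE : forall y, u y = - exp_moment F c C 0 y := utilityE c0 mu_supp.
have [k [k0 Qth_lip]] := quantile01_lip Qth_lipschitz.
have Qth_homo := quantile01_homo (distr_fun_Ny vartheta) (distr_fun_y vartheta) Qth_lipschitz.
have Qth_der p : 0 < p < 1 -> derivable Qth p 1.
  exact: differentiable_within_derivable Qth_differentiable.
have JE : forall (X U : Omega -> R) (D : set Omega), measurable_fun setT X -> uniform01 P U ->
    (forall w, 0 <= U w <= 1) -> measurable D -> P D = 1%E ->
    (forall s t, D s -> D t -> X s < X t -> U s <= U t) ->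
    J X = (- \int[P]_(w in D) (mixM (exp_moment F c C) Qth alpha 0 (X w) (U w))%:E)%E.
  by move=> X U D mX uU U01 mD PD XU; exact: robust_utilityE.
(* From here on the mixture is an abstract tower [M] with the tangent inequalities, positivity and
   the range of [M 1]. *)
move: (exp_moment F c C) M_tangent M_gt0 M1_small M1_large uE JE => M M_tangent M_gt0 M1_small
  M1_large uE JE.
have du : derive1 u (Qth 0) = M 1 (Qth 0) by exact: (derive1_utility M_tangent M_gt0 uE).
have du0 : 0 < derive1 u (Qth 0) by rewrite du.
have Qrho_homo := quantile_homo (distr_fun_Ny rho) (distr_fun_y rho).
have rho_gt0 w : 0 < rho w by rewrite rhoE expR_gt0.
have Qrho_ge0 p : 0 < p < 1 -> 0 <= Qrho p by exact: quantile_pos_ge0.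
have pb01 := pbar_itv lambda_gt0 du0 Qrho_homo Qrho_0 Qrho_1.
have pb_le p : 0 < p < pbar u Qth Qrho lambda -> M 1 (Qth 0) <= lambda * Qrho (1 - p).
  by rewrite -du; exact: (pbar_le lambda_gt0 du0 Qrho_homo Qrho_0 Qrho_1).
have QbQ : Qplus Qbar.
  exact: (Qb_Qplus M_tangent M_gt0 alpha_01 Qth_homo M1_small M1_large Qth_der k0 Qth_lip uE
    pb01 sol).
have mQbar : measurable_fun (`]0, 1[%classic : set R) Qbar.
  by case: QbQ => _ Qh _; exact: homo_measurable_itv.
have h_gt0 := sol_h_gt0 sol.
pose v0 := mixM M Qth alpha 0.
have VE y p : V y p = - v0 y p by exact: (@VfunE R M Qth alpha u uE y p).
have SE p : 0 < p < 1 -> mixM M Qth alpha 1 (Qbar p) p = derive1 H p.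
  move=> p01; apply: (SfunP M_tangent M_gt0 alpha_01 Qth_homo M1_small M1_large uE).
    by case/andP: p01 => p0 p1; rewrite !ltW.
  exact: h_gt0.
have v0_tangent y p : 0 < p < 1 ->
    v0 (Qbar p) p + derive1 H p * Qbar p <= v0 y p + derive1 H p * y.
  move=> p01; have := Vfun_tangent Qth M_tangent alpha_01 uE (Qbar p) y p.
  rewrite -/V !VE SE//; lra.
have v0_tangent_strict y p : 0 < p < 1 -> y != Qbar p ->
    v0 (Qbar p) p + derive1 H p * Qbar p < v0 y p + derive1 H p * y.
  move=> p01; rewrite eq_sym => /(Vfun_tangent_strict Qth M_tangent M_gt0 alpha_01 uE p).
  rewrite -/V !VE SE//; lra.
have rho_atomless := continuous_distr_atomless Frho_continuous.
have valueE Q : quantile_value V Q = (- \int[lebesgue_measure]_(p in `]0%R,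
  1%R[) (v0 (Q p) p)%:E)%E.
  rewrite /quantile_value -integral_ge0N; last by move=> p _; rewrite lee_fin ltW// mixM_gt0.
  by apply: eq_integral => p _; rewrite VE EFinN.
have mv0Q Q : measurable_fun (`]0, 1[%classic : set R) Q ->
    measurable_fun (`]0, 1[%classic : set R) (fun p => v0 (Q p) p).
  exact: measurable_mixM_itv.
have mv0X (X U : Omega -> R) : measurable_fun setT X -> measurable_fun setT U ->
    (forall w, 0 <= U w <= 1) -> measurable_fun setT (fun w => v0 (X w) (U w)).
  exact: measurable_mixM_comp.
have v0_ge0 y p : 0 <= v0 y p by rewrite ltW// mixM_gt0.
have v0_fin : (\int[lebesgue_measure]_(p in `]0%R, 1%R[) (v0 (Qbar p) p)%:E < +oo)%E.
  by apply: integral_mixM_fin => //; case: QbQ.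
have mQr := Qr_measurable Qrho_homo.
have Qr0 := Qr_ge0 Qrho_ge0.
have h0 p : 0 < p < 1 -> 0 <= derive1 H p by move=> /h_gt0/ltW.
have T_le := tail_h_le M_tangent M_gt0 alpha_01 Qth_homo Qth_der uE lambda_gt0 pb01 pb_le
  Qrho_ge0 Qrho_homo sol.
have T_eq := tail_h_eq M_tangent M_gt0 alpha_01 Qth_homo M1_small M1_large Qth_der k0 Qth_lip uE
  lambda_gt0 pb01 pb_le Qrho_ge0 Qrho_homo sol.
have mh := h_measurable sol.
split.
  rewrite (_ : quantile_value V = fun Q => - \int[lebesgue_measure]_(p in `]0%R,
    1%R[) (v0 (Q p) p)%:E)%E; last first.
    by apply/funext => Q; exact: valueE.
  exact: (quantile_optimal rho_atomless lambda_gt0 mh mQr h0 Qr0 QbQ T_le T_eq v0_ge0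
    v0_tangent v0_tangent_strict mv0Q mv0X v0_fin budget).
apply: (claim_optimal (fun w => ltW (rho_gt0 w)) rho_atomless lambda_gt0 mh mQr h0 Qr0 QbQ T_le
  T_eq v0_ge0
    v0_tangent v0_tangent_strict mv0Q mv0X v0_fin budget FT_proper.1 _ JE).
(* The candidate claim is a Borel function of [rho], so it inherits its adaptedness. [1 - Frho z]
   may reach 0 or 1, hence the closed unit interval. *)
have mg : measurable_fun setT (fun z : R => Qbar (1 - Frho z)).
  refine (measurable_comp (F := (`[0,
    1]%classic : set R)) _ _ (measurable_closed_unit mQbar) _) => //.
    by move=> _ [w _ <-]; rewrite /= in_itv /= subr_ge0 distr_fun_le1 lerBlDr lerDl
      distr_fun_ge0.
  by apply: measurable_funB => //; exact: continuous_measurable_fun.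
apply: (measurable_wrt_comp mg).
have := pricing_kernel_adapted (ltW T_gt0) r_prog theta_prog I_ito.
by congr (measurable_wrt _ _); apply/funext => w; rewrite rhoE.
Qed.
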